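(* There is an absolute constant $c\in\mathbb{R}^+$, independent of all other quantities, such that the following holds. Let $\mathcal{M}\subset\mathbb{R}^N$ and $\epsilon\in(0,1)$. There exists a map $f:\mathbb{R}^N\to\mathbb{C}^m$ with $$m\le c\left(\frac{w(S_{\mathcal{M}})}{\epsilon}\right)^2$$ that satisfies $$\left|\,\|f(\mathbf{x})-f(\mathbf{y})\|_2^2-\|\mathbf{x}-\mathbf{y}\|_2^2\,\right|\le \epsilon\,\|\mathbf{x}-\mathbf{y}\|_2^2$$ for all $\mathbf{x}\in\mathcal{M}$ and $\mathbf{y}\in\mathbb{R}^N$.
   Context: The unit secants of $T\subset\mathbb{R}^N$ are $$S_T := \overline{\left\{\frac{\mathbf{x}-\mathbf{y}}{\|\mathbf{x}-\mathbf{y}\|_2} : \mathbf{x},\mathbf{y}\in T,\ \mathbf{x}\neq\mathbf{y}\right\}},$$ where the bar denotes closure in $\mathbb{R}^N$. The Gaussian width of a (nonempty) set $T\subset\mathbb{R}^N$ is $w(T):=\mathbb{E}\sup_{\mathbf{x}\in T}\langle\mathbf{g},\mathbf{x}\rangle$, where $\mathbf{g}$ is a random vector in $\mathbb{R}^N$ with i.i.d. Gaussian entries of mean $0$ and variance $1$. Since Gaussian width is only meaningful for nonempty sets, $w(S_{\mathcal{M}})$ presupposes that $S_{\mathcal{M}}\neq\emptyset$, i.e. that $\mathcal{M}$ has at least two points. *)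

(* Defs.v *)
From HB Require Import structures.
From mathcomp Require Import all_boot all_order all_algebra.
From mathcomp Require Import complex.
From mathcomp Require Import all_classical all_reals all_analysis.

Set Implicit Arguments.
Unset Strict Implicit.
Unset Printing Implicit Defensive.

Import Order.TTheory GRing.Theory Num.Theory numFieldNormedType.Exports.

Local Open Scope classical_set_scope.
Local Open Scope ring_scope.

Definition dotr {R : realType} {n : nat} (u v : 'rV[R]_n) : R :=
  \sum_(i < n) u 0 i * v 0 i.

(* The library norm on matrices is the maximum norm, hence these definitions
   of the Euclidean norms on R^n and C^n. *)
Definition l2norm {R : realType} {n : nat} (x : 'rV[R]_n) : R :=
  Num.sqrt (\sum_(i < n) x 0 i ^+ 2).

Definition cl2norm {R : realType} {n : nat} (z : 'rV[R[i]]_n) : R :=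
  Num.sqrt (\sum_(i < n) Normc.normc (z 0 i) ^+ 2).

(* The library topology on 'rV[R]_n is the product topology, that is, the
   Euclidean one. *)
Definition unit_secants {R : realType} {n : nat} (T : set 'rV[R]_n) :
    set 'rV[R]_n :=
  closure [set z | exists x y, [/\ T x, T y, x <> y &
                                   z = (l2norm (x - y))^-1 *: (x - y)]].

Section std_gaussian.
Context {R : realType}.

Definition tcons (n : nat) (xv : measurableTypeR R * n.-tuple (measurableTypeR R)) :
  n.+1.-tuple (measurableTypeR R) := [the n.+1.-tuple _ of xv.1 :: xv.2].

Lemma measurable_tcons n : measurable_fun [set: _] (@tcons n).
Proof. exact: measurable_cons. Qed.

HB.instance Definition _ n :=
  isMeasurableFun.Build _ _ _ _ (@tcons n) (@measurable_tcons n).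

(* Law of a vector of n i.i.d. N(0, 1) variables, i.e. the n-fold product of
   normal_prob 0 1; R^n appears here as n.-tuple R, which carries the product
   sigma-algebra in the library, while 'rV[R]_n has no measurable structure. *)
Fixpoint std_gaussian (n : nat) : probability (n.-tuple (measurableTypeR R)) R :=
  match n with
  | 0 => dirac [tuple]
  | n'.+1 => distribution (normal_prob 0 1 \x std_gaussian n')%E (@tcons n')
  end.

Lemma std_gaussian_box n (A : 'I_n -> set (measurableTypeR R)) :
  (forall i, measurable (A i)) ->
  std_gaussian n [set v | forall i, A i (tnth v i)] =
  (\prod_(i < n) normal_prob 0 1 (A i))%E.
Proof.
elim: n A => [|n IH] A mA.
  by rewrite big_ord0 /= diracE mem_set// => -[].
rewrite big_ord_recl -(IH (fun i => A (lift ord0 i)))//.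
have mB : measurable [set v : n.-tuple (measurableTypeR R) |
    forall i, A (lift ord0 i) (tnth v i)].
  rewrite (_ : mkset _ = \bigcap_(i in [set: 'I_n])
      ((fun v => tnth v i) @^-1` A (lift ord0 i))); last first.
    by apply/seteqP; split=> v /= h i *; exact: (h i).
  apply: fin_bigcap_measurable => // i _; rewrite -[X in measurable X]setTI.
  exact: measurable_tnth.
rewrite -product_measure1E//= /distribution /pushforward; congr (_ _).
apply/seteqP; split=> [[x v]/= h|[x v]/= [h0 h] i].
  split; first exact: (h ord0).
  by move=> i; have := h (lift ord0 i); rewrite tnthS.
by case: (unliftP ord0 i) => [j|] ->; [rewrite tnthS; exact: h|exact: h0].
Qed.

End std_gaussian.

(* E sup_{x in T} <g, x>, as an extended real: it is +oo for some unbounded T. *)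
Definition gaussian_width {R : realType} {n : nat} (T : set 'rV[R]_n) : \bar R :=
  (\int[std_gaussian n]_g
     ereal_sup [set (dotr (\row_(i < n) tnth g i) x)%:E | x in T])%E.

(* Main.v *)
Require Import Defs.
From mathcomp Require Import all_boot all_order all_algebra.
From mathcomp Require Import complex.
From mathcomp Require Import all_classical all_reals all_analysis.
From mathcomp Require Import perm measurable_realfun ring lra.

(** The map is assembled from a linear embedding of the secants and a dual
    correction for the points outside M.

    Linear part.  Let S be the set of unit secants of M and w its Gaussian
    width.  For an m x N matrix H of independent signs with m of order
    (w / e)^2, some realisation A = H / sqrt m satisfies
    | |A c|^2 - |c|^2 | <= e |c| for every c in the convex hull of S with
    |c| >= e (sign_embedding).  The error is proportional to |c| and not to 1;
    this is what yields the optimal power of e in m.  The proof works with the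
    normalised deviation (|H c|^2 - m |c|^2) / |c| over a finite net:
    - replacing H by an independent copy and sorting the entries by whether the
      two copies agree turns the deviation into the bilinear form <H c, H' c'>,
      c' = c / |c|, with H and H' independent (avg_norm_dev_le);
    - for fixed H this is a process in c whose increments are dominated by those
      of sqrt 2 <h, H c> + sqrt 8 R <g, c>, R the largest |H c'|.  A comparison
      principle of Sudakov-Fernique type (rad_comparison) then bounds it by
      C w (sqrt m + R) (avg_bilform_le);
    - R^2 is itself at most m plus the deviation divided by e, so the estimate
      closes on itself (avg_max_norm_dev_le).

    All averages above run over finitely many signs.  Normal variables are
    replaced by normalised sums of K signs, K a large power of two; the
    comparison principle is proved by exchanging one summand at a time in a
    soft maximum, where a second order expansion of log sum p_t exp x_t shows
    that only the increments matter up to O(K^(-1/2)).  The Gaussian measure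
    enters once, through rad_le_gaussian_width: N(0, 1) dominates an absolute
    multiple of the normalised sum of K signs in convex order, because it is
    stable under (g + g') / sqrt 2.

    Terminal part.  The embedding gives |c| <= |A c| + e on the convex hull of
    S, which is the dual form of the following: every v admits u, of norm
    about at most |v|, with <u, A s> within 2 e |v| of <v, s> for all s in S
    (dual_functional).  Such a u is A z for a near minimiser z of
    |A z|^2 / 2 - <v, z> + e |z|_S, with |.|_S the gauge of the convex hull.
    For a point p outside the closure of M let b in M be nearly closest to p,
    v = p - b, and set f p = (A b + u, sqrt (|v|^2 - |u|^2)), the root being 0 if
    |u| > |v|; on the closure f p = (A p, 0).  Expanding the squares gives the claim, since |v| and
    |x - b| are at most 2 |p - x| and 3 |p - x| for x in M. *)

Set Implicit Arguments.
Unset Strict Implicit.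
Unset Printing Implicit Defensive.

Import Order.TTheory GRing.Theory Num.Theory numFieldNormedType.Exports.
Import HBNNSimple.

Local Open Scope classical_set_scope.
Local Open Scope ring_scope.

(** * Averages over random signs *)

(** The empty average is 0; sign patterns are never empty, see [signs_gt0]. *)
Definition avg {R : realType} {W : finType} (f : W -> R) : R :=
  (\sum_w f w) / #|W|%:R.

Definition signs (I : finType) := {ffun I -> bool}.

Definition sgn {R : realType} (b : bool) : R := (-1) ^+ b.

Definition sgn_sum {R : realType} {I : finType} (s : signs I) (a : I -> R) : R :=
  \sum_i sgn (s i) * a i.

(** The neutral value 0 amounts to adding the zero vector to the index family; it makes
    [pmax] a nonnegative sublinear functional. *)
Definition pmax {R : realType} {T : finType} (v : T -> R) : R :=
  \big[Num.max/0]_t v t.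

Section avg.
Context {R : realType}.

Lemma eq_avg (W : finType) (f g : W -> R) : f =1 g -> avg f = avg g.
Proof. by move=> fg; congr (_ / _); apply: eq_bigr => w _. Qed.

Lemma avgD (W : finType) (f g : W -> R) :
  avg (fun w => f w + g w) = avg f + avg g.
Proof. by rewrite /avg big_split mulrDl. Qed.

Lemma avgZ (W : finType) (k : R) (f : W -> R) :
  avg (fun w => k * f w) = k * avg f.
Proof. by rewrite /avg -mulr_sumr mulrA. Qed.

Lemma avgZr (W : finType) (k : R) (f : W -> R) :
  avg (fun w => f w * k) = avg f * k.
Proof. by rewrite /avg -mulr_suml mulrAC. Qed.

Lemma avg_sum (W J : finType) (f : J -> W -> R) :
  avg (fun w => \sum_j f j w) = \sum_j avg (f j).
Proof. by rewrite /avg exchange_big mulr_suml. Qed.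

Lemma avg_exchange (W W' : finType) (f : W -> W' -> R) :
  avg (fun w => avg (f w)) = avg (fun w' => avg (f ^~ w')).
Proof.
by rewrite /avg -!mulr_suml exchange_big/= mulrAC.
Qed.

Lemma le_avg (W : finType) (f g : W -> R) :
  (forall w, f w <= g w) -> avg f <= avg g.
Proof.
by move=> fg; rewrite /avg ler_wpM2r ?invr_ge0// ler_sum.
Qed.

Lemma avg_ge0 (W : finType) (f : W -> R) : (forall w, 0 <= f w) -> 0 <= avg f.
Proof. by move=> f0; rewrite /avg divr_ge0// sumr_ge0. Qed.

Lemma avg_bij (W W' : finType) (h : W -> W') (f : W' -> R) :
  bijective h -> avg f = avg (f \o h).
Proof.
move=> bh; rewrite /avg (bij_eq_card bh); congr (_ / _).
by rewrite (reindex h)//; exact: onW_bij.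
Qed.

Lemma avg_pair (W W' : finType) (f : W -> W' -> R) :
  avg (fun w => avg (f w)) = avg (fun p : W * W' => f p.1 p.2).
Proof.
rewrite /avg -mulr_suml pair_big/= card_prod natrM invfM mulrA mulrAC//.
Qed.

Lemma avg_norm (W : finType) (f : W -> R) : `|avg f| <= avg (fun w => `|f w|).
Proof.
by rewrite /avg normrM normfV normr_nat ler_wpM2r ?invr_ge0// ler_norm_sum.
Qed.

Lemma signs_gt0 (I : finType) : (0 < #|signs I|)%N.
Proof. by apply/card_gt0P; exists [ffun=> false]. Qed.

Lemma avg_cst (W : finType) (k : R) : (0 < #|W|)%N -> avg (fun _ : W => k : R) = k.
Proof.
move=> W0; rewrite /avg sumr_const -[k *+ _]mulr_natr mulfK//.
by rewrite pnatr_eq0 -lt0n.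
Qed.

Lemma exists_le_avg (W : finType) (f : W -> R) : (0 < #|W|)%N ->
  exists w, f w <= avg f.
Proof.
move=> W0; apply: contrapT => /forallNP fw.
have {}fw w : avg f < f w by rewrite ltNge; apply/negP; exact: fw.
case/card_gt0P: (W0) => w0 _.
have : 0 < \sum_w (f w - avg f).
  rewrite (bigD1 w0)//= ltr_wpDr ?subr_gt0//.
  by apply: sumr_ge0 => w _; rewrite subr_ge0 ltW.
rewrite big_split/= sumrN sumr_const -[avg f *+ _]mulr_natr /avg divfK ?subrr ?ltxx//.
by rewrite pnatr_eq0 -lt0n.
Qed.

Lemma avg_sqr (W : finType) (f : W -> R) : (0 < #|W|)%N ->
  avg f ^+ 2 <= avg (fun w => f w ^+ 2).
Proof.
move=> W0; rewrite -subr_ge0.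
have -> : avg (fun w => f w ^+ 2) - avg f ^+ 2 =
    avg (fun w => (f w - avg f) ^+ 2).
  transitivity (avg (fun w => f w ^+ 2 + ((- (2 * avg f)) * f w + avg f ^+ 2))).
    by rewrite avgD avgD avgZ avg_cst//; ring.
  by apply: eq_avg => w; ring.
by apply: avg_ge0 => w; rewrite sqr_ge0.
Qed.

(** Symmetrisation arguments use this with [d] the indicator of the signs to be reversed. *)
Lemma avg_signs_xor (I : finType) (d : signs I) (f : signs I -> R) :
  avg f = avg (fun s : signs I => f [ffun i => s i (+) d i]).
Proof.
apply: (avg_bij (h := fun s : signs I => [ffun i => s i (+) d i] : signs I)).
by apply: inv_bij => s; apply/ffunP => i; rewrite !ffunE -addbA addbb addbF.
Qed.

Lemma avg_signs_inj (I J : finType) (e : J -> I) (f : signs J -> R) :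
  bijective e -> avg f = avg (fun s : signs I => f [ffun j => s (e j)]).
Proof.
move=> [e' e1 e2].
apply: (avg_bij (h := fun s : signs I => [ffun j => s (e j)] : signs J)).
exists (fun t : signs J => [ffun i => t (e' i)] : signs I) => s; apply/ffunP => i;
  by rewrite !ffunE ?e1 ?e2.
Qed.

Lemma avg_signs_sum (I J : finType) (f : signs I -> signs J -> R) :
  avg (fun s => avg (f s)) =
  avg (fun s : signs (I + J)%type => f [ffun i => s (inl i)] [ffun j => s (inr j)]).
Proof.
rewrite avg_pair.
apply: (avg_bij (h := fun s : signs (I + J)%type =>
  ([ffun i => s (inl i)], [ffun j => s (inr j)]) : signs I * signs J)).
exists (fun p : signs I * signs J =>
   [ffun z => match z with inl i => p.1 i | inr j => p.2 j end] : signs (I + J)%type).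
  by move=> s; apply/ffunP => -[i|j]; rewrite !ffunE.
by move=> [s t]; congr pair; apply/ffunP => i; rewrite !ffunE.
Qed.

Lemma sgn_xor a b : sgn (a (+) b) = sgn a * sgn b :> R.
Proof. by rewrite /sgn signr_addb. Qed.

Lemma sgn_sqr b : sgn b * sgn b = 1 :> R.
Proof. by rewrite -sgn_xor addbb. Qed.

Lemma eq_opp_eq0 (x : R) : x = - x -> x = 0.
Proof. by lra. Qed.

Lemma avg_sgn2 (I : finType) (i j : I) :
  avg (fun s : signs I => sgn (s i) * sgn (s j) : R) = (i == j)%:R.
Proof.
have [->|ij] := eqVneq i j.
  by under eq_avg do rewrite sgn_sqr; rewrite avg_cst ?signs_gt0.
apply: eq_opp_eq0; rewrite {1}(avg_signs_xor [ffun k => k == i]) -mulN1r -avgZ.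
  apply: eq_avg => s; rewrite !ffunE eqxx eq_sym (negbTE ij) addbF sgn_xor.
  by rewrite /sgn/= expr1; ring.
Qed.

Lemma avg_sgn_sum2 (I : finType) (a b : I -> R) :
  avg (fun s => sgn_sum s a * sgn_sum s b) = \sum_i a i * b i.
Proof.
transitivity (avg (fun s : signs I => \sum_i \sum_j (a i * b j) * (sgn (s i) * sgn (s j)))).
  apply: eq_avg => s; rewrite /sgn_sum big_distrlr/=.
  by apply: eq_bigr => i _; apply: eq_bigr => j _; ring.
rewrite avg_sum; apply: eq_bigr => i _; rewrite avg_sum.
rewrite (bigD1 i)//= big1 ?addr0; last first.
  by move=> j ji; rewrite avgZ avg_sgn2 eq_sym (negbTE ji) mulr0.
by rewrite avgZ avg_sgn2 eqxx mulr1.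
Qed.

Lemma avg_sgn_sum (I : finType) (a : I -> R) : avg (fun s => sgn_sum s a) = 0.
Proof.
apply: eq_opp_eq0; rewrite {1}(avg_signs_xor [ffun=> true]) -mulN1r -avgZ; apply: eq_avg => s.
  rewrite /sgn_sum mulr_sumr; apply: eq_bigr => i _.
  by rewrite !ffunE sgn_xor /sgn expr1; ring.
Qed.

(** Adding one sign at a time: averaging (S + a)^4 and (S - a)^4 leaves
    S^4 + 6 a^2 S^2 + a^4, and 3 A^2 + 6 A a^2 + a^4 <= 3 (A + a^2)^2. *)
Lemma avg_sgn_sum4 (I : finType) (a : I -> R) :
  avg (fun s => sgn_sum s a ^+ 4) <= 3 * (\sum_i a i ^+ 2) ^+ 2.
Proof.
pose S (r : seq I) (s : signs I) : R := \sum_(i <- r) sgn (s i) * a i.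
suff H (r : seq I) : uniq r ->
    avg (fun s => S r s ^+ 2) = \sum_(i <- r) a i ^+ 2 /\
    avg (fun s => S r s ^+ 4) <= 3 * (\sum_(i <- r) a i ^+ 2) ^+ 2.
  by have [] := H _ (index_enum_uniq I).
elim: r => [_|i r IH /=/andP[ir /IH[IH2 IH4]]].
  rewrite /S !big_nil; split.
    under eq_avg do rewrite big_nil expr0n/=.
    by rewrite avg_cst// signs_gt0.
  under eq_avg do rewrite big_nil expr0n/=.
  by rewrite avg_cst ?signs_gt0// expr0n mulr0.
(* Negating the sign at i leaves the sum over r unchanged, as i is not in r. *)
have flip (s : signs I) : S r [ffun k => s k (+) [ffun k => k == i] k] = S r s.
  apply: eq_big_seq => j jr; rewrite !ffunE.
  have /negbTE -> : j != i by apply: contraNneq ir => <-.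
  by rewrite addbF.
have Scons s : S (i :: r) s = sgn (s i) * a i + S r s by rewrite /S big_cons.
have E (n : nat) : avg (fun s => S (i :: r) s ^+ n) =
    avg (fun s => ((S r s + a i) ^+ n + (S r s - a i) ^+ n) / 2).
  have E1 : avg (fun s => S (i :: r) s ^+ n) =
    avg (fun s => (S (i :: r) s ^+ n + (S r s - sgn (s i) * a i) ^+ n) / 2).
    rewrite avgZr avgD -[X in (_ + X)](_ : avg (fun s => S (i :: r) s ^+ n) = _).
      by field.
    rewrite (avg_signs_xor [ffun k => k == i]); apply: eq_avg => s.
    rewrite Scons flip !ffunE eqxx sgn_xor /sgn expr1.
    by congr (_ ^+ n); ring.
  rewrite E1; apply: eq_avg => s; rewrite Scons.
  by case: (s i); rewrite /sgn ?expr1 ?expr0; congr (_ / 2); [rewrite addrC|];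
    congr (_ ^+ n + _ ^+ n); ring.
rewrite !big_cons; split.
  rewrite E -IH2 -[a i ^+ 2](avg_cst (a i ^+ 2) (signs_gt0 I)) -avgD.
  by apply: eq_avg => s; field.
rewrite E.
have -> : avg (fun s => ((S r s + a i) ^+ 4 + (S r s - a i) ^+ 4) / 2) =
    avg (fun s => S r s ^+ 4) + (6 * a i ^+ 2) * avg (fun s => S r s ^+ 2) + a i ^+ 4.
  rewrite -avgZ -[a i ^+ 4](avg_cst (a i ^+ 4) (signs_gt0 I)) -!avgD.
  by apply: eq_avg => s; field.
rewrite IH2; set A := \sum_(_ <- _) _ in IH4 *.
have := sqr_ge0 (a i ^+ 2); rewrite -!exprM/= => a4.
have : a i ^+ 4 = (a i ^+ 2) ^+ 2 by rewrite -exprM.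
nra.
Qed.

(** With q the standard deviation, |x| >= 3 x^2 / (4 q) - x^4 / (16 q^3) pointwise, since the
    difference has the factor (|x| / q - 2)^2; the fourth moment bound then leaves 9 q / 16. *)
Lemma khinchine (I : finType) (a : I -> R) :
  Num.sqrt (\sum_i a i ^+ 2) / 2 <= avg (fun s => `|sgn_sum s a|).
Proof.
set A := \sum_i _.
have A0 : 0 <= A by apply: sumr_ge0 => i _; exact: sqr_ge0.
have [Az|An] := eqVneq A 0.
  by rewrite Az sqrtr0 mul0r; apply: avg_ge0.
have Ap : 0 < A by rewrite lt_def An.
set q := Num.sqrt A.
have q0 : 0 < q by rewrite sqrtr_gt0.
have qq : q ^+ 2 = A by rewrite sqr_sqrtr.
have pt (x : R) : 3 / 4 / q * x ^+ 2 - (q ^+ 3)^-1 / 16 * x ^+ 4 <= `|x|.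
  have -> : x ^+ 2 = `|x| ^+ 2 by rewrite real_normK// num_real.
  have -> : x ^+ 4 = `|x| ^+ 4.
    by rewrite -[4%N]/(2 * 2)%N exprM [in RHS]exprM real_normK// num_real.
  set y := `|x|; have y0 : 0 <= y by exact: normr_ge0.
  rewrite -subr_ge0.
  have -> : y - (3 / 4 / q * y ^+ 2 - (q ^+ 3)^-1 / 16 * y ^+ 4) =
     (y / 16) * (y / q - 2) ^+ 2 * (y / q + 4).
    by field; rewrite gt_eqF.
  rewrite mulr_ge0//; first by rewrite mulr_ge0 ?sqr_ge0// divr_ge0.
  by rewrite addr_ge0// divr_ge0// ltW.
apply: (@le_trans _ _ (avg (fun s => 3 / 4 / q * sgn_sum s a ^+ 2 - (q ^+ 3)^-1 / 16 * sgn_sum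
  s a ^+ 4))); last exact: le_avg.
have -> : avg (fun s => 3 / 4 / q * sgn_sum s a ^+ 2 - (q ^+ 3)^-1 / 16 * sgn_sum s a ^+ 4)
  = 3 / 4 / q * A - (q ^+ 3)^-1 / 16 * avg (fun s => sgn_sum s a ^+ 4).
  rewrite avgD avgZ; congr (_ * _ + _).
    by under eq_avg do rewrite expr2; rewrite avg_sgn_sum2.
  by rewrite -mulNr -avgZ; apply: eq_avg => s; rewrite mulNr.
have h4 := avg_sgn_sum4 a; rewrite -/A -qq in h4.
rewrite -qq.
apply: (@le_trans _ _ (3 / 4 / q * q ^+ 2 - (q ^+ 3)^-1 / 16 * (3 * (q ^+ 2) ^+ 2))).
  have -> : 3 / 4 / q * q ^+ 2 - (q ^+ 3)^-1 / 16 * (3 * (q ^+ 2) ^+ 2) = 9 / 16 * q.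
    by field; rewrite gt_eqF.
  by move: q0; lra.
rewrite lerD2l lerN2 ler_wpM2l// divr_ge0// invr_ge0 exprn_ge0// ltW//.
Qed.

End avg.

Section pmax.
Context {R : realType} {T : finType}.
Implicit Types (u v : T -> R).

Lemma eq_pmax u v : u =1 v -> pmax u = pmax v.
Proof. by move=> uv; apply: eq_bigr => t _. Qed.

Lemma pmax_ge0 v : 0 <= pmax v.
Proof. exact: bigmax_ge_id. Qed.

Lemma le_pmax v t : v t <= pmax v.
Proof. exact: le_bigmax. Qed.

Lemma pmax_le v c : 0 <= c -> (forall t, v t <= c) -> pmax v <= c.
Proof.
by move=> c0 vc; apply: bigmax_le.
Qed.

Lemma le_pmax2 u v : (forall t, u t <= v t) -> pmax u <= pmax v.
Proof. by move=> uv; apply: pmax_le (pmax_ge0 v) _ => t; exact: le_trans (le_pmax v t). Qed.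

Lemma pmaxD u v : pmax (fun t => u t + v t) <= pmax u + pmax v.
Proof. by apply: pmax_le; [rewrite addr_ge0 ?pmax_ge0|move=> t; rewrite lerD ?le_pmax]. Qed.

Lemma pmaxZ k v : 0 <= k -> pmax (fun t => k * v t) = k * pmax v.
Proof.
move=> k0; apply/eqP; rewrite eq_le; apply/andP; split.
  by apply: pmax_le; [rewrite mulr_ge0 ?pmax_ge0|move=> t; rewrite ler_wpM2l ?le_pmax].
have [->|kn] := eqVneq k 0; first by rewrite mul0r pmax_ge0.
have kp : 0 < k by rewrite lt_def kn.
rewrite -ler_pdivlMl//; apply: pmax_le; first by rewrite mulr_ge0 ?invr_ge0 ?pmax_ge0.
by move=> t; rewrite ler_pdivlMl// (le_pmax (fun t => k * v t)).
Qed.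

Lemma pmax_avg (W : finType) (f : W -> T -> R) :
  pmax (fun t => avg (f ^~ t)) <= avg (fun w => pmax (f w)).
Proof.
apply: pmax_le; first by apply: avg_ge0 => w; exact: pmax_ge0.
by move=> t; apply: le_avg => w; exact: le_pmax.
Qed.

End pmax.

Definition rad {R : realType} {T I : finType} (a : T -> I -> R) : R :=
  avg (fun s : signs I => pmax (fun t => sgn_sum s (a t))).

(** [K] independent copies of the family [a], normalised so that by the central limit theorem
    [rad (spread K a)] tends to the Gaussian width of [a] as [K] grows. *)
Definition spread {R : realType} {T I : finType} (K : nat) (a : T -> I -> R)
    (t : T) (p : 'I_K * I) : R := (Num.sqrt K%:R)^-1 * a t p.2.

Arguments spread {R T I} K a t p.

Lemma sum_pair {R : realType} (A B : finType) (F : A * B -> R) :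
  \sum_p F p = \sum_a \sum_b F (a, b).
Proof. by rewrite pair_bigA; apply: eq_bigr => -[]. Qed.

Section rad.
Context {R : realType} {T : finType}.

Lemma eq_sgn_sum (I : finType) (s : signs I) (a b : I -> R) :
  a =1 b -> sgn_sum s a = sgn_sum s b.
Proof. by move=> ab; apply: eq_bigr => i _; rewrite ab. Qed.

Lemma sgn_sumZ (I : finType) (s : signs I) (k : R) (a : I -> R) :
  sgn_sum s (fun i => k * a i) = k * sgn_sum s a.
Proof. by rewrite /sgn_sum mulr_sumr; apply: eq_bigr => i _; rewrite mulrCA. Qed.

Lemma radZ (I : finType) (k : R) (a : T -> I -> R) : 0 <= k ->
  rad (fun t i => k * a t i) = k * rad a.
Proof.
move=> k0; rewrite /rad -avgZ; apply: eq_avg => s; rewrite -pmaxZ//.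
by apply: eq_pmax => t; rewrite sgn_sumZ.
Qed.

Lemma rad_spreadZ (I : finType) (k : R) K (a : T -> I -> R) : 0 <= k ->
  rad (spread K (fun t i => k * a t i)) = k * rad (spread K a).
Proof.
move=> k0; rewrite -radZ//; congr rad; apply/funext => t; apply/funext => p.
by rewrite /spread mulrCA.
Qed.

Lemma rad_ge0 (I : finType) (a : T -> I -> R) : 0 <= rad a.
Proof. by apply: avg_ge0 => s; exact: pmax_ge0. Qed.

(** The normalised sum of [K] signs that multiplies coordinate [i] in a spread family. *)
Definition normalised_sgn_sum (I : finType) K (s : signs ('I_K * I)%type) (i : I) : R :=
  (Num.sqrt K%:R)^-1 * \sum_k sgn (s (k, i)).

Lemma sgn_sum_spread (I : finType) K (a : T -> I -> R) s t :
  sgn_sum s (spread K a t) = \sum_i normalised_sgn_sum s i * a t i.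
Proof.
rewrite /sgn_sum sum_pair exchange_big/=; apply: eq_bigr => i _.
by rewrite /normalised_sgn_sum/spread/= -mulr_suml; ring.
Qed.

(** The value does not depend on [i] because the coordinates are exchangeable. *)
Lemma avg_normalised_sgn_sum_ge (I : finType) K : (0 < K)%N ->
  exists2 q : R, 1 / 2 <= q & forall i : I, avg (fun s : signs ('I_K * I)%type =>
    `|normalised_sgn_sum s i|) = q.
Proof.
move=> K0.
have [i0 _|I0] := pickP [pred i : I | true]; last first.
  by exists 1; [lra|move=> i; have := I0 i].
exists (avg (fun s : signs ('I_K * I)%type => `|normalised_sgn_sum s i0|)); last first.
  move=> i; rewrite (@avg_signs_inj _ _ _ (fun p : 'I_K * I => (p.1, tperm i i0 p.2))).
    apply: eq_avg => s; rewrite /normalised_sgn_sum; congr `| _ * _ |.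
    by apply: eq_bigr => k _; rewrite ffunE/= tpermL.
  by apply: inv_bij => -[k j]/=; rewrite tpermK.
have := @khinchine R ('I_K * I)%type (fun p => if p.2 == i0 then (Num.sqrt K%:R)^-1 else 0).
have sK : 0 < Num.sqrt K%:R :> R by rewrite sqrtr_gt0 ltr0n.
have -> : \sum_(p : 'I_K * I) (if p.2 == i0 then (Num.sqrt K%:R)^-1 else 0) ^+ 2 = 1 :> R.
  rewrite sum_pair/=.
  transitivity (\sum_(k < K) K%:R^-1 : R).
    apply: eq_bigr => k _; rewrite (bigD1 i0)//= eqxx big1 ?addr0.
      by rewrite exprVn sqr_sqrtr// ler0n.
    by move=> j /negbTE ->; rewrite expr0n.
  by rewrite sumr_const card_ord -[_ *+ _]mulr_natr mulVf// pnatr_eq0 -lt0n.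
rewrite sqrtr1 => /le_trans; apply; apply: le_avg => s.
rewrite le_eqVlt; apply/orP; left; apply/eqP; congr `| _ |.
rewrite /normalised_sgn_sum /sgn_sum mulr_sumr sum_pair/=.
apply: eq_bigr => k _; rewrite (bigD1 i0)//= eqxx big1 ?addr0 1?mulrC//.
by move=> j /negbTE ->; rewrite mulr0.
Qed.

(** A spread family has random coefficients [normalised_sgn_sum s i] in place of signs.  Their absolute
    values are independent of their signs, so Jensen's inequality replaces them by their
    mean, which is at least 1/2. *)
Lemma rad_le_spread (I : finType) K (a : T -> I -> R) : (0 < K)%N ->
  rad a <= 2 * rad (spread K a).
Proof.
move=> /(avg_normalised_sgn_sum_ge I)[q q2 bq].
have -> : rad (spread K a) =
    avg (fun s : signs I => avg (fun w => pmax (fun t => \sum_i sgn (s i) *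
      `|@normalised_sgn_sum I K w i| * a t i))).
  rewrite avg_exchange.
  transitivity (avg (fun w => avg (fun s : signs I => pmax (fun t => \sum_i sgn (s i) *
    @normalised_sgn_sum I K w i * a t i)))); last first.
    apply: eq_avg => w; rewrite (avg_signs_xor [ffun i => normalised_sgn_sum w i < 0]).
    apply: eq_avg => s; apply: eq_pmax => t; apply: eq_bigr => i _.
    rewrite !ffunE sgn_xor; congr (_ * _); rewrite -mulrA; congr (_ * _).
    by rewrite /sgn; case: ltrP => [/ltr0_norm ->|/ger0_norm ->]; rewrite ?expr1 ?expr0; ring.
  rewrite avg_exchange -[LHS](avg_cst _ (signs_gt0 I)); apply: eq_avg => s.
  rewrite /rad (avg_signs_xor [ffun p => s p.2]); apply: eq_avg => w.
  apply: eq_pmax => t; rewrite sgn_sum_spread; apply: eq_bigr => i _.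
  congr (_ * _); rewrite /normalised_sgn_sum [RHS]mulrCA [in RHS]mulr_sumr; congr (_ * _).
  by apply: eq_bigr => k _; rewrite !ffunE sgn_xor mulrC.
have q0 : 0 < q by move: q2; lra.
apply: (@le_trans _ _ (2 * (q * rad a))).
  by have := rad_ge0 a; move: q2; nra.
rewrite ler_pM2l ?ltr0n// /rad -avgZ; apply: le_avg => s.
rewrite -(pmaxZ _ (ltW q0)).
apply: (le_trans _ (pmax_avg (fun w t => \sum_i sgn (s i) * `|@normalised_sgn_sum I K w i| * a
  t i))).
apply: le_pmax2 => t; rewrite avg_sum le_eqVlt; apply/orP; left; apply/eqP.
rewrite /sgn_sum mulr_sumr; apply: eq_bigr => i _.
by rewrite avgZr avgZ bq; ring.
Qed.

Definition joinf (I J : finType) (a : T -> I -> R) (b : T -> J -> R)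
  (t : T) (z : I + J) : R := match z with inl i => a t i | inr j => b t j end.

Lemma sgn_sum_sumType (I J : finType) (s : signs (I + J)%type) (c : (I + J)%type -> R) :
  sgn_sum s c = sgn_sum [ffun i => s (inl i)] (c \o inl) + sgn_sum [ffun j => s (inr j)] (c \o
    inr).
Proof.
rewrite /sgn_sum big_sumType/=; congr (_ + _);
by apply: eq_bigr => i _; rewrite ffunE.
Qed.

Lemma rad_joinf (I J : finType) (a : T -> I -> R) (b : T -> J -> R) :
  rad (joinf a b) <= rad a + rad b.
Proof.
apply: (@le_trans _ _ (avg (fun s : signs I => avg (fun w : signs J =>
    pmax (fun t => sgn_sum s (a t)) + pmax (fun t => sgn_sum w (b t)))))).
  rewrite avg_signs_sum; apply: le_avg => s; apply: le_trans (pmaxD _ _).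
  by apply: le_pmax2 => t; rewrite sgn_sum_sumType.
rewrite /rad -[X in _ <= _ + X](avg_cst _ (signs_gt0 I)) -avgD; apply: le_avg => s.
by rewrite avgD avg_cst ?signs_gt0.
Qed.

Lemma rad_inj (I J : finType) (e : J -> I) (a : T -> I -> R) : bijective e ->
  rad a = rad (fun t j => a t (e j)).
Proof.
move=> be; rewrite [RHS](avg_signs_inj _ be); apply: eq_avg => s; apply: eq_pmax => t.
rewrite /sgn_sum (reindex e)/=; last exact: onW_bij.
by apply: eq_bigr => j _; rewrite ffunE.
Qed.

Lemma rad_spread_joinf (I J : finType) K (a : T -> I -> R) (b : T -> J -> R) :
  rad (spread K (joinf a b)) <= rad (spread K a) + rad (spread K b).
Proof.
pose e (z : ('I_K * I) + ('I_K * J)) : 'I_K * (I + J) :=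
  match z with inl p => (p.1, inl p.2) | inr p => (p.1, inr p.2) end.
have be : bijective e.
  exists (fun p => match p.2 with inl i => inl (p.1, i) | inr j => inr (p.1, j) end).
    by case=> -[].
  by case=> k [].
rewrite (rad_inj _ be); apply: le_trans (rad_joinf _ _).
rewrite le_eqVlt; apply/orP; left; apply/eqP; congr rad.
by apply/funext => t; apply/funext => -[[k i]|[k j]].
Qed.

(** The Markov operator of one step of the random walk with increments [sgn_sum s (a t)]; its
    [K]-th iterate evaluates a spread family, see [iter_radstep]. *)
Definition radstep (I : finType) (a : T -> I -> R) (phi : (T -> R) -> R) (v : T -> R) : R :=
  avg (fun s : signs I => phi (fun t => v t + sgn_sum s (a t))).

Lemma iter_radstep (I : finType) (a : T -> I -> R) K phi v :
  iter K (radstep a) phi v =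
  avg (fun s : signs ('I_K * I)%type => phi (fun t => v t + sgn_sum s (fun p => a t p.2))).
Proof.
elim: K v => [|K IH] v.
  rewrite -[LHS](avg_cst _ (signs_gt0 ('I_0 * I)%type)); apply: eq_avg => s/=.
  congr phi; apply/funext => t; rewrite /sgn_sum big1 ?addr0//.
  by move=> [[]].
rewrite iterS {1}/radstep.
under eq_avg do rewrite IH.
pose e (z : I + 'I_K * I) : 'I_K.+1 * I :=
  match z with inl i => (ord0, i) | inr p => (lift ord0 p.1, p.2) end.
have be : bijective e.
  exists (fun p => if unlift ord0 p.1 is Some k then inr (k, p.2) else inl p.2).
    by move=> [i|[k i]]/=; rewrite ?unlift_none ?liftK.
  by move=> [k i]/=; case: unliftP => [j ->|->].
rewrite avg_signs_sum [LHS](avg_signs_inj _ be); apply: eq_avg => s.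
congr phi; apply/funext => t; rewrite -addrA; congr (_ + _).
rewrite /sgn_sum [RHS](reindex e)/=; last exact: onW_bij.
by rewrite big_sumType/=; congr (_ + _); apply: eq_bigr => j _; rewrite !ffunE.
Qed.

End rad.

(** * Comparison of Rademacher averages *)

Section exp_taylor.
Context {R : realType}.

Lemma expR_le_quadratic (z : R) : z <= 1 / 2 -> expR z <= 1 + z + 3 * z ^+ 2.
Proof.
move=> z2.
have h := expR_ge1Dx (- z).
have e0 := expR_gt0 z.
have ee : expR z * expR (- z) = 1 by rewrite expRxMexpNx_1.
have q0 : 0 <= 1 + z + 3 * z ^+ 2 by nra.
have q1 : 1 <= (1 + z + 3 * z ^+ 2) * (1 - z).
  have : 0 <= z ^+ 2 * (2 - 3 * z) by rewrite mulr_ge0 ?sqr_ge0//; lra.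
  lra.
have : 1 <= (1 + z + 3 * z ^+ 2) * expR (- z).
  by apply: le_trans q1 _; rewrite ler_wpM2l.
rewrite -{1}ee ler_pM2r// expR_gt0//.
Qed.

(** Both bounds follow from monotonicity: 1 + z + z^2/2 + z^3 - exp z and
    exp z - (1 + z + z^2/2) are nondecreasing on [-1/2, 1/2] and vanish at 0. *)
Lemma expR_taylor2 (z : R) : `|z| <= 1 / 2 ->
  `|expR z - (1 + z + z ^+ 2 / 2)| <= `|z| ^+ 3.
Proof.
move=> z2.
pose f (x : R) : R := 1 + x + x ^+ 2 / 2 + x ^+ 3 - expR x.
pose g (x : R) : R := expR x - (1 + x + x ^+ 2 / 2).
have df (x : R) : is_derive x 1 f (1 + x + 3 * x ^+ 2 - expR x).
  by rewrite /f; apply: is_derive_eq; rewrite /GRing.scale/= mulr0; field.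
have dg (x : R) : is_derive x 1 g (expR x - (1 + x)).
  by rewrite /g; apply: is_derive_eq; rewrite /GRing.scale/= mulr0; field.
have cf : continuous f.
  by move=> x; apply/differentiable_continuous/derivable1_diffP; exact: ex_derive.
have cg : continuous g.
  by move=> x; apply/differentiable_continuous/derivable1_diffP; exact: ex_derive.
have f0 : f 0 = 0 by rewrite /f expR0; ring.
have g0 : g 0 = 0 by rewrite /g expR0; ring.
have hf (x y : R) : x <= y -> - (1 / 2) <= x -> y <= 1 / 2 -> f x <= f y.
  move=> xy x2 y2; apply: (@ger0_derive1_ndecr _ f (- (1 / 2)) (1 / 2)) => //.
  - move=> w; rewrite in_itv/= => /andP[w1 w2].
    by rewrite derive1E derive_val subr_ge0 expR_le_quadratic// ltW.
  - exact: continuous_subspaceT.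
have hg (x y : R) : x <= y -> g x <= g y.
  move=> xy; apply: (@ger0_derive1_ndecr _ g x y) => //.
  - by move=> w _; rewrite derive1E derive_val subr_ge0 expR_ge1Dx.
  - exact: continuous_subspaceT.
move: z2; rewrite ler_norml => /andP[z1 z2].
have [z0|z0] := leP 0 z.
  have := hf 0 z z0 _ z2; have := hg 0 z z0; rewrite f0 g0 /f /g => G F.
  by rewrite ger0_norm// ger0_norm//; have := F ltac:(lra); lra.
have := hf z 0 (ltW z0) z1 _; have := hg z 0 (ltW z0); rewrite f0 g0 /f /g => G F.
rewrite ler0_norm// ltr0_norm//; have := F ltac:(lra).
have -> : (- z) ^+ 3 = - z ^+ 3 by ring.
lra.
Qed.

(** After centring, sum p exp z = 1 + u with u = V / 2 + O(M^3), and ln (1 + u) = u + O(u^2). *)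
Lemma cumulant2 (S : finType) (p y : S -> R) (M : R) :
  (forall s, 0 <= p s) -> \sum_s p s = 1 -> (forall s, `|y s| <= M) -> M <= 1 / 4 ->
  `|ln (\sum_s p s * expR (y s)) -
    (\sum_s p s * y s + (\sum_s p s * y s ^+ 2 - (\sum_s p s * y s) ^+ 2) / 2)|
  <= 12 * M ^+ 3.
Proof.
move=> p0 p1 yM M4.
have M0 : 0 <= M.
  have [s _|S0] := pickP [pred s : S | true]; first exact: le_trans (yM s).
  by move: p1; rewrite big1 ?(@eq_sym R) => [/eqP|s]; [rewrite eq_sym oner_eq0|have := S0 s].
have pb (c : R) (f : S -> R) : (forall s, `|f s| <= c) -> `|\sum_s p s * f s| <= c.
  move=> fc; apply: le_trans (ler_norm_sum _ _ _) _.
  apply: (@le_trans _ _ (\sum_s p s * c)); last by rewrite -mulr_suml p1 mul1r.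
  by apply: ler_sum => s _; rewrite normrM ger0_norm// ler_wpM2l.
set m := \sum_s p s * y s.
have mM : `|m| <= M by exact: pb.
(* Centring makes the linear term of the expansion vanish. *)
pose z s := y s - m.
have zM s : `|z s| <= 2 * M.
  by apply: le_trans (ler_normB _ _) _; have := yM s; move: mM; lra.
set V := \sum_s p s * y s ^+ 2 - m ^+ 2.
have sz : \sum_s p s * z s = 0.
  by under eq_bigr do rewrite mulrBr; rewrite sumrB -mulr_suml p1 mul1r subrr.
have VE : V = \sum_s p s * z s ^+ 2.
  rewrite (eq_bigr (fun s => p s * y s ^+ 2 - (2 * m) * (p s * y s) + p s * m ^+ 2)).
    by rewrite !big_split/= sumrN -mulr_sumr -mulr_suml p1 -/m /V; ring.
  by move=> s _; rewrite /z; ring.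
have V0 : 0 <= V by rewrite VE sumr_ge0// => s _; rewrite mulr_ge0// sqr_ge0.
have VM : V <= M ^+ 2.
  apply: (@le_trans _ _ (\sum_s p s * y s ^+ 2)); first by rewrite /V; have := sqr_ge0 m; lra.
  rewrite -[leRHS]mul1r -p1 mulr_suml; apply: ler_sum => s _; rewrite ler_wpM2l//.
  by rewrite -real_normK ?num_real// lerXn2r// ?nnegrE.
pose u := \sum_s p s * expR (z s) - 1.
have u0 : 0 <= u.
  have -> : u = \sum_s (p s * expR (z s) - p s) by rewrite sumrB p1.
  rewrite -[leLHS]sz; apply: ler_sum => s _.
  by have := ler_wpM2l (p0 s) (expR_ge1Dx (z s)); lra.
have uV : `|u - V / 2| <= 8 * M ^+ 3.
  have -> : u - V / 2 = \sum_s p s * (expR (z s) - (1 + z s + z s ^+ 2 / 2)).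
    rewrite (eq_bigr (fun s => p s * expR (z s) - p s - p s * z s - (p s * z s ^+ 2) / 2)).
      by rewrite !sumrB -mulr_suml p1 sz -VE /u; ring.
    by move=> s _; ring.
  apply: pb => s.
  have z2 : `|z s| <= 1 / 2 by apply: le_trans (zM s) _; move: M4; lra.
  apply: le_trans (expR_taylor2 z2) _.
  have -> : 8 * M ^+ 3 = (2 * M) ^+ 3 by ring.
  by rewrite lerXn2r// ?nnegrE// mulr_ge0.
have lnE : ln (\sum_s p s * expR (y s)) = m + ln (1 + u).
  have -> : \sum_s p s * expR (y s) = expR m * (1 + u).
    rewrite /u addrC subrK mulr_sumr; apply: eq_bigr => s _.
    by rewrite mulrCA -expRD /z addrC subrK.
  by rewrite lnM ?expRK// posrE ?expR_gt0// ltr_pwDl.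
have lu : ln (1 + u) <= u by apply: le_ln1Dx; move: u0; lra.
have ll : u - u ^+ 2 <= ln (1 + u).
  have u1 : 0 < 1 + u by move: u0; lra.
  have : ln (1 + (- u / (1 + u))) <= - u / (1 + u).
    apply: le_ln1Dx; rewrite ltr_pdivlMr//; move: u0; lra.
  have -> : 1 + (- u / (1 + u)) = (1 + u)^-1 by field; rewrite gt_eqF.
  rewrite lnV ?posrE// => h.
  suff : u - u ^+ 2 <= u / (1 + u) by move: h; rewrite mulNr; lra.
  rewrite ler_pdivlMr//.
  have : 0 <= u ^+ 3 by rewrite exprn_ge0.
  lra.
rewrite lnE -/V.
move: uV; rewrite ler_norml => /andP[uV1 uV2].
have M2 : 8 * M ^+ 3 <= 2 * M ^+ 2.
  have := sqr_ge0 M; have -> : M ^+ 3 = M ^+ 2 * M by ring.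
  nra.
have uu : u <= 5 / 2 * M ^+ 2 by move: uV2 VM M2; lra.
have u2 : u ^+ 2 <= 4 * M ^+ 3.
  have h1 : u ^+ 2 <= (5 / 2 * M ^+ 2) ^+ 2 by rewrite lerXn2r// nnegrE mulr_ge0// sqr_ge0.
  apply: le_trans h1 _.
  have -> : (5 / 2 * M ^+ 2) ^+ 2 = 25 / 4 * M * M ^+ 3 by field.
  have M3 : 0 <= M ^+ 3 by rewrite exprn_ge0.
  by rewrite ler_wpM2r//; move: M4; lra.
by rewrite ler_norml; apply/andP; split; move: uV1 uV2 lu ll u2; lra.
Qed.

End exp_taylor.

(** The log-sum-exp soft maximum: within ln #|S| / beta of the true maximum, but smooth. *)
Definition softmax {R : realType} {S : finType} (beta : R) (v : S -> R) : R :=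
  ln (\sum_s expR (beta * v s)) / beta.

Section comparison.
Context {R : realType}.

Lemma avg_mean_sgn_sum (I S : finType) (p : S -> R) (a : S -> I -> R) :
  avg (fun s : signs I => \sum_t p t * sgn_sum s (a t)) = 0.
Proof.
rewrite avg_sum big1// => t _.
by rewrite avgZ avg_sgn_sum mulr0.
Qed.

Lemma variance_pairs (S : finType) (p a : S -> R) : \sum_s p s = 1 ->
  \sum_s p s * a s ^+ 2 - (\sum_s p s * a s) ^+ 2 =
  (\sum_s \sum_t p s * p t * (a s - a t) ^+ 2) / 2.
Proof.
move=> p1; set m := \sum_s p s * a s; set q := \sum_s p s * a s ^+ 2.
have -> : \sum_s \sum_t p s * p t * (a s - a t) ^+ 2 =
    \sum_s (p s * a s ^+ 2 - 2 * (p s * a s) * m + p s * q).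
  apply: eq_bigr => s _; rewrite (eq_bigr (fun t => p s * a s ^+ 2 * p t
    - 2 * (p s * a s) * (p t * a t) + p s * (p t * a t ^+ 2))).
    by rewrite !big_split/= sumrN -!mulr_sumr p1 mulr1.
  by move=> t _; ring.
rewrite !big_split/= sumrN -!mulr_suml -mulr_sumr p1 -/q -/m.
by field.
Qed.

(** Expectation over the signs of the variance, under the weights [p] on [S], of the values
    [sgn_sum s (a t)]. *)
Definition mean_variance {S I : finType} (p : S -> R) (a : S -> I -> R) : R :=
  \sum_s p s * (\sum_i a s i ^+ 2) - \sum_i (\sum_s p s * a s i) ^+ 2.

(** The variance of [a] under [p] depends only on the pairwise distances; this is why a
    comparison of increments suffices in [rad_comparison]. *)
Lemma mean_varianceE (S I : finType) (p : S -> R) (a : S -> I -> R) : \sum_s p s = 1 ->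
  mean_variance p a = (\sum_s \sum_t p s * p t * \sum_i (a s i - a t i) ^+ 2) / 2.
Proof.
move=> p1; rewrite /mean_variance.
under eq_bigr do rewrite mulr_sumr.
rewrite exchange_big/= -sumrB.
rewrite (eq_bigr _ (fun i _ => variance_pairs (a ^~ i) p1)).
rewrite -mulr_suml; congr (_ / 2).
rewrite exchange_big/=; apply: eq_bigr => s _.
rewrite exchange_big/=; apply: eq_bigr => t _.
by rewrite -mulr_sumr.
Qed.

Lemma le_mean_variance (S I J : finType) (p : S -> R) (a : S -> I -> R) (b : S -> J -> R) :
  (forall s, 0 <= p s) -> \sum_s p s = 1 ->
  (forall s t, \sum_i (a s i - a t i) ^+ 2 <= \sum_i (b s i - b t i) ^+ 2) ->
  mean_variance p a <= mean_variance p b.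
Proof.
move=> p0 p1 ab; rewrite !mean_varianceE// ler_wpM2r ?invr_ge0//.
by apply: ler_sum => s _; apply: ler_sum => t _; rewrite ler_wpM2l// mulr_ge0.
Qed.

Lemma norm_sgn_sum (I : finType) (s : signs I) (a : I -> R) :
  `|sgn_sum s a| <= \sum_i `|a i|.
Proof.
apply: le_trans (ler_norm_sum _ _ _) _; apply: ler_sum => i _.
by rewrite normrM /sgn normrX normrN1 expr1n mul1r.
Qed.

(** The gradient of the soft maximum. *)
Definition gibbs {S : finType} (beta : R) (v : S -> R) (s : S) : R :=
  expR (beta * v s) / \sum_s expR (beta * v s).

(** A step of the walk changes the soft maximum by the logarithm of the exponential moment
    of the increment under the Gibbs weights.  The mean of the first cumulant is 0, that of
    the second is [beta ^+ 2 * mean_variance]. *)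
Lemma softmax_step (S I : finType) (s0 : S) (beta A : R) (a : S -> I -> R) (v : S -> R) :
  0 < beta -> (forall s, \sum_i `|a s i| <= A) -> beta * A <= 1 / 4 ->
  `|radstep a (softmax beta) v - (softmax beta v + beta / 2 * mean_variance (gibbs beta v) a)|
  <= 12 * beta ^+ 2 * A ^+ 3.
Proof.
move=> b0 aA bA.
set p := gibbs beta v; set Z := \sum_s expR (beta * v s).
have Z0 : 0 < Z.
  by rewrite /Z (bigD1 s0)//= ltr_pwDl ?expR_gt0// sumr_ge0// => s _; rewrite expR_ge0.
have p0 s : 0 <= p s by rewrite divr_ge0 ?expR_ge0// ltW.
have p1 : \sum_s p s = 1 by rewrite -mulr_suml divff// gt_eqF.
pose y (e : signs I) s := beta * sgn_sum e (a s).
have yM e s : `|y e s| <= beta * A.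
  by rewrite normrM gtr0_norm// ler_wpM2l ?(ltW b0)// (le_trans (norm_sgn_sum _ _)).
have stepE e : softmax beta (fun t => v t + sgn_sum e (a t)) =
    softmax beta v + ln (\sum_s p s * expR (y e s)) / beta.
  rewrite /softmax -mulrDl; congr (_ / beta).
  rewrite -lnM ?posrE//; last first.
    rewrite (bigD1 s0)//= ltr_pwDl//; first by rewrite mulr_gt0 ?divr_gt0 ?expR_gt0.
    by rewrite sumr_ge0// => s _; rewrite mulr_ge0// expR_ge0.
  congr ln; rewrite mulr_sumr; apply: eq_bigr => s _.
  by rewrite mulrDr expRD -/Z /p /gibbs -/Z; field; rewrite gt_eqF.
pose G e := \sum_s p s * y e s + (\sum_s p s * y e s ^+ 2 - (\sum_s p s * y e s) ^+ 2) / 2.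
have avgG : avg G = beta ^+ 2 / 2 * mean_variance p a.
  rewrite /G avgD avgZr avgD.
  have -> : avg (fun e => \sum_s p s * y e s) = 0.
    transitivity (avg (fun e => beta * \sum_s p s * sgn_sum e (a s))).
      by apply: eq_avg => e; rewrite mulr_sumr; apply: eq_bigr => s _; rewrite /y mulrCA.
    by rewrite avgZ avg_mean_sgn_sum mulr0.
  have -> : avg (fun e => \sum_s p s * y e s ^+ 2) = beta ^+ 2 * \sum_s p s * (\sum_i a s i ^+ 2).
    rewrite avg_sum mulr_sumr; apply: eq_bigr => s _; rewrite avgZ [RHS]mulrCA; congr (p s * _).
    transitivity (avg (fun e => beta ^+ 2 * (sgn_sum e (a s) * sgn_sum e (a s)))).
      by apply: eq_avg => e; rewrite /y; ring.
    by rewrite avgZ avg_sgn_sum2.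
  have -> : avg (fun e => - (\sum_s p s * y e s) ^+ 2) = - (beta ^+ 2 * \sum_i (\sum_s p s * a
    s i) ^+ 2).
    transitivity (avg (fun e => - beta ^+ 2 * (sgn_sum e (fun i => \sum_s p s * a s i) *
      sgn_sum e (fun i => \sum_s p s * a s i)))).
      apply: eq_avg => e.
      have -> : \sum_s p s * y e s = beta * sgn_sum e (fun i => \sum_s p s * a s i).
        rewrite /y /sgn_sum mulr_sumr.
        under [RHS]eq_bigr do rewrite !mulr_sumr.
        rewrite exchange_big/=; apply: eq_bigr => s _; rewrite !mulr_sumr.
        by apply: eq_bigr => i _; ring.
      by ring.
    by rewrite avgZ avg_sgn_sum2 mulNr.
  by rewrite /mean_variance; field.
have -> : radstep a (softmax beta) v - (softmax beta v + beta / 2 * mean_variance p a) =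
    avg (fun e => (ln (\sum_s p s * expR (y e s)) - G e) / beta).
  rewrite avgZr avgD.
  have -> : radstep a (softmax beta) v = softmax beta v + avg (fun e => ln (\sum_s p s * expR
    (y e s))) / beta.
    rewrite /radstep -[softmax beta v](avg_cst _ (signs_gt0 I)) -avgZr -avgD.
    by apply: eq_avg => e; rewrite stepE.
  have -> : avg (fun e => - G e) = - avg G.
    by rewrite -mulN1r -avgZ; apply: eq_avg => e; rewrite mulN1r.
  by rewrite avgG; field; rewrite gt_eqF.
apply: le_trans (avg_norm _) _.
rewrite -[leRHS](avg_cst _ (signs_gt0 I)); apply: le_avg => e.
rewrite normrM [`|beta^-1|]gtr0_norm ?invr_gt0// ler_pdivrMr//.
apply: le_trans (cumulant2 p0 p1 (yM e) bA) _.
by rewrite le_eqVlt; apply/orP; left; apply/eqP; ring.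
Qed.

(** The estimate is uniform in [v], so it can be applied at every position of a walk. *)
Lemma softmax_step_le (S I J : finType) (s0 : S) (beta A : R) (a : S -> I -> R)
    (b : S -> J -> R) (v : S -> R) :
  0 < beta -> (forall s, \sum_i `|a s i| <= A) -> (forall s, \sum_i `|b s i| <= A) ->
  beta * A <= 1 / 4 ->
  (forall s t, \sum_i (a s i - a t i) ^+ 2 <= \sum_i (b s i - b t i) ^+ 2) ->
  radstep a (softmax beta) v <= radstep b (softmax beta) v + 24 * beta ^+ 2 * A ^+ 3.
Proof.
move=> b0 aA bA bA4 ab.
have := softmax_step s0 v b0 aA bA4; have := softmax_step s0 v b0 bA bA4.
rewrite !ler_norml => /andP[h1 _] /andP[_ h2].
have Z0 : 0 < \sum_s expR (beta * v s).
  by rewrite (bigD1 s0)//= ltr_pwDl ?expR_gt0// sumr_ge0// => s _; rewrite expR_ge0.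
have : mean_variance (gibbs beta v) a <= mean_variance (gibbs beta v) b.
  apply: le_mean_variance => //; first by move=> s; rewrite divr_ge0 ?expR_ge0// ltW.
  by rewrite -mulr_suml divff// gt_eqF.
move: h1 h2; nra.
Qed.

Lemma le_radstep (S I : finType) (a : S -> I -> R) phi psi v c :
  (forall u, phi u <= psi u + c) -> radstep a phi v <= radstep a psi v + c.
Proof.
move=> pp; rewrite /radstep -[X in _ <= _ + X](avg_cst _ (signs_gt0 I)) -avgD.
by apply: le_avg => s.
Qed.

Lemma radstepC (S I J : finType) (a : S -> I -> R) (b : S -> J -> R) phi v :
  radstep a (radstep b phi) v = radstep b (radstep a phi) v.
Proof.
rewrite /radstep avg_exchange; apply: eq_avg => s; apply: eq_avg => w.
by congr phi; apply/funext => t; ring.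
Qed.

Lemma iter_radstepC (S I J : finType) (a : S -> I -> R) (b : S -> J -> R) phi K :
  radstep a (iter K (radstep b) phi) = iter K (radstep b) (radstep a phi).
Proof.
elim: K => // K IH; rewrite iterS [RHS]iterS -IH.
by apply/funext => v; rewrite radstepC.
Qed.

Lemma le_iter_radstep (S I : finType) (a : S -> I -> R) phi psi v c K :
  (forall u, phi u <= psi u + c) ->
  iter K (radstep a) phi v <= iter K (radstep a) psi v + c.
Proof.
move=> pp; elim: K v => // K IH v; rewrite !iterS; exact: le_radstep.
Qed.

(** Lindeberg exchange: steps of the two walks commute, so the steps of the first can be
    replaced one by one, each at cost [c]. *)
Lemma iter_radstep_le (S I J : finType) (a : S -> I -> R) (b : S -> J -> R) phi c K v :
  (forall u, radstep a phi u <= radstep b phi u + c) ->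
  iter K (radstep a) phi v <= iter K (radstep b) phi v + K%:R * c.
Proof.
move=> ab; elim: K v => [|K IH] v; first by rewrite mul0r addr0.
rewrite iterS; apply: le_trans (le_radstep a v IH) _.
rewrite iter_radstepC iterSr mulrSr mulrDl mul1r [K%:R * c + c]addrC addrA lerD2r.
exact: le_iter_radstep.
Qed.

Lemma le_pmax_softmax (T : finType) (beta : R) (v : option T -> R) : 0 < beta ->
  v None = 0 -> pmax (fun t => v (Some t)) <= softmax beta v.
Proof.
move=> b0 v0.
have h o : v o <= softmax beta v.
  rewrite /softmax ler_pdivlMr// -[leLHS]expRK ler_ln ?posrE ?expR_gt0//.
    by rewrite mulrC (bigD1 o)//= lerDl sumr_ge0// => s _; rewrite expR_ge0.
  by rewrite (bigD1 o)//= ltr_pwDl ?expR_gt0// sumr_ge0// => s _; rewrite expR_ge0.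
by apply: pmax_le => [|t]; [rewrite -v0|].
Qed.

Lemma softmax_le_pmax (T : finType) (beta : R) (v : option T -> R) : 0 < beta ->
  v None = 0 ->
  softmax beta v <= pmax (fun t => v (Some t)) + ln #|{: option T}|%:R / beta.
Proof.
move=> b0 v0; set m := pmax _.
have h o : v o <= m.
  by case: o => [t|]; [exact: (le_pmax (fun t => v (Some t)))|rewrite v0 pmax_ge0].
rewrite /softmax -[m](mulfK (lt0r_neq0 b0)) -mulrDl ler_pM2r ?invr_gt0//.
have c0 : 0 < #|{: option T}|%:R :> R by rewrite ltr0n card_option.
rewrite -[m * beta]expRK -lnM ?posrE ?expR_gt0// ler_ln ?posrE ?mulr_gt0 ?expR_gt0//.
  rewrite mulr_natr -sumr_const; apply: ler_sum => o _.
  by rewrite ler_expR mulrC ler_wpM2r// ltW.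
by rewrite (bigD1 None)//= ltr_pwDl ?expR_gt0// sumr_ge0// => s _; rewrite expR_ge0.
Qed.

(** The extra index [None] carries the zero vector that [pmax] takes into account. *)
Lemma rad_spread_softmax (T I : finType) (a : T -> I -> R) K (beta : R)
    (a' := fun o => if o is Some t then a t else fun=> 0) : 0 < beta ->
  rad (spread K a) <=
    iter K (radstep (fun o i => (Num.sqrt K%:R)^-1 * a' o i)) (softmax beta) (fun=> 0) /\
  iter K (radstep (fun o i => (Num.sqrt K%:R)^-1 * a' o i)) (softmax beta) (fun=> 0)
    <= rad (spread K a) + ln #|{: option T}|%:R / beta.
Proof.
move=> b0; rewrite iter_radstep.
pose v (s : signs ('I_K * I)%type) (o : option T) :=
  0 + sgn_sum s (fun p => (Num.sqrt K%:R)^-1 * a' o p.2).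
have v0 s : v s None = 0.
  by rewrite /v add0r /sgn_sum big1// => i _; rewrite !mulr0.
have vS s : pmax (fun t => v s (Some t)) = pmax (fun t => sgn_sum s (spread K a t)).
  by apply: eq_pmax => t; rewrite /v add0r.
split.
  by apply: le_avg => s; rewrite -vS; exact: (le_pmax_softmax b0 (v0 s)).
rewrite -[X in _ <= _ + X](avg_cst _ (signs_gt0 ('I_K * I)%type)) -avgD.
by apply: le_avg => s; rewrite -vS; exact: (softmax_le_pmax b0 (v0 s)).
Qed.

(** Sudakov-Fernique inequality for spread families.  Exchanging the [K] steps costs
    O(K (beta / sqrt K)^3 / beta), and the soft maximum differs from the maximum by
    O(1 / beta): first [beta] and then [K] are taken large. *)
Lemma rad_comparison (T I J : finType) (a : T -> I -> R) (b : T -> J -> R) (eta : R) :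
  (forall t, \sum_i a t i ^+ 2 <= \sum_j b t j ^+ 2) ->
  (forall s t, \sum_i (a s i - a t i) ^+ 2 <= \sum_j (b s j - b t j) ^+ 2) ->
  0 < eta ->
  exists K0 : nat, forall K, (K0 <= K)%N -> rad (spread K a) <= rad (spread K b) + eta.
Proof.
move=> ab1 ab2 e0.
pose a' o := if o is Some t then a t else fun=> 0.
pose b' o := if o is Some t then b t else fun=> 0.
have ab (s t : option T) :
    \sum_i (a' s i - a' t i) ^+ 2 <= \sum_j (b' s j - b' t j) ^+ 2.
  case: s t => [s|] [t|] /=.
  - exact: ab2.
  - by under eq_bigr do rewrite subr0; under [leRHS]eq_bigr do rewrite subr0.
  - by under eq_bigr do rewrite sub0r sqrrN; under [leRHS]eq_bigr do rewrite sub0r sqrrN.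
  - by rewrite !big1// => i _; rewrite subrr expr0n.
pose L : R := ln #|{: option T}|%:R.
have L0 : 0 <= L by rewrite ln_ge0// ler1n card_option.
(* L + 1 = eta * beta / 2, so the soft maximum errs by at most L / beta <= eta / 2. *)
have [beta b0 betaE] : exists2 beta : R, 0 < beta & eta / 2 * beta = L + 1.
  exists (2 * (L + 1) / eta); last by field; rewrite gt_eqF.
  by rewrite divr_gt0// mulr_gt0//; move: L0; lra.
pose A : R := \sum_t \sum_i `|a' t i| + \sum_t \sum_j `|b' t j| + 1.
have sa0 : 0 <= \sum_t \sum_i `|a' t i| by apply: sumr_ge0 => t _; exact: sumr_ge0.
have sb0 : 0 <= \sum_t \sum_j `|b' t j| by apply: sumr_ge0 => t _; exact: sumr_ge0.
have A1 : 1 <= A by rewrite /A; move: sa0 sb0; lra.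
have aA t : \sum_i `|a' t i| <= A.
  have : \sum_i `|a' t i| <= \sum_t \sum_i `|a' t i|.
    by rewrite [leRHS](bigD1 t)//= lerDl; apply: sumr_ge0 => u _; exact: sumr_ge0.
  by rewrite /A; move: sb0; lra.
have bA t : \sum_i `|b' t i| <= A.
  have : \sum_i `|b' t i| <= \sum_t \sum_i `|b' t i|.
    by rewrite [leRHS](bigD1 t)//= lerDl; apply: sumr_ge0 => u _; exact: sumr_ge0.
  by rewrite /A; move: sa0; lra.
clearbody A.
(* The two terms ensure beta * A / sqrt K <= 1 / 4 and a total exchange cost of at most eta / 2. *)
pose D := 4 * beta * A + 48 * beta ^+ 2 * A ^+ 3 / eta.
have A0 : 0 <= A by exact: le_trans A1.
have D1 : 0 <= 4 * beta * A by rewrite !mulr_ge0// ltW.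
have D2 : 0 <= 48 * beta ^+ 2 * A ^+ 3 / eta.
  by rewrite divr_ge0 ?(ltW e0)// !mulr_ge0// ?exprn_ge0// (ltW b0).
have DE : D = 4 * beta * A + 48 * beta ^+ 2 * A ^+ 3 / eta by [].
have D0 : 0 <= D by rewrite addr_ge0.
clearbody D.
have [K0 K0D] : exists K0 : nat, D ^+ 2 + 1 <= K0%:R.
  exists (Num.truncn (D ^+ 2 + 1)).+1; apply: ltW; exact: truncnS_gt.
exists K0 => K K0K.
have KD : D ^+ 2 + 1 <= K%:R by apply: le_trans K0D _; rewrite ler_nat.
have Kp : 0 < K%:R :> R by apply: lt_le_trans KD; rewrite ltr_wpDl ?sqr_ge0//.
pose q : R := Num.sqrt K%:R.
have q0 : 0 < q by rewrite sqrtr_gt0.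
have qq : q ^+ 2 = K%:R by rewrite sqr_sqrtr// ltW.
have Dq : D <= q.
  rewrite -(ler_pXn2r (n := 2))// ?nnegrE// ?(ltW q0)//; rewrite qq.
  by apply: le_trans KD; lra.
have [h1 _] := rad_spread_softmax a K b0.
have [_ h2] := rad_spread_softmax b K b0.
rewrite -/q in h1 h2.
apply: le_trans h1 _.
apply: (@le_trans _ _ (rad (spread K b) + L / beta + K%:R * (24 * beta ^+ 2 * (q^-1 * A) ^+ 3))).
  apply: le_trans (iter_radstep_le (c := 24 * beta ^+ 2 * (q^-1 * A) ^+ 3) (b := fun o i =>
    q^-1 * b' o i) _ _ _) _.
    move=> u; apply: (softmax_step_le None) => //.
    - move=> s; under eq_bigr do rewrite normrM ger0_norm ?invr_ge0 ?(ltW q0)//.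
      rewrite -mulr_sumr; apply: ler_wpM2l; first by rewrite invr_ge0 (ltW q0).
      exact: aA.
    - move=> s; under eq_bigr do rewrite normrM ger0_norm ?invr_ge0 ?(ltW q0)//.
      rewrite -mulr_sumr; apply: ler_wpM2l; first by rewrite invr_ge0 (ltW q0).
      exact: bA.
    - have -> : beta * (q^-1 * A) = beta * A / q by ring.
      by rewrite ler_pdivrMr//; move: Dq D2; rewrite DE; lra.
    - move=> s t.
      under eq_bigr do rewrite -mulrBr exprMn; rewrite -mulr_sumr.
      under [leRHS]eq_bigr do rewrite -mulrBr exprMn; rewrite -mulr_sumr.
      by apply: ler_wpM2l; [exact: sqr_ge0|exact: ab].
  by rewrite lerD2r.
rewrite -addrA lerD2l.
have -> : eta = eta / 2 + eta / 2 by field.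
apply: lerD.
  rewrite ler_pdivrMr//.
  by rewrite betaE; lra.
have -> : K%:R * (24 * beta ^+ 2 * (q^-1 * A) ^+ 3) = 24 * beta ^+ 2 * A ^+ 3 / q.
  by rewrite -qq; field; rewrite gt_eqF.
rewrite ler_pdivrMr//.
have : 48 * beta ^+ 2 * A ^+ 3 / eta <= q by apply: le_trans Dq; rewrite DE; move: D1; lra.
rewrite ler_pdivrMr//; lra.
Qed.

End comparison.

(** * Gaussian width dominates normalised Rademacher averages *)

Section gaussian.
Context {R : realType}.
Notation mu := (@lebesgue_measure R).
Notation gam := (normal_prob (0:R) 1).
Notation p := (normal_pdf (0:R) 1).

(** Monotone convergence reduces the identity to indicators, for which it is the definition
    of [normal_prob]. *)
Lemma ge0_integral_normal (f : R -> \bar R) :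
  measurable_fun [set: R] f -> (forall x, 0 <= f x)%E ->
  (\int[gam]_x f x = \int[mu]_x (f x * (p x)%:E))%E.
Proof.
move=> mf f0.
have mp : measurable_fun [set: R] (EFin \o p).
  by apply/measurable_EFinP; exact: measurable_normal_pdf.
have p0 x : (0 <= (p x)%:E)%E by rewrite lee_fin normal_pdf_ge0.
pose f_ := nnsfun_approx measurableT mf.
have mf_ n : measurable_fun [set: R] (f_ n) by exact: measurable_funPT.
have f_ge0 n x : 0 <= f_ n x by exact: fun_ge0.
have nd_f x a b : (a <= b)%N -> f_ a x <= f_ b x.
  by move=> ab; exact/lefP/nd_nnsfun_approx.
have cvg_f x : (f_ n x)%:E @[n --> \oo] --> f x.
  by apply: cvg_nnsfun_approx.
transitivity (limn (fun n => \int[gam]_x (f_ n x)%:E))%E.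
  rewrite -monotone_convergence//=.
  - by apply: eq_integral => x _; apply/esym/cvg_lim => //; exact: cvg_f.
  - by move=> n; apply/measurable_EFinP; exact: mf_.
  - by move=> n x _; rewrite lee_fin.
  - by move=> x _ a b ab; rewrite lee_fin; exact: nd_f.
have -> : (\int[mu]_x (f x * (p x)%:E))%E =
    limn (fun n => \int[mu]_x ((f_ n x)%:E * (p x)%:E))%E.
  rewrite -monotone_convergence//=.
  - apply: eq_integral => x _; apply/esym/cvg_lim => //.
    apply: cvgeZr => //; exact: cvg_f.
  - by move=> n; apply: emeasurable_funM; [apply/measurable_EFinP; exact: mf_|exact: mp].
  - by move=> n x _; rewrite mule_ge0// lee_fin.
  - by move=> x _ a b ab; rewrite lee_pmul// ?lee_fin//; exact: nd_f.
congr (limn _); apply/funext => n.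
have mi (y : R) : measurable_fun [set: R]
    (fun x : R => (y * \1_(f_ n @^-1` [set y]) x)%:E).
  by apply/measurable_EFinP; exact: measurable_funM.
have i0 (y x : R) : (0 <= (y * \1_(f_ n @^-1` [set y]) x)%:E)%E.
  by rewrite nnfun_muleindic_ge0.
have fE x : (f_ n x)%:E =
    (\sum_(y \in range (f_ n)) (y * \1_(f_ n @^-1` [set y]) x)%:E)%E.
  by rewrite fsumEFin// -fimfunE.
under eq_integral do rewrite fE.
rewrite ge0_integral_fsum//=.
under [RHS]eq_integral do rewrite fE ge0_mule_fsuml//.
rewrite [RHS]ge0_integral_fsum//=; last 2 first.
- by move=> y; apply: emeasurable_funM; [exact: mi|exact: mp].
- by move=> y x _; rewrite mule_ge0.
apply: eq_fsbigr => y _.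
have [y0|y0] := leP 0 y; last first.
  rewrite preimage_nnfun0// !integral0_eq//= => x _; rewrite indicE in_set0 mulr0//.
  by rewrite mul0e.
have m1 : measurable_fun [set: R] (fun x : R => (\1_(f_ n @^-1` [set y]) x : R)%:E).
  by apply/measurable_EFinP; exact: measurable_indic.
under eq_integral do rewrite EFinM.
rewrite ge0_integralZl//=.
under [RHS]eq_integral do rewrite EFinM -muleA.
rewrite [RHS]ge0_integralZl//=; last 2 first.
- by apply: emeasurable_funM; [exact: m1|exact: mp].
- by move=> x _; rewrite mule_ge0// lee_fin.
congr (_ * _)%E.
rewrite integral_indic//=; last first.
  by rewrite -[X in measurable X]setTI; exact: (mf_ n).
rewrite setIT /normal_prob integral_mkcond.
apply: eq_integral => x _; rewrite patchE indicE.
by case: ifP => _; rewrite ?mul1e ?mul0e.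
Qed.

Lemma normal_pdf01E x : p x = normal_peak 1 * expR (- (x ^+ 2 / 2)).
Proof.
by rewrite normal_pdfE ?oner_eq0// /normal_fun subr0 expr1n mulNr.
Qed.

Lemma continuous_normal_pdf01 : continuous p.
Proof. by apply: continuous_normal_pdf; rewrite oner_eq0. Qed.

Lemma integral_affine (G : R -> R) (a b : R) : 0 < a -> continuous G ->
  (forall x, 0 <= G x) ->
  (\int[mu]_x (G x)%:E = \int[mu]_x (G (a * x + b) * a)%:E)%E.
Proof.
move=> a0 cG G0.
pose F (x : R) : R := a * x + b.
have dF (x : R) : is_derive x 1 F a.
  by rewrite /F; apply: is_derive_eq; rewrite addr0 /GRing.scale/= mulr1.
have F'E : F^`()%classic = cst a.
  by apply/funext => x; rewrite derive1E derive_val.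
rewrite (increasing_ge0_integration_by_substitutionT (F := F))//.
- by apply: eq_integral => x _; rewrite F'E.
- by move=> x y xy; rewrite /F ltrD2r ltr_pM2l.
- by rewrite F'E => ?; exact: cvg_cst.
- by rewrite F'E; exact: is_cvg_cst.
- by rewrite F'E; exact: is_cvg_cst.
- apply/cvgrNyPle => A; near=> x.
  by rewrite /F -lerBrDr mulrC -ler_pdivlMr//; near: x; exact: nbhs_ninfty_le.
- apply/cvgryPge => A; near=> x.
  by rewrite /F -lerBlDr mulrC -ler_pdivrMr//; near: x; exact: nbhs_pinfty_ge.
Unshelve. all: by end_near. Qed.

Lemma ge0_integral_normalN (f : R -> R) :
  continuous f -> (forall x, 0 <= f x) ->
  (\int[gam]_x (f (- x))%:E = \int[gam]_x (f x)%:E)%E.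
Proof.
move=> cf f0.
have mp : measurable_fun [set: R] (EFin \o p).
  by apply/measurable_EFinP; exact: measurable_normal_pdf.
have mf : measurable_fun [set: R] (EFin \o f).
  by apply/measurable_EFinP; exact: continuous_measurable_fun.
have mfN : measurable_fun [set: R] (fun x => (f (- x))%:E).
  by apply: (measurableT_comp mf); exact: oppr_measurable.
rewrite !ge0_integral_normal//; last by move=> x; rewrite lee_fin.
pose g x := ((f x)%:E * (p x)%:E)%E.
have mg : measurable_fun [set: R] g by exact: emeasurable_funM.
have mN : measurable_fun [set: R] (-%R : R -> measurableTypeR R) by exact: oppr_measurable.
transitivity (\int[pushforward mu (-%R : R -> measurableTypeR R)]_x g x)%E.
  rewrite ge0_integral_pushforward//=.
  - apply: eq_integral => x _; rewrite /g/= !normal_pdf01E sqrrN//.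
  - by move=> x _; rewrite /g mule_ge0// lee_fin// normal_pdf_ge0.
by apply: eq_measure_integral => A mA _; exact: lebesgue_measureN.
Qed.

(** The law of (g + g') / sqrt 2 is N(0, 1).  Substituting y = sqrt 2 z - x and exchanging the
    integrals, p x * p (sqrt 2 z - x) = p z * p (sqrt 2 x - z), and the last factor integrates
    to 1 / sqrt 2. *)
Lemma ge0_integral_normal_stable (f : R -> R) :
  continuous f -> (forall x, 0 <= f x) ->
  (\int[gam]_x \int[gam]_y (f ((x + y) / Num.sqrt 2))%:E = \int[gam]_x (f x)%:E)%E.
Proof.
move=> cf f0.
have s0 : 0 < Num.sqrt 2 :> R by rewrite sqrtr_gt0.
set s : R := Num.sqrt 2 in s0 *.
have ss : s ^+ 2 = 2 by rewrite sqr_sqrtr.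
have mp : measurable_fun [set: R] p by exact: measurable_normal_pdf.
have mf : measurable_fun [set: R] f by exact: continuous_measurable_fun.
have p0 x : 0 <= p x by exact: normal_pdf_ge0.
pose h (xz : R * R) : \bar R := (f xz.2 * p xz.1 * p (s * xz.2 - xz.1) * s)%:E.
pose k (xy : R * R) : \bar R := (f ((xy.1 + xy.2) / s))%:E.
have mk : measurable_fun setT k.
  apply/measurable_EFinP; apply: measurableT_comp => //.
  by apply: measurable_funM => //; apply: measurable_funD.
have mh : measurable_fun setT h.
  apply/measurable_EFinP; apply: measurable_funM => //.
  apply: measurable_funM; first by apply: measurable_funM; apply: measurableT_comp.
  apply: measurableT_comp => //; apply: measurable_funB => //.
  by apply: measurable_funM.
rewrite ge0_integral_normal; last 2 first.
- by apply: (measurable_fun_fubini_tonelli_F (m2 := gam) k) => // x; rewrite lee_fin.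
- by move=> x; apply: integral_ge0 => y _; rewrite lee_fin.
transitivity (\int[mu]_x \int[mu]_z h (x, z))%E.
  apply: eq_integral => x _.
  rewrite ge0_integral_normal; last 2 first.
  - by apply/measurable_EFinP; apply: measurableT_comp => //; apply: measurable_funM => //;
    apply: measurable_funD.
  - by move=> y; rewrite lee_fin.
  rewrite -ge0_integralZr//; last 3 first.
  - apply/measurable_EFinP; apply: measurable_funM => //.
    by apply: measurableT_comp => //; apply: measurable_funM => //; apply: measurable_funD.
  - by move=> y _; rewrite -EFinM lee_fin mulr_ge0.
  - by rewrite lee_fin.
  under eq_integral do rewrite -!EFinM.
  rewrite (@integral_affine (fun y => f ((x + y) / s) * p y * p x) s (- x))//; last 2 first.
  - move=> y; apply: cvgM; last exact: cvg_cst.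
    apply: cvgM; last exact: continuous_normal_pdf01.
    apply: (cvg_comp (fun y => (x + y) / s) f); last exact: cf.
    by apply: cvgM; [apply: cvgD; [exact: cvg_cst|exact: cvg_id]|exact: cvg_cst].
  - by move=> y; rewrite !mulr_ge0.
  apply: eq_integral => z _; rewrite /h/=; congr (_%:E).
  have -> : (x + (s * z - x)) / s = z by field; rewrite gt_eqF.
  by ring.
have h0 xz : (0 <= h xz)%E by rewrite lee_fin !mulr_ge0// ltW.
transitivity (\int[mu]_z \int[mu]_x h (x, z))%E.
  exact: (@fubini_tonelli _ _ (measurableTypeR R) (measurableTypeR R) R mu mu h).
rewrite ge0_integral_normal; last 2 first.
- exact/measurable_EFinP.
- by move=> y; rewrite lee_fin.
apply: eq_integral => z _.
transitivity (\int[mu]_x ((f z * p z)%:E * (p (s * x - z) * s)%:E))%E.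
  apply: eq_integral => x _; rewrite /h/= -EFinM; congr (_%:E).
  rewrite !mulrA; congr (_ * s); rewrite -!mulrA; congr (_ * _).
  rewrite !normal_pdf01E mulrACA [in RHS]mulrACA -!expRD; congr (_ * expR _).
  rewrite -!opprD -!mulrDl; congr (- (_ / 2)).
  by rewrite !sqrrB !exprMn ss; ring.
rewrite ge0_integralZl//; last 3 first.
- apply/measurable_EFinP; apply: measurable_funM => //.
  apply: measurableT_comp => //; apply: measurable_funB => //.
- by move=> x _; rewrite lee_fin mulr_ge0// ltW.
- by rewrite lee_fin mulr_ge0.
rewrite -(@integral_affine p s (- z))//; last exact: continuous_normal_pdf01.
by rewrite integral_normal_pdf mule1 EFinM.
Qed.

End gaussian.

Section pmax_regularity.
Context {R : realType} {T : finType}.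

Lemma continuous_pmax (f : T -> R -> R) :
  (forall t, continuous (f t)) -> continuous (fun x => pmax (f ^~ x)).
Proof.
move=> cf x; rewrite /pmax; elim: (index_enum T) => [|t r IH].
  have -> : (fun x0 : R => \big[Num.max/0]_(t <- [::]) f t x0) = cst 0.
    by apply/funext => y; rewrite big_nil.
  exact: cst_continuous.
have -> : (fun y : R => \big[Num.max/0]_(s <- t :: r) f s y) =
    (f t \max (fun y => \big[Num.max/0]_(s <- r) f s y)).
  by apply/funext => y; rewrite big_cons.
by apply: continuous_max; [exact: cf|exact: IH].
Qed.

Lemma measurable_pmax d (X : measurableType d) (f : T -> X -> R) :
  (forall t, measurable_fun setT (f t)) ->
  measurable_fun setT (fun x => pmax (f ^~ x)).
Proof.
move=> mf; rewrite /pmax; elim: (index_enum T) => [|t r IH].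
  by under eq_fun do rewrite big_nil; exact: measurable_cst.
by under eq_fun do rewrite big_cons; apply: measurable_maxr.
Qed.

End pmax_regularity.

Section avg_integral.
Context d (X : measurableType d) (R : realType) (P : {measure set X -> \bar R}).

Lemma le_avg_integral (W : finType) (h : W -> R) (f : W -> X -> R) :
  (forall w, measurable_fun setT (f w)) -> (forall w x, 0 <= f w x) ->
  (forall w, ((h w)%:E <= \int[P]_x (f w x)%:E)%E) ->
  ((avg h)%:E <= \int[P]_x (avg (f ^~ x))%:E)%E.
Proof.
move=> mf f0 hf.
rewrite /avg mulrC EFinM.
under eq_integral do rewrite mulrC EFinM.
rewrite ge0_integralZl//; last 2 first.
- by apply/measurable_EFinP; apply: measurable_sum => w; exact: mf.
- by move=> x _; rewrite lee_fin sumr_ge0.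
apply: lee_wpmul2l; first by rewrite lee_fin invr_ge0.
under eq_integral do rewrite -sumEFin.
rewrite -sumEFin ge0_integral_sum//.
- exact: lee_sum.
- by move=> w; apply/measurable_EFinP; exact: mf.
- by move=> w x _; rewrite lee_fin.
Qed.

End avg_integral.

Section gaussian_width.
Context {R : realType}.
Notation gam := (normal_prob (0:R) 1).
Notation p := (normal_pdf (0:R) 1).

Definition gauss_tail_set : set R := [set x | 1 <= `|x|].

Lemma measurable_gauss_tail_set : measurable gauss_tail_set.
Proof.
have -> : gauss_tail_set = (@Num.norm R R) @^-1` `[1, +oo[%classic.
  by apply/seteqP; split=> x /=; rewrite in_itv/= andbT.
by rewrite -[X in measurable X]setTI; exact: normr_measurable.
Qed.

(** The constant of the convex domination in [gauss_dominates]. *)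
Definition gauss_tail : R := fine (gam gauss_tail_set).

Lemma gauss_tailE : gam gauss_tail_set = gauss_tail%:E.
Proof. by rewrite /gauss_tail fineK// fin_num_measure//; exact: measurable_gauss_tail_set. Qed.

Lemma gauss_tail_le1 : gauss_tail <= 1.
Proof. by rewrite -lee_fin -gauss_tailE; apply: probability_le1; exact:
  measurable_gauss_tail_set. Qed.

Lemma gauss_tail_gt0 : 0 < gauss_tail.
Proof.
rewrite -lte_fin -gauss_tailE.
apply: (@lt_le_trans _ _ (gam `[1, 2]%classic)); last first.
  apply: le_measure; rewrite ?inE//; first exact: measurable_gauss_tail_set.
  by move=> x /=; rewrite in_itv/= => /andP[x1 _]; rewrite /gauss_tail_set/= ger0_norm//
    (le_trans _ x1).
rewrite /normal_prob.
have h1 : (0 < \int[lebesgue_measure]_(x in (`[1%R, 2%R]%classic : set R)) (p 2)%:E)%E.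
  rewrite integral_cst//= lebesgue_measure_itv/= lte_fin ltr1n -EFinB.
  rewrite -EFinM lte_fin normal_pdf01E mulr_gt0 ?mulr_gt0 ?expR_gt0 ?normal_peak_gt0 ?oner_eq0//.
apply: (lt_le_trans h1).
apply: ge0_le_integral => //=.
- by move=> x _; rewrite lee_fin normal_pdf_ge0.
- by apply/measurable_funTS/measurable_EFinP; exact: measurable_normal_pdf.
- move=> x; rewrite in_itv/= => /andP[x1 x2]; rewrite lee_fin !normal_pdf01E.
  rewrite ler_wpM2l ?normal_peak_ge0// ler_expR lerN2 ler_wpM2r ?invr_ge0//.
  by rewrite lerXn2r// nnegrE// (le_trans _ x1).
Qed.

Context {T : finType}.
Implicit Types u c : T -> R.

Definition gauss_pmax u c : \bar R := (\int[gam]_x (pmax (fun t => u t + x * c t))%:E)%E.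

Lemma continuous_pmax_affine u c : continuous (fun x : R => pmax (fun t => u t + x * c t)).
Proof.
apply: (continuous_pmax (f := fun t x => u t + x * c t)) => t x; apply: cvgD; first exact:
  cvg_cst.
by apply: cvgM; [exact: cvg_id|exact: cvg_cst].
Qed.

Lemma pmax_convex u c (k x : R) : 0 <= k -> k <= x -> 0 < x ->
  pmax (fun t => u t + k * c t) <= (1 - k / x) * pmax u + (k / x) * pmax (fun t => u t + x * c t).
Proof.
move=> k0 kx x0.
rewrite -pmaxZ ?subr_ge0 ?ler_pdivrMr ?mul1r// -pmaxZ ?divr_ge0// ?(ltW x0)//.
apply: le_trans (pmaxD _ _); apply: le_pmax2 => t.
by rewrite le_eqVlt; apply/orP; left; apply/eqP; field; rewrite gt_eqF.
Qed.

Definition even_pmax u c (x : R) : R :=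
  (pmax (fun t => u t + x * c t) + pmax (fun t => u t - x * c t)) / 2.

(** Domination of a single sign in convex order.  The even part psi of the convex function
    satisfies psi x >= psi 0 + (psi k - psi 0) / k whenever 0 < k <= 1 <= |x|; integrating this
    over |x| >= 1, an event of probability k, gives psi k. *)
Lemma gauss_pmax_one_step u c : ((even_pmax u c gauss_tail)%:E <= gauss_pmax u c)%E.
Proof.
pose phi x := pmax (fun t => u t + x * c t).
have phiN x : pmax (fun t => u t - x * c t) = phi (- x).
  by apply: eq_pmax => t; rewrite mulNr.
have phi0 x : 0 <= phi x by exact: pmax_ge0.
have mphi : measurable_fun [set: R] phi.
  by apply: continuous_measurable_fun; exact: continuous_pmax_affine.
have E0 : even_pmax u c 0 = pmax u.
  rewrite /even_pmax; have -> : pmax (fun t => u t + 0 * c t) = pmax u by apply: eq_pmax => t;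
    rewrite mul0r addr0.
  by have -> : pmax (fun t => u t - 0 * c t) = pmax u; [apply: eq_pmax => t; rewrite mul0r
    subr0|field].
have even_ge0 x : pmax u <= even_pmax u c x.
  rewrite /even_pmax ler_pdivlMr//.
  have -> : pmax u * 2 = pmax (fun t => 2 * u t) by rewrite pmaxZ// mulrC.
  by apply: le_trans (pmaxD _ _); apply: le_pmax2 => t; lra.
have evenN x : even_pmax u c (- x) = even_pmax u c x.
  by rewrite /even_pmax addrC; congr ((_ + _) / 2); apply: eq_pmax => t; rewrite mulNr ?opprK.
(* The slope of the chord of the even part between 0 and gauss_tail. *)
pose D := (even_pmax u c gauss_tail - pmax u) / gauss_tail.
have D0 : 0 <= D by rewrite divr_ge0 ?subr_ge0// ltW// gauss_tail_gt0.
have pt x : pmax u + D * \1_gauss_tail_set x <= even_pmax u c x.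
  rewrite indicE; have [xt|] := boolP (x \in gauss_tail_set); last by rewrite mulr0 addr0.
  rewrite mulr1 /D; move: xt; rewrite inE /gauss_tail_set/= => x1.
  wlog x0 : x x1 / 0 < x.
    move=> H; have [x0|x0] := ltP 0 x; first exact: H.
    rewrite -(evenN x); apply: H; first by rewrite normrN.
    by rewrite oppr_gt0 lt_neqAle x0 andbT; apply: contraTneq x1 => ->; rewrite normr0 -ltNge.
  rewrite gtr0_norm// in x1.
  have tx : gauss_tail <= x by exact: le_trans gauss_tail_le1 x1.
  have h1 := pmax_convex u c (ltW gauss_tail_gt0) tx x0.
  have h2 := pmax_convex u (fun t => - c t) (ltW gauss_tail_gt0) tx x0.
  have h : even_pmax u c gauss_tail <= (1 - gauss_tail / x) * pmax u + gauss_tail / x *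
    even_pmax u c x.
    rewrite /even_pmax.
    have e k : pmax (fun t => u t - k * c t) = pmax (fun t => u t + k * - c t).
      by apply: eq_pmax => t; rewrite mulrN.
    rewrite !e; move: h1 h2; lra.
  have t0 := gauss_tail_gt0.
  have h3 : (even_pmax u c gauss_tail - pmax u) <= (even_pmax u c x - pmax u) * gauss_tail.
    apply: (@le_trans _ _ ((gauss_tail / x) * (even_pmax u c x - pmax u))); first by move: h; lra.
    rewrite mulrC; apply: ler_wpM2l; first by rewrite subr_ge0.
    by rewrite ler_pdivrMr// ler_peMr// ltW.
  by rewrite addrC -lerBrDr ler_pdivrMr.
rewrite /gauss_pmax.
pose f x : R := phi x / 2.
have f_ge0 x : 0 <= f x by rewrite divr_ge0.
have cf : continuous f.
  by move=> x; apply: cvgM; [exact: continuous_pmax_affine|exact: cvg_cst].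
have mf : measurable_fun [set: R] (fun x => (f x)%:E).
  by apply/measurable_EFinP; exact: continuous_measurable_fun.
have mfN : measurable_fun [set: R] (fun x => (f (- x))%:E).
  by apply: (measurableT_comp mf); exact: oppr_measurable.
have evenE x : even_pmax u c x = f x + f (- x).
  by rewrite /even_pmax phiN mulrDl.
have -> : (\int[gam]_x (phi x)%:E = \int[gam]_x (even_pmax u c x)%:E)%E.
  transitivity (\int[gam]_x ((f x)%:E + (f (- x))%:E))%E; last first.
    by apply: eq_integral => x _; rewrite evenE EFinD.
  have f0 x : [set: R] x -> (0 <= (f x)%:E)%E by rewrite lee_fin.
  have fN0 x : [set: R] x -> (0 <= (f (- x))%:E)%E by rewrite lee_fin.
  rewrite [RHS]ge0_integralD//.
  rewrite [X in (_ + X)%E]ge0_integral_normalN//.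
  rewrite -ge0_integralD//.
  by apply: eq_integral => x _; rewrite -EFinD; congr (_%:E); rewrite /f; field.
have meven : measurable_fun [set: R] (fun x => (even_pmax u c x)%:E).
  by under eq_fun do rewrite evenE EFinD; apply: emeasurable_funD.
have mtail : measurable_fun [set: R] (fun x => (\1_gauss_tail_set x : R)%:E).
  by apply/measurable_EFinP; apply: measurable_indic; exact: measurable_gauss_tail_set.
have mDtail : measurable_fun [set: R] (fun x => (D * \1_gauss_tail_set x : R)%:E).
  apply/measurable_EFinP; apply: measurable_funM => //.
  by apply: measurable_indic; exact: measurable_gauss_tail_set.
apply: (@le_trans _ _ (\int[gam]_x ((pmax u)%:E + (D * \1_gauss_tail_set x)%R%:E)%E)%E); last
  first.
  apply: ge0_le_integral => //=.
  - by move=> x _; rewrite lee_fin addr_ge0 ?pmax_ge0// mulr_ge0.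
  - by apply: emeasurable_funD.
  - by move=> x _; rewrite lee_fin.
rewrite ge0_integralD//; last 2 first.
- by move=> x _; rewrite lee_fin pmax_ge0.
- by move=> x _; rewrite lee_fin mulr_ge0.
under [X in (_ + X)%E]eq_integral do rewrite EFinM.
rewrite integral_cst//= probability_setT mule1 ge0_integralZl//.
rewrite integral_indic ?setIT; [|by []|exact: measurable_gauss_tail_set].
rewrite [X in (_ * X)%E]gauss_tailE.
rewrite -EFinM -EFinD lee_fin /D divfK ?gt_eqF ?gauss_tail_gt0//.
by rewrite addrC subrK.
Qed.

End gaussian_width.

Lemma card_bij (A B : finType) : #|A| = #|B| -> exists e : A -> B, bijective e.
Proof.
move=> AB; exists (fun x => enum_val (cast_ord AB (enum_rank x))).
exists (fun y => enum_val (cast_ord (esym AB) (enum_rank y))) => x.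
  by rewrite enum_valK cast_ordK enum_rankK.
by rewrite enum_valK cast_ordKV enum_rankK.
Qed.

Section gauss_dominates.
Context {R : realType} {T : finType}.
Notation gam := (normal_prob (0:R) 1).
Implicit Types u c : T -> R.

Definition gauss_scale (K : finType) : R := gauss_tail / Num.sqrt #|K|%:R.

(** N(0, 1) dominates, in convex order, [gauss_tail] times the normalised sum of #|K| signs. *)
Definition gauss_dominates (K : finType) := forall u c : T -> R,
  ((avg (fun s : signs K => pmax (fun t => (u t + sgn_sum s (fun=> gauss_scale K * c t))%R)))%:E
   <= gauss_pmax u c)%E.

Lemma gauss_dominates_bij (K K' : finType) (e : K -> K') : bijective e -> gauss_dominates K ->
  gauss_dominates K'.
Proof.
move=> be gK u c; apply: le_trans (gK u c); rewrite lee_fin.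
rewrite [leRHS](avg_signs_inj _ be) le_eqVlt; apply/orP; left; apply/eqP.
apply: eq_avg => s; apply: eq_pmax => t; congr (_ + _).
rewrite /sgn_sum (reindex e)/=; last exact: onW_bij.
by apply: eq_bigr => k _; rewrite ffunE /gauss_scale (bij_eq_card be).
Qed.

Lemma gauss_dominates_unit : gauss_dominates unit.
Proof.
move=> u c; apply: le_trans (gauss_pmax_one_step u c); rewrite lee_fin.
rewrite (avg_bij (h := fun b : bool => [ffun=> b] : signs unit)); last first.
  exists (fun s : signs unit => s tt); first by move=> b; rewrite ffunE.
  by move=> s; apply/ffunP => -[]; rewrite ffunE.
rewrite /avg big_bool card_bool /even_pmax /gauss_scale card_unit sqrtr1 divr1.
rewrite le_eqVlt; apply/orP; left; apply/eqP; congr (_ / _); rewrite addrC.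
by congr (_ + _); apply: eq_pmax => t; rewrite /= /sgn_sum -(big_mkcond xpredT) (big_pred1
  tt)//= ffunE /sgn ?expr0 ?expr1; ring.
Qed.

(** By stability a standard normal variable is (x + y) / sqrt 2 with independent x and y, and
    each of them dominates a normalised sum of #|K| signs. *)
Lemma gauss_dominates_sum (K : finType) : gauss_dominates K -> gauss_dominates (K + K)%type.
Proof.
move=> gK u c.
have s0 : 0 < Num.sqrt 2 :> R by rewrite sqrtr_gt0.
have gE : gauss_scale (K + K)%type = gauss_scale K / Num.sqrt 2.
  rewrite /gauss_scale card_sum addnn -mul2n natrM sqrtrM// invfM.
  by ring.
pose c' t := c t / Num.sqrt 2.
have -> : gauss_pmax u c = (\int[gam]_x gauss_pmax (fun t => (u t + x * c' t)%R) c')%E.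
  rewrite /gauss_pmax -(@ge0_integral_normal_stable R (fun x => pmax (fun t => u t + x * c t)))//.
  - apply: eq_integral => x _; apply: eq_integral => y _; congr (_%:E).
    by apply: eq_pmax => t; rewrite /c'; ring.
  - exact: continuous_pmax_affine.
  - by move=> x; exact: pmax_ge0.
have cE t : gauss_scale (K + K)%type * c t = gauss_scale K * c' t by rewrite gE /c'; ring.
pose h (w s : signs K) := pmax (fun t => (u t + sgn_sum w (fun=> gauss_scale K * c' t)) +
   sgn_sum s (fun=> gauss_scale K * c' t)).
have -> : avg (fun s : signs (K + K)%type => pmax (fun t => u t + sgn_sum s (fun=> gauss_scale
  (K + K)%type * c t)))
    = avg (fun w => avg (h w)).
  rewrite avg_signs_sum; apply: eq_avg => s; apply: eq_pmax => t.
  by rewrite sgn_sum_sumType addrA cE.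
pose f (w : signs K) (x : R) := pmax (fun t => (u t + sgn_sum w (fun=> gauss_scale K * c' t)) +
  x * c' t).
have cf w : continuous (f w) by exact: continuous_pmax_affine.
apply: (@le_trans _ _ (\int[gam]_x (avg (f ^~ x))%:E)%E).
  apply: le_avg_integral => [w|w x|w].
  - by apply: continuous_measurable_fun; exact: cf.
  - exact: pmax_ge0.
  - exact: (gK (fun t => u t + sgn_sum w (fun=> gauss_scale K * c' t)) c').
apply: ge0_le_integral => //.
- by move=> x _; rewrite lee_fin; apply: avg_ge0 => w; exact: pmax_ge0.
- apply/measurable_EFinP; apply: measurable_funM => //.
  by apply: measurable_sum => w; apply: continuous_measurable_fun; exact: cf.
- pose g (xy : R * R) := (pmax (fun t => (u t + xy.1 * c' t) + xy.2 * c' t))%:E.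
  apply: (measurable_fun_fubini_tonelli_F (m2 := gam) g).
    apply/measurable_EFinP.
    apply: (measurable_pmax (f := fun t (xy : R * R) => u t + xy.1 * c' t + xy.2 * c' t)) => t.
    by apply: measurable_funD; [apply: measurable_funD => //|]; apply: measurable_funM.
  by move=> x; rewrite lee_fin; exact: pmax_ge0.
- move=> x _; apply: le_trans (gK _ _); rewrite lee_fin; apply: le_avg => w.
  by apply: le_pmax2 => t; rewrite addrAC.
Qed.

Lemma gauss_dominates_pow2 (p : nat) (K : finType) : #|K| = (2 ^ p)%N -> gauss_dominates K.
Proof.
elim: p K => [|p IH] K Kp.
  have [|e be] := @card_bij unit K; first by rewrite card_unit Kp.
  exact: gauss_dominates_bij be gauss_dominates_unit.
have [|e be] := @card_bij ('I_(2 ^ p) + 'I_(2 ^ p))%type K.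
  by rewrite card_sum !card_ord Kp expnS addnn mul2n.
by apply: gauss_dominates_bij be _; apply: gauss_dominates_sum; apply: IH; rewrite card_ord.
Qed.

Lemma measurable_pmax_tuple n (u : T -> R) (c : T -> 'I_n -> R) :
  measurable_fun [set: n.-tuple (measurableTypeR R)]
    (fun g : n.-tuple (measurableTypeR R) => pmax (fun t => u t + \sum_i tnth g i * c t i)).
Proof.
apply: (measurable_pmax (f := fun t (g : n.-tuple (measurableTypeR R)) => u t + \sum_i tnth g i
  * c t i)) => t.
apply: measurable_funD => //; apply: measurable_sum => i; apply: measurable_funM => //.
exact: measurable_tnth.
Qed.

(** One coordinate at a time, by Tonelli's theorem along the recursive definition of
    [std_gaussian]. *)
Lemma std_gaussian_dominates (K : finType) n (u : T -> R) (c : T -> 'I_n -> R) :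
  gauss_dominates K ->
  ((avg (fun s : signs (K * 'I_n)%type => pmax (fun t => (u t +
      sgn_sum s (fun p => gauss_scale K * c t p.2))%R)))%:E
   <= \int[std_gaussian n]_g (pmax (fun t => (u t + \sum_i tnth g i * c t i)%R))%:E)%E.
Proof.
move=> gK; elim: n u c => [|n IH] u c.
  rewrite integral_dirac//; last first.
    by apply/measurable_EFinP; exact: measurable_pmax_tuple.
  rewrite diracT mul1e lee_fin -[leRHS](avg_cst _ (signs_gt0 (K * 'I_0)%type)).
  apply: le_avg => s; apply: le_pmax2 => t.
  by rewrite /sgn_sum !big1//; [move=> [] []|move=> [? []]].
pose c0 t := c t ord0; pose c1 t (i : 'I_n) := c t (lift ord0 i).
pose F (g : n.+1.-tuple (measurableTypeR R)) : \bar R :=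
  (pmax (fun t => (u t + \sum_i tnth g i * c t i)%R))%:E.
have mF : measurable_fun setT F by apply/measurable_EFinP; exact: measurable_pmax_tuple.
have F0 g : (0 <= F g)%E by rewrite lee_fin; exact: pmax_ge0.
have FE x (v : n.-tuple (measurableTypeR R)) : F (tcons (x, v)) =
    (pmax (fun t => ((u t + x * c0 t) + \sum_i tnth v i * c1 t i)%R))%:E.
  rewrite /F; congr (_%:E); apply: eq_pmax => t; rewrite big_ord_recl addrA.
  by congr (_ + _); apply: eq_bigr => i _; rewrite tnthS.
have -> : (\int[std_gaussian n.+1]_g F g =
    \int[gam]_x \int[std_gaussian n]_v F (tcons (x, v)))%E.
  rewrite /= ge0_integral_distribution//.
  rewrite (fubini_tonelli1 (m1 := gam) (m2 := std_gaussian n))//.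
    by apply: (measurableT_comp mF); exact: measurable_tcons.
  by move=> z; exact: F0.
pose f (w : signs (K * 'I_n)%type) (x : R) := 
  pmax (fun t => (u t + sgn_sum w (fun p => gauss_scale K * c1 t p.2)) + x * c0 t).
have cf w : continuous (f w) by exact: continuous_pmax_affine.
apply: (@le_trans _ _ (\int[gam]_x (avg (f ^~ x))%:E)%E).
  apply: (@le_trans _ _ (avg (fun w : signs (K * 'I_n)%type => avg (fun s : signs K =>
     pmax (fun t => (u t + sgn_sum w (fun p => gauss_scale K * c1 t p.2)) +
      sgn_sum s (fun=> gauss_scale K * c0 t)))))%:E).
    rewrite lee_fin avg_signs_sum.
    pose e (z : K * 'I_n + K) : K * 'I_n.+1 :=
      match z with inl p => (p.1, lift ord0 p.2) | inr k => (k, ord0) end.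
    have be : bijective e.
      exists (fun p => if unlift ord0 p.2 is Some j then inl (p.1, j) else inr p.1).
        by move=> [[k i]|k]/=; rewrite ?unlift_none ?liftK.
      by move=> [k i]/=; case: unliftP => [j ->|->].
    rewrite [leRHS](avg_signs_inj _ be); apply: le_avg => s; apply: le_pmax2 => t.
    rewrite -addrA lerD2l /sgn_sum (reindex e)/=; last exact: onW_bij.
    by rewrite big_sumType/= le_eqVlt; apply/orP; left; apply/eqP; congr (_ + _);
      apply: eq_bigr => j _; rewrite !ffunE.
  apply: le_avg_integral => [w|w x|w].
  - by apply: continuous_measurable_fun; exact: cf.
  - exact: pmax_ge0.
  - exact: (gK (fun t => u t + sgn_sum w (fun p => gauss_scale K * c1 t p.2)) c0).
apply: ge0_le_integral => //.
- by move=> x _; rewrite lee_fin; apply: avg_ge0 => w; exact: pmax_ge0.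
- apply/measurable_EFinP; apply: measurable_funM => //.
  by apply: measurable_sum => w; apply: continuous_measurable_fun; exact: cf.
- apply: (measurable_fun_fubini_tonelli_F (m2 := std_gaussian n) (F \o @tcons R n)).
    by apply: (measurableT_comp mF); exact: measurable_tcons.
  by move=> z; exact: F0.
- move=> x _.
  under eq_integral do rewrite FE.
  apply: le_trans (IH (fun t => u t + x * c0 t) c1); rewrite lee_fin; apply: le_avg => w.
  by apply: le_pmax2 => t; rewrite addrAC.
Qed.

(** The integral of a nonnegative function is the supremum of the integrals of the simple
    functions below it, so monotonicity holds for the supremum over an arbitrary set [S]. *)
Lemma ge0_le_integral_nonmeasurable d (X : measurableType d)
    (mu : {measure set X -> \bar R}) (f g : X -> \bar R) :
  (forall x, 0 <= f x)%E -> (forall x, f x <= g x)%E ->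
  (\int[mu]_x f x <= \int[mu]_x g x)%E.
Proof.
move=> f0 fg; have g0 x : (0 <= g x)%E by exact: le_trans (fg x).
rewrite !ge0_integralTE//; apply: ereal_sup_le => _ [h hf <-].
by exists h => // x; exact: le_trans (fg x).
Qed.

Lemma rad_le_gaussian_width n (S : set 'rV[R]_n) (x : T -> 'rV[R]_n) (p : nat) :
  (forall v t, ((dotr v (x t))%:E <= ereal_sup [set (dotr v z)%:E | z in S])%E) ->
  (forall v, (0 <= ereal_sup [set (dotr v z)%:E | z in S])%E) ->
  ((gauss_tail * rad (spread (2 ^ p) (fun t i => x t 0 i)))%:E <= gaussian_width S)%E.
Proof.
move=> xS S0.
have gK : gauss_dominates 'I_(2 ^ p) by apply: (@gauss_dominates_pow2 p); rewrite card_ord.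
apply: (@le_trans _ _ (\int[std_gaussian n]_g
    (pmax (fun t => (0 + \sum_i tnth g i * x t 0 i)%R))%:E)%E); last first.
  apply: ge0_le_integral_nonmeasurable => g; first by rewrite lee_fin pmax_ge0.
  set w := ereal_sup _.
  have w0 : (0 <= w)%E by exact: S0.
  case wr : w w0 => [r| |//]; last by move=> _; rewrite leey.
  rewrite lee_fin => r0; rewrite lee_fin; apply: pmax_le => // t.
  rewrite -lee_fin -wr add0r /w; apply: (le_trans _ (xS (\row_i tnth g i) t)).
  by rewrite lee_fin le_eqVlt; apply/orP; left; apply/eqP; apply: eq_bigr => i _; rewrite mxE.
apply: le_trans (std_gaussian_dominates (fun=> 0) (fun t i => x t 0 i) gK).
rewrite lee_fin -(radZ _ (ltW gauss_tail_gt0)) /rad; apply: le_avg => s; apply: le_pmax2 => t.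
rewrite add0r le_eqVlt; apply/orP; left; apply/eqP; apply: eq_sgn_sum => q.
by rewrite /spread /gauss_scale card_ord mulrA.
Qed.

End gauss_dominates.

(** * Decoupling and the deviation of a random sign matrix *)

Section decoupling.
Context {R : realType} {T : finType} {m n : nat}.
Notation I := ('I_m * 'I_n)%type.

Definition sgn_entries (s : signs I) : I -> R := fun p => sgn (s p).

(** The product of the [m] x [n] matrix with entries [h] and the vector [v]. *)
Definition mxapply (h : I -> R) (v : 'I_n -> R) (i : 'I_m) : R := \sum_j h (i, j) * v j.

Definition bilform (x y : T -> 'I_n -> R) (h k : I -> R) (t : T) : R :=
  \sum_i mxapply h (x t) i * mxapply k (y t) i.

Lemma mxapply_lin (h h' : I -> R) (a b : R) v i :
  mxapply (fun p => a * h p + b * h' p) v i = a * mxapply h v i + b * mxapply h' v i.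
Proof.
rewrite /mxapply !mulr_sumr -big_split/=; apply: eq_bigr => j _; ring.
Qed.

Lemma bilformC x y h k t : bilform x y h k t = bilform y x k h t.
Proof. by apply: eq_bigr => i _; rewrite mulrC. Qed.

Lemma bilform_linl x y (h h' k : I -> R) (a b : R) t :
  bilform x y (fun p => a * h p + b * h' p) k t = a * bilform x y h k t + b * bilform x y h' k t.
Proof.
rewrite /bilform !mulr_sumr -big_split/=; apply: eq_bigr => i _; rewrite mxapply_lin; ring.
Qed.

Lemma avg_sqr_mxapply v i : avg (fun s : signs I => mxapply (sgn_entries s) v i ^+ 2) = \sum_j
  v j ^+ 2.
Proof.
pose a (p : I) : R := if p.1 == i then v p.2 else 0.
have E s : mxapply (sgn_entries s) v i = sgn_sum s a.
  rewrite /sgn_sum sum_pair (bigD1 i)//= [X in _ + X]big1 ?addr0.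
    by apply: eq_bigr => j _; rewrite /a eqxx.
  by move=> k /negbTE ki; apply: big1 => j _; rewrite /a/= ki mulr0.
under eq_avg do rewrite E expr2.
rewrite avg_sgn_sum2 sum_pair (bigD1 i)//= [X in _ + X]big1 ?addr0.
  by apply: eq_bigr => j _; rewrite /a eqxx expr2.
by move=> k /negbTE ki; apply: big1 => j _; rewrite /a/= ki mulr0.
Qed.

Definition mask (d s : signs I) : I -> R := fun p => if d p then sgn (s p) else 0.

Definition flip (d s : signs I) : signs I := [ffun p => s p (+) d p].
Definition compl (d : signs I) : signs I := [ffun p => ~~ d p].

Lemma maskE d s p : mask d s p = 1 / 2 * sgn_entries s p + 1 / 2 * sgn_entries (flip (compl d)
  s) p.
Proof.
rewrite /mask /sgn_entries /flip !ffunE; case: (d p) => /=; rewrite ?addbF ?addbT; first by field.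
by rewrite /sgn; case: (s p) => /=; rewrite ?expr1 ?expr0; field.
Qed.

(** A masked sign matrix is the mean of two sign matrices with the law of [s], so Jensen's
    inequality fills in the masked entries. *)
Lemma avg_mask_le (d : signs I) x y k :
  avg (fun s => pmax (bilform x y (mask d s) k)) <= avg (fun s => pmax (bilform x y
    (sgn_entries s) k)).
Proof.
have -> : avg (fun s => pmax (bilform x y (sgn_entries s) k)) =
   avg (fun s => 1 / 2 * pmax (bilform x y (sgn_entries s) k) + 1 / 2 * pmax (bilform x y
     (sgn_entries (flip (compl d) s)) k)).
  rewrite avgD !avgZ -(avg_signs_xor (compl d) (fun s => pmax (bilform x y (sgn_entries s) k))).
  by field.
apply: le_avg => s; rewrite -!pmaxZ ?divr_ge0//; apply: le_trans (pmaxD _ _).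
apply: le_pmax2 => t; rewrite -bilform_linl le_eqVlt; apply/orP; left; apply/eqP.
by congr (bilform _ _ _ _ _); apply/funext => p; rewrite maskE.
Qed.

(** The two masked matrices depend on disjoint sets of entries; swapping the entries of [s] and
    [w] in [d] is a measure preserving involution that exhibits their independence. *)
Lemma avg_mask_pair (d : signs I) (F : (I -> R) -> (I -> R) -> R) :
  avg (fun s => F (mask (compl d) s) (mask d s)) =
  avg (fun s => avg (fun w => F (mask (compl d) s) (mask d w))).
Proof.
pose h (p : signs I * signs I) : signs I * signs I :=
  ([ffun q => if d q then p.2 q else p.1 q], [ffun q => if d q then p.1 q else p.2 q]).
have bh : bijective h.
  apply: inv_bij => -[s w]; rewrite /h/=; congr pair; apply/ffunP => q;
  by rewrite !ffunE; case: (d q).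
rewrite avg_pair (avg_bij _ bh)/=.
have -> : (fun p : signs I * signs I => F (mask (compl d) p.1) (mask d p.2)) \o h =
    (fun p : signs I * signs I => F (mask (compl d) p.1) (mask d p.1)).
  apply/funext => -[s w]/=; congr F; apply/funext => q; rewrite /mask !ffunE; by case: (d q).
rewrite -(avg_pair (fun s w : signs I => F (mask (compl d) s) (mask d s))).
by apply: eq_avg => s; rewrite avg_cst// signs_gt0.
Qed.

Lemma avg_bilform_mask_le (d : signs I) x y :
  avg (fun s => pmax (fun t => `|bilform x y (mask d s) (mask (compl d) s) t|)) <=
  2 * avg (fun s => avg (fun w => pmax (bilform x y (sgn_entries s) (sgn_entries w)))).
Proof.
pose d' := compl d.
have dd : compl d' = d by apply/ffunP => q; rewrite !ffunE negbK.
rewrite -{1}dd.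
have key (e : R) : e = 1 \/ e = -1 ->
    avg (fun s => pmax (fun t => e * bilform x y (mask (compl d') s) (mask d' s) t)) <=
    avg (fun s => avg (fun w => pmax (bilform x y (sgn_entries s) (sgn_entries w)))).
  move=> he.
  rewrite (avg_mask_pair d' (fun h k => pmax (fun t => e * bilform x y h k t))).
  apply: (@le_trans _ _ (avg (fun s => avg (fun w => pmax (bilform x y (mask (compl d') s)
    (mask d' w)))))).
    rewrite le_eqVlt; apply/orP; left; apply/eqP; apply: eq_avg => s.
    case: he => ->.
      by apply: eq_avg => w; apply: eq_pmax => t; rewrite mul1r.
    (* The sign e is absorbed by negating all entries of w. *)
    rewrite (avg_signs_xor [ffun=> true]); apply: eq_avg => w; apply: eq_pmax => t.
    rewrite /bilform mulr_sumr; apply: eq_bigr => i _; rewrite mulrCA; congr (_ * _).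
    rewrite /mxapply mulr_sumr; apply: eq_bigr => j _; rewrite mulrA; congr (_ * _).
    rewrite /mask !ffunE; case: ifP => _; last by rewrite mulr0.
    by rewrite sgn_xor /sgn expr1; ring.
  apply: (@le_trans _ _ (avg (fun s => avg (fun w => pmax (bilform x y (mask (compl d') s)
    (sgn_entries w)))))).
    apply: le_avg => s.
    have E k w : pmax (bilform x y k w) = pmax (bilform y x w k) by apply: eq_pmax => t;
      rewrite bilformC.
    under eq_avg do rewrite E; under [leRHS]eq_avg do rewrite E.
    exact: avg_mask_le.
  rewrite avg_exchange [leRHS]avg_exchange; apply: le_avg => w.
  exact: avg_mask_le.
have := key 1 (or_introl erefl); have := key (-1) (or_intror erefl).
set X := avg (fun s => avg _) => h1 h2.
apply: (@le_trans _ _ (avg (fun s => pmax (fun t => 1 * bilform x y (mask (compl d') s) (mask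
  d' s) t) +
   pmax (fun t => -1 * bilform x y (mask (compl d') s) (mask d' s) t)))); last first.
  by rewrite avgD; move: h1 h2; lra.
apply: le_avg => s; apply: pmax_le => [|t]; first by rewrite addr_ge0// pmax_ge0.
rewrite ler_norml; apply/andP; split.
  rewrite lerNl; apply: (@le_trans _ _ (pmax (fun t => -1 * bilform x y (mask (compl d') s)
    (mask d' s) t))).
    by rewrite -[leLHS]mulN1r; exact: (le_pmax (fun t => -1 * bilform x y (mask (compl d') s)
      (mask d' s) t) t).
  by rewrite lerDr pmax_ge0.
apply: (@le_trans _ _ (pmax (fun t => 1 * bilform x y (mask (compl d') s) (mask d' s) t))).
  by rewrite -[leLHS]mul1r; exact: (le_pmax (fun t => 1 * bilform x y (mask (compl d') s) (mask
    d' s) t) t).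
by rewrite lerDl pmax_ge0.
Qed.

Variables (x : T -> 'I_n -> R) (r : T -> R).
Hypothesis r0 : forall t, 0 < r t.
Hypothesis xr : forall t, \sum_j x t j ^+ 2 = r t ^+ 2.

Definition normalised (t : T) (j : 'I_n) : R := x t j / r t.

(** Dividing by the norm makes the deviation homogeneous of degree 1 in [x t]. *)
Definition norm_dev (s : signs I) (t : T) : R :=
  (\sum_i mxapply (sgn_entries s) (x t) i ^+ 2 - m%:R * r t ^+ 2) / r t.

(** Symmetrisation and decoupling.  If H' is H with the entries in [d] negated, then
    |H x|^2 - |H' x|^2 = 4 <P x, Q x> with P and Q the parts of H outside and inside [d];
    averaging over [d] makes H' independent of H. *)
Lemma avg_norm_dev_le :
  avg (fun s => pmax (fun t => `|norm_dev s t|)) <=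
  8 * avg (fun s => avg (fun w => pmax (bilform x normalised (sgn_entries s) (sgn_entries w)))).
Proof.
pose E s d t := 4 * bilform x normalised (mask (compl d) s) (mask d s) t.
have EE s d t : E s d t = (\sum_i mxapply (sgn_entries s) (x t) i ^+ 2 - \sum_i mxapply
  (sgn_entries (flip d s)) (x t) i ^+ 2) / r t.
  rewrite -sumrB /E /bilform mulr_sumr mulr_suml; apply: eq_bigr => i _.
  have -> : mxapply (mask (compl d) s) (x t) i = 1 / 2 * mxapply (sgn_entries s) (x t) i + 1 /
    2 * mxapply (sgn_entries (flip d s)) (x t) i.
    rewrite -mxapply_lin; congr (mxapply _ _ _); apply/funext => p; rewrite maskE.
    by congr (_ + _ * sgn_entries (flip _ _) _); apply/ffunP => q; rewrite !ffunE negbK.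
  have -> : mxapply (mask d s) (normalised t) i = (1 / 2 * mxapply (sgn_entries s) (x t) i + -
    (1 / 2) * mxapply (sgn_entries (flip d s)) (x t) i) / r t.
    rewrite -mxapply_lin /mxapply mulr_suml; apply: eq_bigr => j _.
    rewrite /normalised mulrA; congr (_ * _ / _); rewrite /mask /sgn_entries /flip !ffunE.
    by case: (d _) => /=; rewrite ?addbF ?addbT /sgn; case: (s _) => /=; rewrite ?expr1 ?expr0;
      field.
  by field; rewrite gt_eqF.
apply: (@le_trans _ _ (avg (fun s => avg (fun d => pmax (fun t => `|E s d t|))))).
  apply: le_avg => s; apply: le_trans (pmax_avg (fun d t => `|E s d t|)); apply: le_pmax2 => t.
  have -> : norm_dev s t = avg (fun d => E s d t); last exact: avg_norm.
  transitivity (avg (fun d => (\sum_i mxapply (sgn_entries s) (x t) i ^+ 2 - \sum_i mxapply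
    (sgn_entries (flip d s)) (x t) i ^+ 2) / r t)).
    rewrite avgZr avgD avg_cst ?signs_gt0// /norm_dev; congr ((_ + _) / _).
    have -> : avg (fun d => - \sum_i mxapply (sgn_entries (flip d s)) (x t) i ^+ 2) =
       - avg (fun d => \sum_i mxapply (sgn_entries (flip d s)) (x t) i ^+ 2).
      by rewrite -mulN1r -avgZ; apply: eq_avg => d; rewrite mulN1r.
    have -> : avg (fun d => \sum_i mxapply (sgn_entries (flip d s)) (x t) i ^+ 2) =
        avg (fun d => \sum_i mxapply (sgn_entries d) (x t) i ^+ 2).
      rewrite [RHS](avg_signs_xor s); apply: eq_avg => d; apply: eq_bigr => i _.
      by congr (mxapply (sgn_entries _) _ _ ^+ 2); apply/ffunP => p; rewrite !ffunE addbC.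
    rewrite avg_sum (eq_bigr (fun=> r t ^+ 2)); first by rewrite sumr_const card_ord [m%:R *
      _]mulr_natl.
    by move=> i _; rewrite avg_sqr_mxapply xr.
  by apply: eq_avg => d; rewrite EE.
rewrite avg_exchange.
rewrite -[leRHS](avg_cst _ (signs_gt0 I)); apply: le_avg => d.
have := avg_bilform_mask_le (compl d) x normalised.
have -> : compl (compl d) = d by apply/ffunP => q; rewrite !ffunE negbK.
move=> h; apply: (@le_trans _ _ (4 * avg (fun s => pmax (fun t => `|bilform x normalised (mask
  (compl d) s) (mask d s) t|)))).
  rewrite -avgZ; apply: le_avg => s; rewrite -pmaxZ//; apply: le_pmax2 => t.
  by rewrite /E normrM ger0_norm.
by move: h; lra.
Qed.

End decoupling.

Section main_bound.
Context {R : realType} {T : finType} {m n : nat}.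
Notation I := ('I_m * 'I_n)%type.
Variables (x : T -> 'I_n -> R) (r : T -> R).
Hypothesis r0 : forall t, 0 < r t.
Hypothesis xr : forall t, \sum_j x t j ^+ 2 = r t ^+ 2.
Variable W : R.
Hypothesis xW : forall p, rad (spread (2 ^ p) x) <= W.

Lemma width_bound_ge0 : 0 <= W.
Proof. exact: le_trans (rad_ge0 _) (xW 0). Qed.

Lemma rad_comparison_pow2 (J J' : finType) (a : T -> J -> R) (b : T -> J' -> R) eta :
  (forall t, \sum_i a t i ^+ 2 <= \sum_j b t j ^+ 2) ->
  (forall s t, \sum_i (a s i - a t i) ^+ 2 <= \sum_j (b s j - b t j) ^+ 2) ->
  0 < eta ->
  exists p0 : nat, forall p, (p0 <= p)%N ->
    rad a <= 2 * (rad (spread (2 ^ p) b) + eta).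
Proof.
move=> ab1 ab2 e0; have [K0 hK] := rad_comparison ab1 ab2 e0.
exists K0 => p pK; apply: (@le_trans _ _ (2 * rad (spread (2 ^ p) a))).
  by apply: rad_le_spread; rewrite expn_gt0.
by rewrite ler_pM2l// hK// (leq_trans pK)// ltnW// ltn_expl.
Qed.

(** The vectors b ⊗ x t and |b| x t have the same pairwise distances. *)
Lemma rad_tensor_le (b : 'I_m -> R) :
  rad (fun t (p : I) => b p.1 * x t p.2) <= 2 * (Num.sqrt (\sum_i b i ^+ 2) * W).
Proof.
set q := Num.sqrt _.
have q0 : 0 <= q by exact: sqrtr_ge0.
have qq : q ^+ 2 = \sum_i b i ^+ 2 by rewrite sqr_sqrtr// sumr_ge0// => i _; exact: sqr_ge0.
have sq (v : 'I_n -> R) :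
    \sum_(p : I) (b p.1 * v p.2) ^+ 2 = \sum_j (q * v j) ^+ 2.
  rewrite sum_pair/=; under [RHS]eq_bigr do rewrite exprMn.
  rewrite -mulr_sumr qq mulr_suml; apply: eq_bigr => i _; rewrite mulr_sumr.
  by apply: eq_bigr => j _; rewrite exprMn.
apply/ler_addgt0Pr => e e0.
have e2 : 0 < e / 2 by rewrite divr_gt0.
have h1 t : \sum_(p : I) (b p.1 * x t p.2) ^+ 2 <= \sum_j (q * x t j) ^+ 2 by rewrite sq.
have h2 s t : \sum_(p : I) (b p.1 * x s p.2 - b p.1 * x t p.2) ^+ 2 <=
    \sum_j (q * x s j - q * x t j) ^+ 2.
  under eq_bigr do rewrite -mulrBr; under [leRHS]eq_bigr do rewrite -mulrBr.
  by rewrite (sq (fun j => x s j - x t j)).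
have [p0 /(_ p0 (leqnn _)) h] := rad_comparison_pow2 h1 h2 e2.
apply: le_trans h _; rewrite rad_spreadZ//.
have := ler_wpM2l q0 (xW p0); lra.
Qed.

(** The averages over the sign matrix H and over h can be exchanged: for fixed h, <h, H x> is
    a sum of signs with coefficients h ⊗ x, and |h| is about sqrt m. *)
Lemma avg_rad_spread_mxapply K : (0 < K)%N ->
  avg (fun s : signs I => rad (spread K (fun t => mxapply (sgn_entries s) (x t)))) <=
  2 * (Num.sqrt m%:R * W).
Proof.
move=> K0.
have -> : avg (fun s : signs I => rad (spread K (fun t => mxapply (sgn_entries s) (x t)))) =
    avg (fun h : signs ('I_K * 'I_m)%type =>
      rad (fun t (p : I) => normalised_sgn_sum h p.1 * x t p.2)).
  rewrite /rad avg_exchange; apply: eq_avg => h; apply: eq_avg => s; apply: eq_pmax => t.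
  rewrite sgn_sum_spread /sgn_sum sum_pair; apply: eq_bigr => i _; rewrite /mxapply mulr_sumr.
  by apply: eq_bigr => j _; rewrite /sgn_entries/=; ring.
apply: (@le_trans _ _ (2 * (avg (fun h : signs ('I_K * 'I_m)%type => Num.sqrt (\sum_i
  normalised_sgn_sum h i ^+ 2) : R) * W))).
  rewrite -avgZr -avgZ; apply: le_avg => h; exact: rad_tensor_le.
rewrite ler_wpM2l// ler_wpM2r ?width_bound_ge0//.
have s0 (h : signs ('I_K * 'I_m)%type) : 0 <= \sum_i normalised_sgn_sum h i ^+ 2 :> R.
  by apply: sumr_ge0 => i _; exact: sqr_ge0.
rewrite -(ler_pXn2r (n := 2))// ?nnegrE ?sqrtr_ge0//; last by apply: avg_ge0 => h; exact:
  sqrtr_ge0.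
rewrite sqr_sqrtr//; apply: le_trans (avg_sqr _ (signs_gt0 _)) _.
under eq_avg do rewrite sqr_sqrtr//.
rewrite avg_sum (eq_bigr (fun=> 1)); first by rewrite sumr_const card_ord.
move=> i _.
pose a (p : 'I_K * 'I_m) : R := if p.2 == i then (Num.sqrt K%:R)^-1 else 0.
have E (h : signs ('I_K * 'I_m)%type) : normalised_sgn_sum h i = sgn_sum h a.
  rewrite /normalised_sgn_sum /sgn_sum mulr_sumr sum_pair/=.
  apply: eq_bigr => k _; rewrite (bigD1 i)//= /a eqxx big1 ?addr0 1?mulrC//.
  by move=> j /negbTE /= ->; rewrite mulr0.
under eq_avg do rewrite E expr2.
rewrite avg_sgn_sum2 sum_pair (eq_bigr (fun=> K%:R^-1)).
  by rewrite sumr_const card_ord -[_ *+ K]mulr_natr mulVf// pnatr_eq0 -lt0n.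
move=> k _; rewrite (bigD1 i)//= /a eqxx big1 ?addr0 -?expr2.
  by rewrite exprVn sqr_sqrtr.
by move=> j /negbTE /= ->; rewrite mulr0.
Qed.

Lemma normalised_sqr t : \sum_j normalised x r t j ^+ 2 = 1.
Proof.
rewrite /normalised; under eq_bigr do rewrite exprMn exprVn.
by rewrite -mulr_suml xr divff// expf_neq0// gt_eqF.
Qed.

(** The radial projection has Lipschitz constant 2 / |x|. *)
Lemma normalised_dist s t :
  r t ^+ 2 * \sum_j (normalised x r s j - normalised x r t j) ^+ 2 <=
  4 * \sum_j (x s j - x t j) ^+ 2.
Proof.
pose c := \sum_j normalised x r s j * normalised x r t j.
have xE u j : x u j = r u * normalised x r u j.
  by rewrite /normalised mulrC divfK// gt_eqF.
have D (a b : R) : \sum_j (a * normalised x r s j - b * normalised x r t j) ^+ 2 = a ^+ 2 + b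
  ^+ 2 - 2 * a * b * c.
  rewrite (eq_bigr (fun j => a ^+ 2 * normalised x r s j ^+ 2 + b ^+ 2 * normalised x r t j ^+ 2 -
    2 * a * b * (normalised x r s j * normalised x r t j))); last by move=> j _; ring.
  by rewrite !big_split/= sumrN -!mulr_sumr !normalised_sqr /c; ring.
have c1 : 0 <= 1 - c.
  have : 0 <= \sum_j (1 * normalised x r s j - 1 * normalised x r t j) ^+ 2.
    by apply: sumr_ge0 => j _; exact: sqr_ge0.
  by rewrite D; lra.
have c2 : 0 <= 1 + c.
  have : 0 <= \sum_j (1 * normalised x r s j - (-1) * normalised x r t j) ^+ 2.
    by apply: sumr_ge0 => j _; exact: sqr_ge0.
  by rewrite D; lra.
have -> : \sum_j (normalised x r s j - normalised x r t j) ^+ 2 = 2 - 2 * c.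
  transitivity (\sum_j (1 * normalised x r s j - 1 * normalised x r t j) ^+ 2).
    by apply: eq_bigr => j _; rewrite !mul1r.
  by rewrite D; ring.
under [X in _ <= 4 * X]eq_bigr do rewrite !xE.
rewrite D -subr_ge0; clearbody c.
have rs := r0 s; have rt := r0 t.
have [cn|cp] := leP c 0.
  have -> : 4 * (r s ^+ 2 + r t ^+ 2 - 2 * r s * r t * c) - r t ^+ 2 * (2 - 2 * c) =
    4 * r s ^+ 2 + 8 * (r s * r t) * (- c) + 2 * r t ^+ 2 * (1 + c) by ring.
  by rewrite !addr_ge0// !mulr_ge0// ?sqr_ge0// ?oppr_ge0// ?mulr_ge0// ?(ltW rs) ?(ltW rt).
have -> : 4 * (r s ^+ 2 + r t ^+ 2 - 2 * r s * r t * c) - r t ^+ 2 * (2 - 2 * c) =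
    4 * (r s - r t * c) ^+ 2 + 2 * r t ^+ 2 * ((1 - c) * (1 + 2 * c)) by ring.
apply: addr_ge0; first by apply: mulr_ge0 => //; exact: sqr_ge0.
apply: mulr_ge0; first by apply: mulr_ge0 => //; exact: sqr_ge0.
by apply: mulr_ge0 => //; move: cp; lra.
Qed.

Definition max_dilation (s : signs I) : R :=
  pmax (fun t => Num.sqrt (\sum_i mxapply (sgn_entries s) (normalised x r t) i ^+ 2)).

(** A family indexed by the two separate randomness sources of the comparison process; its
    increments dominate those of H x ⊗ x', see [bilform_chevet]. *)
Definition chevet_family (s : signs I) : T -> 'I_m + 'I_n -> R :=
  joinf (fun t i => Num.sqrt 2 * mxapply (sgn_entries s) (x t) i)
        (fun t j => Num.sqrt 8 * max_dilation s * x t j).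

Lemma chevet_family_sqr (c : R) (u : 'I_m -> R) (v : 'I_n -> R) :
  \sum_z (match z with inl i => Num.sqrt 2 * u i | inr j => Num.sqrt 8 * c * v j end) ^+ 2 =
  2 * \sum_i u i ^+ 2 + 8 * c ^+ 2 * \sum_j v j ^+ 2 :> R.
Proof.
rewrite big_sumType/=; congr (_ + _); rewrite mulr_sumr; apply: eq_bigr => i _.
  by rewrite exprMn sqr_sqrtr.
by rewrite !exprMn sqr_sqrtr.
Qed.

Lemma sum_tensor_sqr (u : 'I_m -> R) (v : 'I_n -> R) :
  \sum_(p : I) (u p.1 * v p.2) ^+ 2 = (\sum_i u i ^+ 2) * \sum_j v j ^+ 2.
Proof.
rewrite sum_pair/= mulr_suml; apply: eq_bigr => i _; rewrite mulr_sumr.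
by apply: eq_bigr => j _; rewrite exprMn.
Qed.

Lemma mxapply_max_dilation (s : signs I) t :
  \sum_i mxapply (sgn_entries s) (x t) i ^+ 2 <= r t ^+ 2 * max_dilation s ^+ 2.
Proof.
have -> : \sum_i mxapply (sgn_entries s) (x t) i ^+ 2 = r t ^+ 2 * \sum_i mxapply (sgn_entries
  s) (normalised x r t) i ^+ 2.
  rewrite mulr_sumr; apply: eq_bigr => i _; rewrite -exprMn; congr (_ ^+ 2).
  rewrite /mxapply mulr_sumr; apply: eq_bigr => j _; rewrite /normalised.
  by field; rewrite gt_eqF.
rewrite ler_wpM2l ?sqr_ge0//.
have h0 : 0 <= \sum_i mxapply (sgn_entries s) (normalised x r t) i ^+ 2 by apply: sumr_ge0 => i
  _; exact: sqr_ge0.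
rewrite -[leLHS](sqr_sqrtr h0) lerXn2r ?nnegrE ?sqrtr_ge0 ?pmax_ge0//.
exact: (le_pmax (fun t => Num.sqrt (\sum_i mxapply (sgn_entries s) (normalised x r t) i ^+ 2))).
Qed.

(** Comparison for a fixed sign matrix: with x' and y' the normalised vectors,
    H x ⊗ x' - H y ⊗ y' = (H x - H y) ⊗ x' + H y ⊗ (x' - y'), and
    |H y| |x' - y'| <= 2 R |x - y| by [normalised_dist]. *)
Lemma bilform_chevet (s : signs I) eta : 0 < eta ->
  exists p0 : nat, forall p, (p0 <= p)%N ->
  avg (fun w : signs I => pmax (bilform x (normalised x r) (sgn_entries s) (sgn_entries w))) <=
  2 * (Num.sqrt 2 * rad (spread (2 ^ p) (fun t => mxapply (sgn_entries s) (x t)))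
       + Num.sqrt 8 * max_dilation s * W + eta).
Proof.
move=> eta0.
pose a t (q : I) := mxapply (sgn_entries s) (x t) q.1 * normalised x r t q.2.
have h1 t : \sum_q a t q ^+ 2 <= \sum_z chevet_family s t z ^+ 2.
  rewrite (sum_tensor_sqr (mxapply (sgn_entries s) (x t)) (normalised x r t)) normalised_sqr
    mulr1.
  rewrite (eq_bigr (fun z => (match z with inl i => Num.sqrt 2 * mxapply (sgn_entries s) (x t) i
    | inr j => Num.sqrt 8 * max_dilation s * x t j end) ^+ 2)); last by case.
  rewrite chevet_family_sqr//.
  have : 0 <= \sum_i mxapply (sgn_entries s) (x t) i ^+ 2 by apply: sumr_ge0 => i _; exact:
    sqr_ge0.
  have : 0 <= 8 * max_dilation s ^+ 2 * \sum_j x t j ^+ 2.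
    apply: mulr_ge0; first by apply: mulr_ge0 => //; exact: sqr_ge0.
    by apply: sumr_ge0 => i _; exact: sqr_ge0.
  lra.
have h2 t u : \sum_q (a t q - a u q) ^+ 2 <=
    \sum_z (chevet_family s t z - chevet_family s u z) ^+ 2.
  rewrite [leRHS](eq_bigr (fun z => (match z with
      inl i => Num.sqrt 2 * (mxapply (sgn_entries s) (x t) i - mxapply (sgn_entries s) (x u) i)
    | inr j => Num.sqrt 8 * max_dilation s * (x t j - x u j) end) ^+ 2)); last first.
    by case=> [i|j] _; rewrite /chevet_family/= -mulrBr.
  rewrite (chevet_family_sqr (max_dilation s) (fun i => mxapply (sgn_entries s) (x t) i -
    mxapply (sgn_entries s) (x u) i) (fun j => x t j - x u j)).
  pose A (q : I) := (mxapply (sgn_entries s) (x t) q.1 - mxapply (sgn_entries s) (x u) q.1) *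
    normalised x r t q.2.
  pose B (q : I) := mxapply (sgn_entries s) (x u) q.1 * (normalised x r t q.2 - normalised x r
    u q.2).
  apply: (@le_trans _ _ (2 * \sum_q A q ^+ 2 + 2 * \sum_q B q ^+ 2)).
    rewrite !mulr_sumr -big_split/=; apply: ler_sum => q _.
    have -> : a t q - a u q = A q + B q by rewrite /a /A /B; ring.
    by have := sqr_ge0 (A q - B q); lra.
  rewrite (sum_tensor_sqr (fun i => mxapply (sgn_entries s) (x t) i - mxapply (sgn_entries s)
    (x u) i) (normalised x r t)).
  rewrite (sum_tensor_sqr (mxapply (sgn_entries s) (x u)) (fun j => normalised x r t j -
    normalised x r u j)).
  rewrite normalised_sqr mulr1 lerD2l.
  set Y := \sum_j (normalised x r t j - normalised x r u j) ^+ 2.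
  have Y0 : 0 <= Y by apply: sumr_ge0 => j _; exact: sqr_ge0.
  have k1 := ler_wpM2r Y0 (mxapply_max_dilation s u).
  have k2 := ler_wpM2l (sqr_ge0 (max_dilation s)) (normalised_dist t u).
  by rewrite -/Y in k2; move: k1 k2; lra.
have [p0 hp] := rad_comparison_pow2 h1 h2 eta0.
have -> : avg (fun w : signs I => pmax (bilform x (normalised x r) (sgn_entries s) (sgn_entries
  w))) = rad a.
  apply: eq_avg => w; apply: eq_pmax => t; rewrite /sgn_sum sum_pair.
  apply: eq_bigr => i _; rewrite [mxapply (sgn_entries w) _ _]/mxapply mulr_sumr.
  by apply: eq_bigr => j _; rewrite /a /sgn_entries/=; ring.
exists p0 => p pp; apply: le_trans (hp p pp) _.
rewrite ler_pM2l// lerD2r; apply: le_trans (rad_spread_joinf _ _ _) _.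
rewrite !rad_spreadZ ?mulr_ge0 ?sqrtr_ge0 ?pmax_ge0// lerD2l.
by rewrite ler_wpM2l ?xW// mulr_ge0 ?sqrtr_ge0 ?pmax_ge0.
Qed.

(** Finitely many sign matrices occur, hence one [p] serves for all of them. *)
Lemma avg_bilform_le :
  avg (fun s : signs I => avg (fun w : signs I => pmax (bilform x (normalised x r) (sgn_entries
    s) (sgn_entries w)))) <=
  6 * W * (Num.sqrt m%:R + avg max_dilation).
Proof.
apply/ler_addgt0Pr => e e0.
have e2 : 0 < e / 2 by rewrite divr_gt0.
have /choice[p0 hp0] := fun s => @bilform_chevet s (e / 2) e2.
pose p := (\max_s p0 s)%N.
have hp s := hp0 s p (leq_bigmax s).
have W0 := width_bound_ge0.
have rad0 : 0 <= avg max_dilation by apply: avg_ge0 => s; exact: pmax_ge0.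
have sm0 : 0 <= Num.sqrt m%:R :> R by exact: sqrtr_ge0.
have s2 : Num.sqrt 2 <= 3 / 2 :> R.
  rewrite -(ler_pXn2r (n := 2))// ?nnegrE ?sqrtr_ge0// sqr_sqrtr//; lra.
have s8 : Num.sqrt 8 <= 3 :> R.
  rewrite -(ler_pXn2r (n := 2))// ?nnegrE ?sqrtr_ge0// sqr_sqrtr//; lra.
apply: (@le_trans _ _ (2 * (Num.sqrt 2 * avg (fun s => rad (spread (2 ^ p) (fun t => mxapply
  (sgn_entries s) (x t)))) + Num.sqrt 8 * avg max_dilation * W + e / 2))).
  apply: (@le_trans _ _ (avg (fun s : signs I => 2 * (Num.sqrt 2 * rad (spread (2 ^ p) (fun t
    => mxapply (sgn_entries s) (x t)))
      + Num.sqrt 8 * max_dilation s * W + e / 2)))); first by apply: le_avg => s; exact: hp.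
  have lin (f g : signs I -> R) (a b c : R) :
      avg (fun s => 2 * (a * f s + b * g s * W + c)) = 2 * (a * avg f + b * avg g * W + c).
    by rewrite avgZ !avgD avgZ avgZr avgZ avg_cst// signs_gt0.
  by rewrite lin.
have h := avg_rad_spread_mxapply (K := 2 ^ p).
have {}h := h ltac:(by rewrite expn_gt0).
have h1 : Num.sqrt 2 * avg (fun s : signs I => rad (spread (2 ^ p) (fun t => mxapply
  (sgn_entries s) (x t)))) <= 3 / 2 * (2 * (Num.sqrt m%:R * W)).
  by apply: ler_pM => //; apply: avg_ge0 => s; exact: rad_ge0.
have h2 : Num.sqrt 8 * avg max_dilation * W <= 3 * avg max_dilation * W.
  by rewrite ler_wpM2r// ler_wpM2r.
by move: h1 h2; lra.
Qed.

Variable theta : R.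
Hypothesis theta0 : 0 < theta.
Hypothesis rtheta : forall t, theta <= r t.

Definition max_norm_dev (s : signs I) : R := pmax (fun t => `|norm_dev x r s t|).

(** Since |x| >= theta, a small deviation also controls the dilation of the unit vectors; this
    closes the estimate of the deviation on itself. *)
Lemma max_dilation_sqr_le s : max_dilation s ^+ 2 <= m%:R + max_norm_dev s / theta.
Proof.
have M0 : 0 <= max_norm_dev s by exact: pmax_ge0.
have b0 : 0 <= m%:R + max_norm_dev s / theta by rewrite addr_ge0// divr_ge0// ltW.
rewrite -[leRHS](sqr_sqrtr b0) lerXn2r ?nnegrE ?sqrtr_ge0 ?pmax_ge0//.
apply: pmax_le; first exact: sqrtr_ge0.
move=> t; rewrite ler_sqrt//.
have -> : \sum_i mxapply (sgn_entries s) (normalised x r t) i ^+ 2 = m%:R + norm_dev x r s t /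
  r t.
  rewrite /norm_dev; have -> : \sum_i mxapply (sgn_entries s) (x t) i ^+ 2 = r t ^+ 2 * \sum_i
    mxapply (sgn_entries s) (normalised x r t) i ^+ 2.
    rewrite mulr_sumr; apply: eq_bigr => i _; rewrite -exprMn; congr (_ ^+ 2).
    rewrite /mxapply mulr_sumr; apply: eq_bigr => j _; rewrite /normalised.
    by field; rewrite gt_eqF.
  by field; rewrite gt_eqF.
rewrite lerD2l; apply: (@le_trans _ _ (`|norm_dev x r s t| / r t)).
  by rewrite ler_pM2r ?invr_gt0// ler_norm.
apply: ler_pM => //; first by rewrite invr_ge0 ltW.
  exact: (le_pmax (fun t => `|norm_dev x r s t|)).
by rewrite lef_pV2 ?posrE.
Qed.

(** With q^2 the averaged deviation, [avg_bilform_le] and [max_dilation_sqr_le] give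
    q^2 <= 96 W sqrt m + B q with B = 48 W / sqrt theta, hence q^2 <= 192 W sqrt m + B^2. *)
Lemma avg_max_norm_dev_le :
  avg max_norm_dev <= 192 * W * Num.sqrt m%:R + 2304 * W ^+ 2 / theta.
Proof.
set D := avg max_norm_dev.
have D0 : 0 <= D by apply: avg_ge0 => s; exact: pmax_ge0.
have W0 := width_bound_ge0.
have sm0 : 0 <= Num.sqrt m%:R :> R by exact: sqrtr_ge0.
have st0 : 0 < Num.sqrt theta by rewrite sqrtr_gt0.
pose q := Num.sqrt D; have q0 : 0 <= q by exact: sqrtr_ge0.
have qq : q ^+ 2 = D by rewrite sqr_sqrtr.
have hr : avg max_dilation <= Num.sqrt m%:R + q / Num.sqrt theta.
  have rad0 : 0 <= avg max_dilation by apply: avg_ge0 => s; exact: pmax_ge0.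
  have b0 : 0 <= Num.sqrt m%:R + q / Num.sqrt theta by rewrite addr_ge0// divr_ge0// ltW.
  rewrite -(ler_pXn2r (n := 2))// ?nnegrE//.
  apply: le_trans (avg_sqr _ (signs_gt0 _)) _.
  apply: (@le_trans _ _ (m%:R + D / theta)).
    have lin (f : signs I -> R) (a b : R) : avg (fun s => a + f s / b) = a + avg f / b.
      by rewrite avgD avgZr avg_cst// signs_gt0.
    by rewrite -lin; apply: le_avg => s; exact: max_dilation_sqr_le.
  have -> : D / theta = (q / Num.sqrt theta) ^+ 2.
    by rewrite exprMn exprVn qq sqr_sqrtr// ltW.
  rewrite sqrrD sqr_sqrtr// -addrA lerD2l lerDr.
  by rewrite mulrn_wge0// mulr_ge0// divr_ge0// ltW.
have h1 : D <= 48 * W * (Num.sqrt m%:R + avg max_dilation).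
  have := avg_norm_dev_le r0 xr (m := m); have := avg_bilform_le.
  by rewrite -/D; move=> h1 h2; apply: le_trans h2 _; move: h1; lra.
have h2 : 48 * W * (Num.sqrt m%:R + avg max_dilation) <=
    48 * W * (2 * Num.sqrt m%:R) + 48 * W / Num.sqrt theta * q.
  have -> : 48 * W * (2 * Num.sqrt m%:R) + 48 * W / Num.sqrt theta * q =
     48 * W * (Num.sqrt m%:R + (Num.sqrt m%:R + q / Num.sqrt theta)) by ring.
  by rewrite ler_wpM2l ?mulr_ge0// lerD2l.
set B := 48 * W / Num.sqrt theta in h2.
have B2 : B ^+ 2 = 2304 * W ^+ 2 / theta.
  by rewrite /B !exprMn exprVn sqr_sqrtr ?ltW//; ring.
rewrite -B2.
have := sqr_ge0 (q - B).
move: h1 h2 qq; nra.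
Qed.

End main_bound.

(** * Euclidean geometry and the dual functional *)

Section euclid.
Context {R : realType} {n : nat}.
Implicit Types u v w : 'rV[R]_n.

Lemma dotrC u v : dotr u v = dotr v u.
Proof. by apply: eq_bigr => i _; rewrite mulrC. Qed.

Lemma dotrDl u v w : dotr (u + v) w = dotr u w + dotr v w.
Proof. by rewrite /dotr -big_split/=; apply: eq_bigr => i _; rewrite mxE mulrDl. Qed.

Lemma dotrZl a u v : dotr (a *: u) v = a * dotr u v.
Proof. by rewrite /dotr mulr_sumr; apply: eq_bigr => i _; rewrite mxE mulrA. Qed.

Lemma dotrNl u v : dotr (- u) v = - dotr u v.
Proof. by rewrite -scaleN1r dotrZl mulN1r. Qed.

Lemma dotrBl u v w : dotr (u - v) w = dotr u w - dotr v w.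
Proof. by rewrite dotrDl dotrNl. Qed.

Lemma dotrDr u v w : dotr u (v + w) = dotr u v + dotr u w.
Proof. by rewrite dotrC dotrDl !(dotrC u). Qed.

Lemma dotrZr a u v : dotr u (a *: v) = a * dotr u v.
Proof. by rewrite dotrC dotrZl dotrC. Qed.

Lemma dotrNr u v : dotr u (- v) = - dotr u v.
Proof. by rewrite dotrC dotrNl dotrC. Qed.

Lemma dotrBr u v w : dotr u (v - w) = dotr u v - dotr u w.
Proof. by rewrite dotrDr dotrNr. Qed.

Lemma dotr0l v : dotr 0 v = 0.
Proof. by rewrite -(scale0r v) dotrZl mul0r. Qed.

Lemma dotr0r v : dotr v 0 = 0.
Proof. by rewrite dotrC dotr0l. Qed.

Lemma dotr_ge0 u : 0 <= dotr u u.
Proof. by apply: sumr_ge0 => i _; rewrite -expr2 sqr_ge0. Qed.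

Lemma l2norm_ge0 u : 0 <= l2norm u.
Proof. exact: sqrtr_ge0. Qed.

Lemma l2norm_sqr u : l2norm u ^+ 2 = dotr u u.
Proof.
rewrite /l2norm sqr_sqrtr; first by apply: eq_bigr => i _; rewrite expr2.
by apply: sumr_ge0 => i _; exact: sqr_ge0.
Qed.

Lemma l2norm_le u c : 0 <= c -> (l2norm u <= c) = (dotr u u <= c ^+ 2).
Proof. by move=> c0; rewrite -l2norm_sqr ler_pXn2r// nnegrE// l2norm_ge0. Qed.

Lemma cauchy_schwarz u v : dotr u v <= l2norm u * l2norm v.
Proof.
have a0 := l2norm_ge0 u; have b0 := l2norm_ge0 v.
set a := l2norm u in a0 *; set b := l2norm v in b0 *.
have h : 0 <= dotr (b *: u - a *: v) (b *: u - a *: v) by exact: dotr_ge0.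
move: h; rewrite dotrBl !dotrBr !dotrZl !dotrZr -!l2norm_sqr -/a -/b (dotrC v u) => h.
have [ab|ab] := eqVneq (a * b) 0.
  rewrite ab; move/eqP: ab; rewrite mulf_eq0 => /orP[|] /eqP z.
    have /eqP : dotr u u = 0 by rewrite -l2norm_sqr -/a z expr0n.
    rewrite psumr_eq0; last by move=> i _; rewrite -expr2 sqr_ge0.
    move=> /allP uz; rewrite /dotr big1// => i _.
    have := uz i (mem_index_enum i); rewrite mulf_eq0 => /orP[|] /eqP ->; by rewrite mul0r.
  have /eqP : dotr v v = 0 by rewrite -l2norm_sqr -/b z expr0n.
  rewrite psumr_eq0; last by move=> i _; rewrite -expr2 sqr_ge0.
  move=> /allP uz; rewrite /dotr big1// => i _.
  have := uz i (mem_index_enum i); rewrite mulf_eq0 => /orP[|] /eqP ->; by rewrite mulr0.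
have p : 0 < a * b by rewrite lt_def ab mulr_ge0.
have h2 : 0 <= (a * b) * (a * b - dotr u v) by move: h; lra.
by move: h2; rewrite pmulr_rge0// subr_ge0.
Qed.

Lemma cauchy_schwarz_norm u v : `|dotr u v| <= l2norm u * l2norm v.
Proof.
rewrite ler_norml cauchy_schwarz andbT lerNl -dotrNl.
apply: le_trans (cauchy_schwarz _ _) _; rewrite le_eqVlt; apply/orP; left; apply/eqP.
by congr (_ * _); rewrite /l2norm; congr Num.sqrt; apply: eq_bigr => i _; rewrite mxE sqrrN.
Qed.

Lemma l2norm_triangle u v : l2norm (u + v) <= l2norm u + l2norm v.
Proof.
rewrite l2norm_le ?addr_ge0 ?l2norm_ge0//.
rewrite dotrDl !dotrDr (dotrC v u) -!l2norm_sqr.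
have := cauchy_schwarz u v; lra.
Qed.

Lemma l2normN u : l2norm (- u) = l2norm u.
Proof. by rewrite /l2norm; congr Num.sqrt; apply: eq_bigr => i _; rewrite mxE sqrrN. Qed.

Lemma l2normB u v : l2norm (u - v) = l2norm (v - u).
Proof. by rewrite -l2normN opprB. Qed.

Lemma l2normZ a u : l2norm (a *: u) = `|a| * l2norm u.
Proof.
rewrite /l2norm -sqrtr_sqr -sqrtrM ?sqr_ge0// mulr_sumr; congr Num.sqrt.
by apply: eq_bigr => i _; rewrite mxE exprMn.
Qed.

Lemma l2norm0 : l2norm (0 : 'rV[R]_n) = 0.
Proof. by rewrite -(scale0r (0 : 'rV[R]_n)) l2normZ normr0 mul0r. Qed.

Lemma l2norm_eq0 u : l2norm u = 0 -> u = 0.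
Proof.
move=> u0; have /eqP : dotr u u = 0 by rewrite -l2norm_sqr u0 expr0n.
rewrite psumr_eq0; last by move=> i _; rewrite -expr2 sqr_ge0.
move=> /allP uz; apply/rowP => i; rewrite mxE.
by have := uz i (mem_index_enum i); rewrite mulf_eq0 => /orP[|] /eqP.
Qed.

Lemma l2norm_gt0 u : u != 0 -> 0 < l2norm u.
Proof.
move=> u0; rewrite lt_def l2norm_ge0 andbT; apply: contraNneq u0 => /l2norm_eq0 ->//.
Qed.

(** The weight [l] bounds the gauge of the convex hull of [S] at [z]; [cone S 1] is that hull. *)
Inductive cone (S : set 'rV[R]_n) : R -> 'rV[R]_n -> Prop :=
| cone_nil : cone S 0 0
| cone_cons l z s t : cone S l z -> S s -> 0 <= t -> cone S (l + t) (z + t *: s).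

Lemma cone_ge0 S l z : cone S l z -> 0 <= l.
Proof. by elim=> // {}l {}z s t _ l0 _ t0; rewrite addr_ge0. Qed.

Lemma cone_scale S a l z : 0 <= a -> cone S l z -> cone S (a * l) (a *: z).
Proof.
move=> a0; elim=> [|{}l {}z s t _ IH Ss t0].
  by rewrite mulr0 scaler0; exact: cone_nil.
by rewrite mulrDr scalerDr scalerA; apply: cone_cons => //; rewrite mulr_ge0.
Qed.

Lemma cone_norm S l z : (forall s, S s -> l2norm s = 1) -> cone S l z -> l2norm z <= l.
Proof.
move=> S1; elim=> [|{}l {}z s t _ IH Ss t0]; first by rewrite l2norm0.
apply: le_trans (l2norm_triangle _ _) _.
by rewrite lerD// l2normZ S1// mulr1 ger0_norm.
Qed.

Lemma cone_single S s : S s -> cone S 1 s.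
Proof.
by move=> Ss; have := cone_cons (cone_nil S) Ss ler01; rewrite !add0r scale1r.
Qed.

Lemma cone_dot S v l z c : (forall s, S s -> dotr v s <= c) -> cone S l z ->
  dotr v z <= l * c.
Proof.
move=> Sc; elim=> [|{}l {}z s t _ IH Ss t0]; first by rewrite dotr0r mul0r.
by rewrite dotrDr dotrZr mulrDl lerD// ler_wpM2l// Sc.
Qed.

End euclid.

Section functional.
Context {R : realType} {n m : nat}.
Variables (S : set 'rV[R]_n) (A : 'M[R]_(n, m)) (e : R).
Hypothesis e0 : 0 < e < 1.
Hypothesis S1 : forall s, S s -> l2norm s = 1.
Hypothesis SN : forall s, S s -> S (- s).
Hypothesis SA : forall s, S s -> l2norm (s *m A) ^+ 2 <= 2.
Hypothesis coneA : forall c, cone S 1 c -> l2norm c <= l2norm (c *m A) + e.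

Lemma coneA_scaled l z : cone S l z -> l2norm z <= l2norm (z *m A) + e * l.
Proof.
move=> cz; have := cone_ge0 cz; rewrite le_eqVlt => /predU1P[l0|l0].
  by have := cone_norm S1 cz; rewrite -l0 mulr0 addr0 => /le_trans; apply; exact: l2norm_ge0.
have : cone S 1 (l^-1 *: z).
  rewrite -(mulVf (lt0r_neq0 l0)); apply: cone_scale => //.
  by rewrite invr_ge0 ltW.
move=> /coneA; rewrite -scalemxAl !l2normZ gtr0_norm ?invr_gt0//.
rewrite -(ler_pM2l l0) mulrDr !mulrA divff ?gt_eqF// !mul1r.
by rewrite (mulrC e).
Qed.

(** Near a minimum over the cone of J = |z A|^2 / 2 - <v, z> + e l, moving by t in a direction
    s in S gives <v, s> - <z A, s A> <= e + O(t), and moving radially gives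
    |z A|^2 <= <v, z> - e l + O(t) <= |z A| + O(t), the last step by [coneA_scaled]. *)
Lemma unit_dual_functional v : l2norm v = 1 ->
  exists u : 'rV[R]_m, l2norm u ^+ 2 <= 1 + 4 * e /\
    forall s, S s -> dotr v s - dotr u (s *m A) <= 2 * e.
Proof.
move=> v1; case/andP: (e0) => ep e1.
pose J l (z : 'rV[R]_n) := l2norm (z *m A) ^+ 2 / 2 - dotr v z + e * l.
pose E := [set j | exists l z, cone S l z /\ j = J l z].
have vz z : dotr v z <= l2norm z by have := cauchy_schwarz v z; rewrite v1 mul1r.
have J2 l z : cone S l z -> - (1 / 2) <= J l z.
  move=> cz; have := coneA_scaled cz; have := vz z.
  by have := sqr_ge0 (l2norm (z *m A) - 1); rewrite /J; lra.
have EI : has_inf E.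
  split; first by exists (J 0 0), 0, 0; split => //; exact: cone_nil.
  by exists (- (1 / 2)) => _ [l [z [cz ->]]]; exact: J2.
(* With step t and accuracy t^2 both variations lose only O(t). *)
pose t := e / 2.
have t0 : 0 < t by rewrite divr_gt0.
have te : e = 2 * t by rewrite /t; field.
have t2 : 0 < t ^+ 2 by rewrite exprn_gt0.
have [_ [l [z [cz ->]]] Jz] := inf_adherent t2 EI.
have min l' z' : cone S l' z' -> J l z - t ^+ 2 <= J l' z'.
  move=> cz'; rewrite lerBlDr; apply: le_trans (ltW Jz) _; rewrite lerD2r.
  by apply: ge_inf; [exact: EI.2|exists l', z'].
exists (z *m A).
set a := l2norm (z *m A) in J2 min Jz *.
have a0 : 0 <= a by exact: l2norm_ge0.
clearbody t.
split.
  have tl : 0 <= 1 - t by lra.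
  have := min _ _ (cone_scale tl cz).
  rewrite /J -scalemxAl l2normZ (ger0_norm tl) dotrZr -/a => h.
  have := coneA_scaled cz; rewrite -/a => h1; have h2 := vz z.
  have h3 : t * (a ^+ 2 - dotr v z + e * l) <= t * (t / 2 * a ^+ 2 + t) by move: h; lra.
  rewrite ler_pM2l// in h3.
  have h4 := sqr_ge0 (a - 1).
  have h5 : a ^+ 2 * (1 - t) <= 1 + 2 * t by move: h1 h2 h3 h4; lra.
  have h6 : 1 + 2 * t <= (1 + 8 * t) * (1 - t) by nra.
  have tp : 0 < 1 - t by lra.
  have : a ^+ 2 * (1 - t) <= (1 + 8 * t) * (1 - t) by exact: le_trans h6.
  by rewrite ler_pM2r// te; lra.
move=> s Ss; have := min _ _ (cone_cons cz Ss (ltW t0)).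
rewrite /J mulmxDl -scalemxAl !l2norm_sqr dotrDl !dotrDr !dotrZl !dotrZr.
rewrite (dotrC (s *m A)) -!l2norm_sqr -/a.
have := SA Ss; set b := l2norm (s *m A) => b2 h.
have h3 : t * (dotr v s - dotr (z *m A) (s *m A)) <= t * (2 * e).
  have : t ^+ 2 * b ^+ 2 <= t ^+ 2 * 2 by rewrite ler_pM2l.
  by move: h; rewrite te; lra.
by rewrite ler_pM2l// in h3.
Qed.

Lemma dual_functional v :
  exists u : 'rV[R]_m, l2norm u ^+ 2 <= (1 + 4 * e) * l2norm v ^+ 2 /\
    forall s, S s -> `|dotr v s - dotr u (s *m A)| <= 2 * e * l2norm v.
Proof.
have [->|v0] := eqVneq v 0.
  exists 0; rewrite !l2norm0 expr0n mulr0; split => // s _.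
  by rewrite !dotr0l subrr normr0 mulr0.
have vp := l2norm_gt0 v0.
have v1 : l2norm ((l2norm v)^-1 *: v) = 1.
  by rewrite l2normZ gtr0_norm ?invr_gt0// mulVf// gt_eqF.
have [u [u1 us]] := unit_dual_functional v1.
exists (l2norm v *: u); split.
  by rewrite l2normZ gtr0_norm// exprMn mulrC ler_wpM2r// sqr_ge0.
have key s : S s -> dotr v s - dotr (l2norm v *: u) (s *m A) <= 2 * e * l2norm v.
  move=> Ss; have := us s Ss; rewrite !dotrZl -(ler_pM2r vp) => h.
  by apply: le_trans h; rewrite le_eqVlt; apply/orP; left; apply/eqP; field; rewrite gt_eqF.
move=> s Ss; rewrite ler_norml key// andbT.
have := key _ (SN Ss); rewrite mulNmx !dotrNr; lra.
Qed.

End functional.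

(** * Embedding the convex hull *)

Section net.
Context {R : realType} {n : nat}.

Lemma coord_le_l2norm (u : 'rV[R]_n) i : `|u 0 i| <= l2norm u.
Proof.
rewrite -sqrtr_sqr ler_sqrt; last by apply: sumr_ge0 => j _; exact: sqr_ge0.
by rewrite (bigD1 i)//= lerDl sumr_ge0// => j _; exact: sqr_ge0.
Qed.

(** The net lies inside [A]: one point is chosen in each occupied cell of a grid. *)
Lemma finite_net (A : set 'rV[R]_n) (eta : R) :
  (forall c, A c -> l2norm c <= 1) -> 0 < eta ->
  exists (T : finType) (x : T -> 'rV[R]_n), (forall t, A (x t)) /\
    forall c, A c -> exists t, l2norm (c - x t) <= eta.
Proof.
move=> A1 eta0.
pose q := (Num.truncn (n.+1%:R / eta)).+1.
have qn : n.+1%:R / eta < q%:R by exact: truncnS_gt.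
pose bucket (c : 'rV[R]_n) : {ffun 'I_n -> 'I_(2 * q).+1} :=
  [ffun i => inord (Num.truncn ((c 0 i + 1) * q%:R))].
pose T := {b : {ffun 'I_n -> 'I_(2 * q).+1} | `[< exists c, A c /\ bucket c = b >]}.
have hT (t : T) : exists c, A c /\ bucket c = val t by apply/asboolP; exact: (valP t).
have [x xT] := choice hT.
exists T, x; split; first by move=> t; have [] := xT t.
move=> c Ac.
have cT : `[< exists c', A c' /\ bucket c' = bucket c >] by apply/asboolP; exists c.
exists (exist _ (bucket c) cT : T).
set t : T := exist _ _ _; have [Ax /= bx] := xT t.
have q0 : 0 < q%:R :> R by rewrite ltr0n.
have range (d : 'rV[R]_n) i : A d -> 0 <= (d 0 i + 1) * q%:R /\
    (Num.truncn ((d 0 i + 1) * q%:R)%R < (2 * q).+1)%N.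
  move=> /A1 d1; have := le_trans (coord_le_l2norm d i) d1.
  rewrite ler_norml => /andP[d2 d3].
  have h0 : 0 <= (d 0 i + 1) * q%:R by rewrite mulr_ge0 ?(ltW q0)//; lra.
  split=> //; rewrite ltnS -(ler_nat R).
  have h1 : (Num.truncn ((d 0 i + 1) * q%:R))%:R <= (d 0 i + 1) * q%:R by rewrite truncn_le.
  apply: le_trans h1 _; rewrite natrM ler_wpM2r ?(ltW q0)//; lra.
have close i : `|c 0 i - x t 0 i| <= q%:R^-1.
  have [c0 cq] := range c i Ac; have [x0 xq] := range (x t) i Ax.
  have : nat_of_ord (bucket (x t) i) = nat_of_ord (bucket c i) by rewrite bx.
  rewrite !ffunE !inordK// => e.
  have := truncn_itv c0; have := truncn_itv x0; rewrite e => /andP[h1 h2] /andP[h3 h4].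
  rewrite -(ler_pM2r q0) mulVf ?gt_eqF// -[q%:R in X in X <= _]ger0_norm ?(ltW q0)// -normrM.
  by rewrite ler_norml; move: h1 h2 h3 h4; rewrite -natr1; lra.
rewrite l2norm_le ?(ltW eta0)//.
have n0 : 0 < n.+1%:R :> R by rewrite ltr0n.
have qe : q%:R^-1 <= eta / n.+1%:R.
  by rewrite -[leRHS]invf_div lef_pV2 ?posrE ?divr_gt0// ltW.
apply: (@le_trans _ _ (\sum_(i < n) (eta / n.+1%:R) ^+ 2)).
  apply: ler_sum => i _; rewrite -expr2 !mxE -real_normK ?num_real//.
  by rewrite lerXn2r ?nnegrE ?divr_ge0 ?(ltW eta0)//; exact: le_trans (close i) qe.
rewrite sumr_const card_ord -[_ *+ n]mulr_natl exprMn mulrCA.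
rewrite -[leRHS]mulr1 ler_wpM2l ?sqr_ge0// exprVn ler_pdivrMr ?exprn_gt0// mul1r.
by rewrite -natrX ler_nat (leq_trans (leqnSn n))// -[X in (X <= _)%N]expn1 leq_pexp2l.
Qed.

End net.

Lemma le_sqrt_of_sqr {R : realType} (a b : R) : a ^+ 2 <= b -> a <= Num.sqrt b.
Proof.
move=> ab; apply: le_trans (ler_norm a) _.
by rewrite -sqrtr_sqr ler_sqrt// (le_trans (sqr_ge0 a)).
Qed.

Section embedding.
Context {R : realType} {n m : nat}.
Variables (S : set 'rV[R]_n) (e W : R).
Hypothesis e0 : 0 < e < 1.
Hypothesis S1 : forall s, S s -> l2norm s = 1.
Hypothesis SW : forall (T : finType) (x : T -> 'rV[R]_n),
  (forall t, cone S 1 (x t)) -> forall p, rad (spread (2 ^ p) (fun t i => x t 0 i)) <= W.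
Hypothesis m0 : (0 < m)%N.
Hypothesis mW : (1000 * W / e) ^+ 2 <= m%:R.

Definition sign_matrix (s : signs ('I_m * 'I_n)%type) : 'M[R]_(n, m) :=
  \matrix_(j, i) (sgn (s (i, j)) / Num.sqrt m%:R).

Let sm0 : 0 < Num.sqrt m%:R :> R.
Proof. by rewrite sqrtr_gt0 ltr0n. Qed.

Lemma sign_matrixE s (c : 'rV[R]_n) i :
  (c *m sign_matrix s) 0 i = mxapply (sgn_entries s) (fun j => c 0 j) i / Num.sqrt m%:R.
Proof.
rewrite mxE /mxapply mulr_suml; apply: eq_bigr => j _; rewrite mxE /sgn_entries; ring.
Qed.

Lemma sign_matrix_sqr s (c : 'rV[R]_n) :
  l2norm (c *m sign_matrix s) ^+ 2 = (\sum_i mxapply (sgn_entries s) (fun j => c 0 j) i ^+ 2) /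
    m%:R.
Proof.
rewrite l2norm_sqr mulr_suml; apply: eq_bigr => i _.
by rewrite -expr2 sign_matrixE exprMn exprVn sqr_sqrtr.
Qed.

(** A crude bound, valid for every realisation; it only serves to pass from a fine net to all
    points. *)
Lemma sign_matrix_norm s (c : 'rV[R]_n) :
  l2norm (c *m sign_matrix s) <= n.+1%:R * l2norm c.
Proof.
rewrite -(ler_pXn2r (n := 2))// ?nnegrE ?mulr_ge0 ?l2norm_ge0//.
rewrite sign_matrix_sqr ler_pdivrMr ?ltr0n//.
apply: (@le_trans _ _ (\sum_(i < m) n%:R * l2norm c ^+ 2)).
  apply: ler_sum => i _.
  pose w : 'rV[R]_n := \row_j sgn (s (i, j)).
  have -> : mxapply (sgn_entries s) (fun j => c 0 j) i = dotr w c.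
    by apply: eq_bigr => j _; rewrite mxE.
  have ww : l2norm w ^+ 2 = n%:R.
    rewrite l2norm_sqr /dotr (eq_bigr (fun=> 1)) ?sumr_const ?card_ord//.
    by move=> j _; rewrite mxE sgn_sqr.
  rewrite -ww -exprMn -real_normK ?num_real// lerXn2r ?nnegrE ?mulr_ge0 ?l2norm_ge0//.
  exact: cauchy_schwarz_norm.
rewrite sumr_const card_ord -[_ *+ m]mulr_natr exprMn ler_wpM2r// ler_wpM2r ?sqr_ge0//.
by rewrite -natrX ler_nat (leq_trans (leqnSn n))// -[X in (X <= _)%N]expn1 leq_pexp2l.
Qed.

(** Some realisation is no worse than the average, and the constant 1000 makes the average
    deviation at most (e / 2) m on a net of the vectors of norm at least e.  The mesh [eta] is
    fine enough for the other half of e to absorb the passage to all vectors. *)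
Lemma sign_embedding : exists A : 'M[R]_(n, m),
  forall c, cone S 1 c -> e <= l2norm c ->
    `|l2norm (c *m A) ^+ 2 - l2norm c ^+ 2| <= e * l2norm c.
Proof.
case/andP: e0 => ep e1.
pose C := [set c : 'rV[R]_n | cone S 1 c /\ e <= l2norm c].
have C1 c : C c -> l2norm c <= 1 by move=> [/(cone_norm S1)].
pose k : R := n.+1%:R.
have k1 : 1 <= k by rewrite ler1n.
(* Chosen so that (e / 2 + 2 k^2 + 2) eta <= e^2 / 2, with k a bound for the operator norm. *)
pose eta := e ^+ 2 / (4 * k ^+ 2 + 6).
have d0 : 0 < 4 * k ^+ 2 + 6 by have := sqr_ge0 k; lra.
have eta0 : 0 < eta by rewrite divr_gt0 ?exprn_gt0.
have etaE : eta * (4 * k ^+ 2 + 6) = e ^+ 2 by rewrite divfK// gt_eqF.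
clearbody eta.
have [T [x [xC net]]] := finite_net C1 eta0.
pose r t := l2norm (x t).
have rt t : e <= r t by have [] := xC t.
have r0 t : 0 < r t by exact: lt_le_trans (rt t).
pose y t j := x t 0 j.
have yr t : \sum_j y t j ^+ 2 = r t ^+ 2.
  by rewrite l2norm_sqr; apply: eq_bigr => j _; rewrite expr2.
have yW p : rad (spread (2 ^ p) y) <= W.
  by apply: SW => t; have [] := xC t.
have W0 : 0 <= W := width_bound_ge0 yW.
have hD := avg_max_norm_dev_le (m := m) r0 yr yW ep rt.
have [s hs] := exists_le_avg (max_norm_dev y r) (signs_gt0 ('I_m * 'I_n)%type).
have {hD}hs := le_trans hs hD.
have We : 1000 * W <= e * Num.sqrt m%:R.
  have : 1000 * W / e <= Num.sqrt m%:R by exact: le_sqrt_of_sqr.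
  by rewrite (ler_pdivrMr _ _ ep) [e * _]mulrC.
have mm : Num.sqrt m%:R ^+ 2 = m%:R :> R by rewrite sqr_sqrtr.
have dev_le t : `|norm_dev y r s t| <= e / 2 * m%:R.
  apply: le_trans (le_pmax (fun t => `|norm_dev y r s t|) t) _; apply: le_trans hs _.
  move: We mm (ltW sm0); pose q : R := Num.sqrt m%:R; rewrite -/q => We mm q0.
  have h1 : 192 * W * q <= 192 / 1000 * e * m%:R.
    by rewrite -mm; have := ler_wpM2r q0 We; lra.
  have h2 : 2304 * W ^+ 2 / e <= 2304 / (1000 * 1000) * e * m%:R.
    rewrite (ler_pdivrMr _ _ ep) -mm.
    have p1 := ler_wpM2r W0 We.
    have p2 := ler_wpM2l (mulr_ge0 (ltW ep) q0) We.
    by move: p1 p2; lra.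
  have h3 : 0 <= e * m%:R by exact: mulr_ge0 (ltW ep) (ler0n _ _).
  by move: h1 h2 h3; lra.
exists (sign_matrix s) => c cC ce.
have Cc : C c by [].
have [t ct] := net c Cc.
have mp : 0 < m%:R :> R by rewrite ltr0n.
have c1 := C1 c Cc; have x1 := C1 _ (xC t).
have g1 : `|l2norm (x t *m sign_matrix s) ^+ 2 - r t ^+ 2| <= e / 2 * r t.
  rewrite sign_matrix_sqr.
  have -> : (\sum_i mxapply (sgn_entries s) (fun j => x t 0 j) i ^+ 2) / m%:R - r t ^+ 2 =
    norm_dev y r s t * (r t / m%:R).
    by rewrite /norm_dev /y; field; rewrite !gt_eqF.
  have rm0 : 0 <= r t / m%:R by apply: divr_ge0; rewrite ?ler0n ?(ltW (r0 t)).
  rewrite normrM (ger0_norm rm0).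
  apply: (@le_trans _ _ (e / 2 * m%:R * (r t / m%:R))); first by rewrite ler_wpM2r.
  by rewrite le_eqVlt; apply/orP; left; apply/eqP; field; rewrite gt_eqF.
have diff p (a b : 'rV[R]_p) : l2norm a ^+ 2 - l2norm b ^+ 2 = dotr (a - b) (a + b).
  by rewrite !l2norm_sqr dotrBl !dotrDr (dotrC b a); ring.
have g2 : `|l2norm (c *m sign_matrix s) ^+ 2 - l2norm (x t *m sign_matrix s) ^+ 2| <= 2 * k ^+
  2 * eta.
  rewrite diff -mulmxBl -mulmxDl; apply: le_trans (cauchy_schwarz_norm _ _) _.
  apply: (@le_trans _ _ ((k * eta) * (k * 2))); last by rewrite le_eqVlt; apply/orP; left;
    apply/eqP; ring.
  apply: ler_pM; rewrite ?l2norm_ge0//.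
    by apply: le_trans (sign_matrix_norm _ _) _; apply: ler_wpM2l.
  apply: le_trans (sign_matrix_norm _ _) _; apply: ler_wpM2l => //.
  apply: le_trans (l2norm_triangle _ _) _; move: c1 x1; lra.
have g3 : `|l2norm c ^+ 2 - r t ^+ 2| <= 2 * eta.
  rewrite diff; apply: le_trans (cauchy_schwarz_norm _ _) _.
  rewrite mulrC; apply: ler_pM; rewrite ?l2norm_ge0//.
  apply: le_trans (l2norm_triangle _ _) _; move: c1 x1; lra.
have g4 : r t <= l2norm c + eta.
  have -> : r t = l2norm (c + (x t - c)) by rewrite addrC subrK.
  by apply: le_trans (l2norm_triangle _ _) _; rewrite lerD2l l2normB.
have g5 : e / 2 * r t <= e / 2 * (l2norm c + eta).
  by apply: ler_wpM2l => //; move: ep; lra.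
have g6 : e / 2 * eta + 2 * k ^+ 2 * eta + 2 * eta <= e / 2 * l2norm c.
  apply: (@le_trans _ _ (e ^+ 2 / 2)).
    have := ler_wpM2r (ltW eta0) (ltW e1); move: etaE; lra.
  by have := ler_wpM2l (ltW ep) ce; lra.
move: g1 g2 g3; rewrite !ler_norml => /andP[a1 a2] /andP[a3 a4] /andP[a5 a6].
by apply/andP; split; move: g5 g6; lra.
Qed.

End embedding.

(** * Terminal extension *)

Section row_mx_norm.
Context {R : realType}.

Lemma l2normB_sqr p (u v : 'rV[R]_p) :
  l2norm (u - v) ^+ 2 = l2norm u ^+ 2 - 2 * dotr u v + l2norm v ^+ 2.
Proof. by rewrite !l2norm_sqr dotrBl !dotrBr (dotrC v u); ring. Qed.

Lemma l2norm_row_mx p q (u : 'rV[R]_p) (v : 'rV[R]_q) :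
  l2norm (row_mx u v) ^+ 2 = l2norm u ^+ 2 + l2norm v ^+ 2.
Proof.
rewrite !l2norm_sqr /dotr big_split_ord/=.
by congr (_ + _); apply: eq_bigr => i _; rewrite ?row_mxEl ?row_mxEr.
Qed.

Lemma l2norm_const1 (a : R) : l2norm (const_mx a : 'rV[R]_1) ^+ 2 = a ^+ 2.
Proof. by rewrite l2norm_sqr /dotr big_ord1 !mxE expr2. Qed.

Lemma mulmx_bounded n m (A : 'M[R]_(n, m)) :
  exists2 B, 0 <= B & forall z : 'rV[R]_n, l2norm (z *m A) <= B * l2norm z.
Proof.
exists (\sum_j l2norm (row j A)); first by apply: sumr_ge0 => j _; exact: l2norm_ge0.
move=> z; rewrite mulmx_sum_row mulr_suml.
apply: (@le_trans _ _ (\sum_j l2norm (z 0 j *: row j A))).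
  elim/big_ind2: _ => [|a b c d ab cd|//]; first by rewrite l2norm0.
  by apply: le_trans (l2norm_triangle _ _) _; rewrite lerD.
apply: ler_sum => j _; rewrite l2normZ mulrC ler_wpM2l ?l2norm_ge0//.
exact: coord_le_l2norm.
Qed.

End row_mx_norm.

(** The unit secants before taking the closure: differences of points of M suffice for the
    embedding, and their width is at most that of the closure. *)
Definition secants {R : realType} {n : nat} (M : set 'rV[R]_n) : set 'rV[R]_n :=
  [set z | exists x y, [/\ M x, M y, x <> y & z = (l2norm (x - y))^-1 *: (x - y)]].

Section secants.
Context {R : realType} {n : nat} (M : set 'rV[R]_n).

Lemma secants_norm s : secants M s -> l2norm s = 1.
Proof.
move=> [x [y [_ _ xy ->]]].
have d0 : 0 < l2norm (x - y) by apply: l2norm_gt0; rewrite subr_eq0; apply/eqP.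
by rewrite l2normZ gtr0_norm ?invr_gt0// mulVf// gt_eqF.
Qed.

Lemma secantsN s : secants M s -> secants M (- s).
Proof.
move=> [x [y [Mx My xy ->]]]; exists y, x; split => //; first by move=> yx; exact: xy.
by rewrite l2normB -scalerN opprB.
Qed.

Lemma secants_unit x y : M x -> M y -> x <> y ->
  exists2 s, secants M s & x - y = l2norm (x - y) *: s.
Proof.
move=> Mx My xy; exists ((l2norm (x - y))^-1 *: (x - y)); first by exists x, y.
rewrite scalerA divff ?scale1r// gt_eqF//; apply: l2norm_gt0.
by rewrite subr_eq0; apply/eqP.
Qed.

End secants.

Section terminal.
Context {R : realType} {n m : nat}.
Variables (M : set 'rV[R]_n) (A : 'M[R]_(n, m)) (e : R) (x0 : 'rV[R]_n).
Hypothesis e0 : 0 < e < 1.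
Hypothesis Mx0 : M x0.
Hypothesis embA : forall c, cone (secants M) 1 c -> e <= l2norm c ->
    `|l2norm (c *m A) ^+ 2 - l2norm c ^+ 2| <= e * l2norm c.

Let S := secants M.

(** For |c| >= e, |c A|^2 >= |c|^2 - e |c| >= (|c| - e)^2; smaller c are covered by the term e. *)
Lemma cone_secants_le c : cone S 1 c -> l2norm c <= l2norm (c *m A) + e.
Proof.
case/andP: e0 => ep e1.
move=> cc; have a0 := l2norm_ge0 (c *m A); have c0 := l2norm_ge0 c.
have [ce|ec] := leP e (l2norm c); last by apply: le_trans (ltW ec) _; rewrite lerDr.
have := embA cc ce; rewrite ler_norml => /andP[h _].
rewrite leNgt; apply/negP => lt.
have : l2norm (c *m A) ^+ 2 < (l2norm c - e) ^+ 2.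
  by rewrite ltrXn2r ?nnegrE// ?subr_ge0//; move: lt; lra.
have := ler_wpM2l (ltW ep) ce; move: h; lra.
Qed.

Lemma secants_sqr s : S s -> `|l2norm (s *m A) ^+ 2 - 1| <= e.
Proof.
case/andP: e0 => ep e1.
move=> Ss; have s1 := secants_norm Ss.
have := embA (cone_single Ss); rewrite s1 expr1n mulr1; apply; exact: ltW.
Qed.

Lemma secants_sqr2 s : S s -> l2norm (s *m A) ^+ 2 <= 2.
Proof.
case/andP: e0 => ep e1.
by move=> /secants_sqr; rewrite ler_norml => /andP[_]; lra.
Qed.

Lemma distance_sqr x y : M x -> M y ->
  `|l2norm ((x - y) *m A) ^+ 2 - l2norm (x - y) ^+ 2| <= e * l2norm (x - y) ^+ 2.
Proof.
move=> Mx My; have [->|/eqP xy] := eqVneq x y.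
  by rewrite subrr mul0mx !l2norm0 expr0n subrr normr0 mulr0.
have [s Ss ->] := secants_unit Mx My xy.
set d := l2norm (x - y).
rewrite -scalemxAl !l2normZ (secants_norm Ss) mulr1 exprMn.
rewrite -[X in _ - X]mulr1 -mulrBr normrM mulrC (ger0_norm (sqr_ge0 _)).
by rewrite ler_wpM2r ?sqr_ge0// secants_sqr.
Qed.

Definition adherent u := forall d, 0 < d -> exists2 y, M y & l2norm (u - y) <= d.

(** By continuity, from points of M close to u. *)
Lemma distance_sqr_adherent u x : adherent u -> M x ->
  `|l2norm ((u - x) *m A) ^+ 2 - l2norm (u - x) ^+ 2| <= e * l2norm (u - x) ^+ 2.
Proof.
case/andP: e0 => ep e1 adu Mx.
have [B B0 hB] := mulmx_bounded A.
set a := l2norm ((u - x) *m A); set d := l2norm (u - x).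
have a0 : 0 <= a by exact: l2norm_ge0.
have d0 : 0 <= d by exact: l2norm_ge0.
have ep1 : 0 <= 1 + e by lra.
have em1 : 0 <= 1 - e by lra.
have near y : M y -> [/\ Num.sqrt (1 - e) * l2norm (y - x) <= l2norm ((y - x) *m A),
    l2norm ((y - x) *m A) <= Num.sqrt (1 + e) * l2norm (y - x),
    `|a - l2norm ((y - x) *m A)| <= B * l2norm (u - y) &
    `|d - l2norm (y - x)| <= l2norm (u - y)].
  move=> My; have := distance_sqr My Mx; rewrite ler_norml => /andP[h1 h2].
  have k1 := l2norm_ge0 ((y - x) *m A); have k2 := l2norm_ge0 (y - x).
  have s1 : 0 <= Num.sqrt (1 - e) by exact: sqrtr_ge0.
  have s2 : 0 <= Num.sqrt (1 + e) by exact: sqrtr_ge0.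
  have rev p (b c : 'rV[R]_p) : `|l2norm b - l2norm c| <= l2norm (b - c).
    have t1 := l2norm_triangle (b - c) c; have t2 := l2norm_triangle (c - b) b.
    rewrite !subrK in t1 t2; rewrite (l2normB c b) in t2.
    by rewrite ler_norml; apply/andP; split; move: t1 t2; lra.
  split.
  - by rewrite -(ler_pXn2r (n := 2))// ?nnegrE ?mulr_ge0// exprMn (sqr_sqrtr em1); lra.
  - by rewrite -(ler_pXn2r (n := 2))// ?nnegrE ?mulr_ge0// exprMn (sqr_sqrtr ep1); lra.
  - apply: le_trans (rev _ _ _) _; rewrite -mulmxBl.
    have -> : u - x - (y - x) = u - y by rewrite opprB addrA subrK.
    exact: hB.
  - apply: le_trans (rev _ _ _) _.
    by have -> : u - x - (y - x) = u - y by rewrite opprB addrA subrK.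
have s1 : 0 <= Num.sqrt (1 - e) <= 1.
  by rewrite sqrtr_ge0/= -[leRHS]sqrtr1 ler_sqrt//; lra.
have s2 : 0 <= Num.sqrt (1 + e) <= 2.
  rewrite sqrtr_ge0/= -(ler_pXn2r (n := 2))// ?nnegrE ?sqrtr_ge0// sqr_sqrtr//; lra.
have up : a <= Num.sqrt (1 + e) * d.
  apply/ler_addgt0Pr => z z0.
  have z1 : 0 < z / (B + 2) by rewrite divr_gt0//; move: B0; lra.
  have [y My uy] := adu _ z1; have [_ h2 h3 h4] := near y My.
  have zE : z / (B + 2) * (B + 2) = z by rewrite divfK// gt_eqF//; move: B0; lra.
  have uB := ler_wpM2l B0 uy.
  move: h3 h4; rewrite !ler_norml => /andP[_ h3] /andP[h4 _].
  case/andP: s2 => s20 s22.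
  have h5 := ler_wpM2l s20 (_ : l2norm (y - x) <= d + z / (B + 2)).
  have {}h5 := h5 ltac:(move: h4 uy; lra).
  have h6 := ler_wpM2r (ltW z1) s22.
  by move: h2 h3 h5 h6 uB zE; lra.
have lo : Num.sqrt (1 - e) * d <= a.
  apply/ler_addgt0Pr => z z0.
  have z1 : 0 < z / (B + 1) by rewrite divr_gt0//; move: B0; lra.
  have [y My uy] := adu _ z1; have [h2 _ h3 h4] := near y My.
  have zE : z / (B + 1) * (B + 1) = z by rewrite divfK// gt_eqF//; move: B0; lra.
  have uB := ler_wpM2l B0 uy.
  move: h3 h4; rewrite !ler_norml => /andP[h3 _] /andP[_ h4].
  case/andP: s1 => s10 s11.
  have h5 := ler_wpM2l s10 (_ : d <= l2norm (y - x) + z / (B + 1)).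
  have {}h5 := h5 ltac:(move: h4 uy; lra).
  have h6 := ler_wpM2r (ltW z1) s11.
  by move: h2 h3 h5 h6 uB zE; lra.
have up2 : a ^+ 2 <= (1 + e) * d ^+ 2.
  rewrite -[1 + e in leRHS]sqr_sqrtr// -exprMn lerXn2r// nnegrE mulr_ge0// sqrtr_ge0//.
have lo2 : (1 - e) * d ^+ 2 <= a ^+ 2.
  by rewrite -[1 - e in leLHS]sqr_sqrtr// -exprMn lerXn2r// nnegrE mulr_ge0// sqrtr_ge0.
by rewrite ler_norml; apply/andP; split; move: up2 lo2; lra.
Qed.

(** The infimum of the distances from u to M need not be attained, hence the factor 2. *)
Lemma quasi_nearest u : ~ adherent u ->
  exists2 xb, M xb & forall x, M x -> l2norm (u - xb) <= 2 * l2norm (u - x).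
Proof.
move=> /existsNP[d /not_implyP[d0 hd]].
have far y : M y -> d < l2norm (u - y).
  by move=> My; rewrite ltNge; apply/negP => h; apply: hd; exists y.
pose E := [set l2norm (u - y) | y in M].
have EI : has_inf E.
  split; first by exists (l2norm (u - x0)), x0.
  by exists d => _ [y My <-]; rewrite ltW// far.
have dI : d <= inf E.
  by apply: lb_le_inf; [exact: EI.1|move=> _ [y My <-]; rewrite ltW// far].
have I0 : 0 < inf E by exact: lt_le_trans dI.
have [_ [xb Mxb <-] hxb] := inf_adherent I0 EI.
exists xb => // x Mx.
have : inf E <= l2norm (u - x) by apply: ge_inf; [exact: EI.2|exists x].
by move: hxb; lra.
Qed.

(** The last coordinate restores the norm |v| that the functional u may have lost, so that
    only the cross term and the embedding error remain; with d = |u - x|, |v| <= 2 d and |y| <=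
      3 d they
    add up to (16 + 24 + 9) e d^2. *)
Lemma terminal_point u : exists fu : 'rV[R]_(m + 1),
  (M u -> fu = row_mx (u *m A) 0) /\
  forall x, M x -> `|l2norm (fu - row_mx (x *m A) 0) ^+ 2 - l2norm (u - x) ^+ 2|
     <= 50 * e * l2norm (u - x) ^+ 2.
Proof.
case/andP: (e0) => ep e1.
have [adu|nadu] := pselect (adherent u).
  exists (row_mx (u *m A) 0); split => // x Mx.
  rewrite opp_row_mx add_row_mx subr0 l2norm_row_mx l2norm0 expr0n addr0 -mulmxBl.
  apply: le_trans (distance_sqr_adherent adu Mx) _.
  by apply: ler_wpM2r; [exact: sqr_ge0|lra].
have [xb Mxb near] := quasi_nearest nadu.
pose v := u - xb.
have [w [wv ws]] := dual_functional e0 (@secants_norm _ _ M) (@secantsN _ _ M) secants_sqr2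
  cone_secants_le v.
pose q := Num.sqrt (Num.max 0 (l2norm v ^+ 2 - l2norm w ^+ 2)).
have qq : q ^+ 2 = Num.max 0 (l2norm v ^+ 2 - l2norm w ^+ 2).
  by rewrite sqr_sqrtr// le_max lexx.
exists (row_mx (xb *m A + w) (const_mx q)); split.
  by move=> Mu; exfalso; apply: nadu => d d0; exists u; rewrite ?subrr ?l2norm0// ltW.
move=> x Mx.
rewrite opp_row_mx add_row_mx subr0 l2norm_row_mx l2norm_const1 qq.
pose y := x - xb.
have -> : xb *m A + w - x *m A = w - y *m A.
  by rewrite /y mulmxBl opprB addrA [w + _]addrC.
have -> : u - x = v - y by rewrite /v /y opprB addrA subrK.
have d0 := l2norm_ge0 (v - y).
have v0 := l2norm_ge0 v; have y0 := l2norm_ge0 y.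
have vd : l2norm v <= 2 * l2norm (v - y).
  have -> : v - y = u - x by rewrite /v /y opprB addrA subrK.
  exact: near.
have yd : l2norm y <= 3 * l2norm (v - y).
  have := l2norm_triangle v (- (v - y)); rewrite l2normN subKr.
  by move: vd; lra.
have bilform : `|dotr v y - dotr w (y *m A)| <= 2 * e * l2norm v * l2norm y.
  rewrite /y; have [->|/eqP xx] := eqVneq x xb.
    by rewrite subrr mul0mx !dotr0r l2norm0 mulr0 subrr normr0.
  have [s Ss ->] := secants_unit Mx Mxb xx.
  rewrite -scalemxAl !dotrZr -mulrBr normrM l2normZ (secants_norm Ss) mulr1.
  rewrite (ger0_norm (l2norm_ge0 _)) mulrC.
  by rewrite ler_wpM2r ?normr_ge0 ?l2norm_ge0//; exact: ws.
have hy := distance_sqr Mx Mxb; rewrite -/y in hy.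
clear qq; clearbody q y v.
have e1' : l2norm (w - y *m A) ^+ 2 = l2norm w ^+ 2 - 2 * dotr w (y *m A) + l2norm (y *m A) ^+ 2.
  exact: l2normB_sqr.
have e2' : l2norm (v - y) ^+ 2 = l2norm v ^+ 2 - 2 * dotr v y + l2norm y ^+ 2.
  exact: l2normB_sqr.
have mid : l2norm v ^+ 2 <= l2norm w ^+ 2 + Num.max 0 (l2norm v ^+ 2 - l2norm w ^+ 2) <=
    (1 + 4 * e) * l2norm v ^+ 2.
  apply/andP; split.
    have : l2norm v ^+ 2 - l2norm w ^+ 2 <= Num.max 0 (l2norm v ^+ 2 - l2norm w ^+ 2).
      by rewrite le_max lexx orbT.
    lra.
  have : 0 <= e * l2norm v ^+ 2 by rewrite mulr_ge0 ?sqr_ge0// ltW.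
  by case: (leP 0 (l2norm v ^+ 2 - l2norm w ^+ 2)) => _; move: wv; lra.
set D := l2norm (v - y) in d0 vd yd e2' *.
have vv : e * l2norm v ^+ 2 <= e * (2 * D) ^+ 2.
  by rewrite ler_pM2l// lerXn2r ?nnegrE// mulr_ge0.
have yy : e * l2norm y ^+ 2 <= e * (3 * D) ^+ 2.
  by rewrite ler_pM2l// lerXn2r ?nnegrE// mulr_ge0.
have vy : e * (l2norm v * l2norm y) <= e * ((2 * D) * (3 * D)).
  by rewrite ler_pM2l//; apply: ler_pM.
have D2 : 0 <= e * D ^+ 2 by rewrite mulr_ge0 ?sqr_ge0// ltW.
rewrite e1'.
move: hy bilform; rewrite !ler_norml => /andP[hy1 hy2] /andP[b1 b2].
case/andP: mid => m1 m2.
apply/andP; split; move: e2' hy1 hy2 b1 b2 m1 m2 vv yy vy D2; lra.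
Qed.

End terminal.

(** * The theorem *)

Section width.
Context {R : realType} {n : nat} (M : set 'rV[R]_n).
Hypothesis M0 : unit_secants M !=set0.

Lemma secants_nonempty : exists s, secants M s.
Proof.
apply: contrapT => /forallNP h; case: M0 => z.
have -> : unit_secants M = set0; last by [].
rewrite /unit_secants -/(secants M) (_ : secants M = set0) ?closure0//.
by apply/seteqP; split => // s /h.
Qed.

Lemma sub_unit_secants s : secants M s -> unit_secants M s.
Proof. exact: subset_closure. Qed.

Definition support (v : 'rV[R]_n) : \bar R :=
  ereal_sup [set (dotr v z)%:E | z in unit_secants M].

Lemma support_ge0 v : (0 <= support v)%E.
Proof.
have [s Ss] := secants_nonempty.
have [vs|vs] := leP 0 (dotr v s).
  apply: (@le_trans _ _ (dotr v s)%:E); first by rewrite lee_fin.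
  by apply: ereal_sup_ubound; exists s => //; exact: sub_unit_secants.
apply: (@le_trans _ _ (dotr v (- s))%:E).
  by rewrite lee_fin dotrNr oppr_ge0 ltW.
apply: ereal_sup_ubound; exists (- s) => //; apply: sub_unit_secants.
exact: secantsN.
Qed.

Lemma cone_le_support v c : cone (secants M) 1 c -> ((dotr v c)%:E <= support v)%E.
Proof.
move=> cc; case E : (support v) (support_ge0 v) => [a| |//] a0; last by rewrite leey.
rewrite lee_fin -[a]mul1r; apply: cone_dot cc => s Ss; rewrite -lee_fin -E.
by apply: ereal_sup_ubound; exists s => //; exact: sub_unit_secants.
Qed.

Lemma rad_le_width (T : finType) (x : T -> 'rV[R]_n) p :
  (forall t, cone (secants M) 1 (x t)) ->
  ((gauss_tail * rad (spread (2 ^ p) (fun t i => x t 0 i)))%:E <=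
    gaussian_width (unit_secants M))%E.
Proof.
move=> xc; apply: rad_le_gaussian_width => v; last exact: support_ge0.
by move=> t; exact: cone_le_support.
Qed.

(** A single unit secant already has width of order 1; this absorbs the rounding of m. *)
Lemma width_ge : ((gauss_tail / 8)%:E <= gaussian_width (unit_secants M))%E.
Proof.
have [s Ss] := secants_nonempty.
apply: le_trans (@rad_le_width unit (fun=> s) 0 _); last first.
  by move=> _; exact: cone_single.
rewrite lee_fin ler_wpM2l ?(ltW gauss_tail_gt0)//.
pose a (_ : unit) i := s 0 i.
have h1 : rad a <= 2 * rad (spread (2 ^ 0) a) by exact: rad_le_spread.
have h2 : 1 / 4 <= rad a.
  have h3 := @khinchine R _ (fun i => s 0 i).
  have s1 := secants_norm Ss; rewrite /l2norm in s1; rewrite s1 in h3.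
  have h4 : avg (fun w : signs 'I_n => (sgn_sum w (fun i => s 0 i) + `|sgn_sum w (fun i => s 0
    i)|) / 2) <= rad a.
    apply: le_avg => w.
    have := le_pmax (fun t => sgn_sum w (a t)) tt; have := pmax_ge0 (fun t => sgn_sum w (a t)).
    rewrite /a; case: (ler0P (sgn_sum w (fun i => s 0 i))) => _; lra.
  rewrite avgZr avgD avg_sgn_sum in h4.
  by move: h3 h4; lra.
by move: h1 h2; rewrite /a; lra.
Qed.

End width.

Section complexify.
Context {R : realType} {n : nat}.

Lemma cl2norm_complex (u : 'rV[R]_n) : cl2norm (map_mx (real_complex R) u) = l2norm u.
Proof.
rewrite /cl2norm /l2norm; congr Num.sqrt; apply: eq_bigr => i _.
by rewrite mxE /= expr0n addr0 sqrtr_sqr real_normK// num_real.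
Qed.

End complexify.

Theorem theorem3p2 (R : realType) :
  exists c : R, 0 < c /\
    forall (N : nat) (M : set 'rV[R]_N) (eps : R),
      unit_secants M !=set0 ->
      0 < eps < 1 ->
      exists (m : nat) (f : 'rV[R]_N -> 'rV[R[i]]_m),
        (m%:R%:E <= c%:E * (gaussian_width (unit_secants M) / eps%:E) ^+ 2)%E /\
        forall x y : 'rV[R]_N, M x ->
          `|cl2norm (f x - f y) ^+ 2 - l2norm (x - y) ^+ 2|
            <= eps * l2norm (x - y) ^+ 2.
Proof.
have t0 : 0 < (gauss_tail : R) := gauss_tail_gt0.
pose c1 : R := (1000 * 50 / gauss_tail) ^+ 2.
pose c2 : R := 128 / gauss_tail ^+ 2.
have c20 : 0 < c2 by rewrite divr_gt0// exprn_gt0.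
have c10 : 0 <= c1 by exact: sqr_ge0.
exists (c1 + c2); split; first by rewrite ltr_wpDl.
move=> N M eps M0 /andP[eps0 eps1].
have wt := width_ge M0.
case wE : (gaussian_width _) wt => [w| |//] wt; last first.
  exists N, (fun x => map_mx (real_complex R) x); split.
    rewrite inver gt_eqF// gt0_mulye ?lte_fin ?invr_gt0//.
    by rewrite expe2 mulyy gt0_muley ?leey// lte_fin ltr_wpDl.
  move=> x y _; rewrite -map_mxB cl2norm_complex subrr normr0.
  by rewrite mulr_ge0 ?sqr_ge0// ltW.
rewrite lee_fin in wt.
have w0 : 0 < w by apply: lt_le_trans wt; rewrite divr_gt0.
(* 50 is the loss of the terminal extension. *)
pose e := eps / 50.
have e0 : 0 < e < 1 by rewrite /e; lra.
have ep : 0 < e by case/andP: e0.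
have [s0 [x0 [y0 [Mx0 _ _ _]]]] := secants_nonempty M0.
pose W := w / gauss_tail.
have SW (T : finType) (x : T -> 'rV[R]_N) :
    (forall t, cone (secants M) 1 (x t)) ->
    forall p, rad (spread (2 ^ p) (fun t i => x t 0 i)) <= W.
  move=> xc p; have := rad_le_width M0 p xc.
  by rewrite wE lee_fin /W ler_pdivlMr// mulrC.
pose m := (Num.truncn ((1000 * W / e) ^+ 2)).+1.
have mW : (1000 * W / e) ^+ 2 <= m%:R by rewrite ltW// truncnS_gt.
have [A hA] := sign_embedding e0 (@secants_norm _ _ M) SW (ltn0Sn _ : (0 < m)%N) mW.
have /choice[g hg] := terminal_point e0 Mx0 hA.
exists (m + 1)%N, (fun u => map_mx (real_complex R) (g u)); split.
  rewrite inver gt_eqF// -EFinM lee_fin natrD.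
  have h1 : m%:R <= (1000 * W / e) ^+ 2 + 1.
    rewrite /m -natr1 lerD2r truncn_le; exact: sqr_ge0.
  have h2 : (1000 * W / e) ^+ 2 = c1 * (w / eps * (w / eps)).
    by rewrite /c1 /W /e; field; rewrite !gt_eqF.
  have h3 : 2 <= c2 * (w / eps * (w / eps)).
    have we : gauss_tail / 8 <= w / eps.
      apply: le_trans wt _; rewrite ler_pdivlMr//.
      by rewrite -[leRHS]mulr1 ler_wpM2l ?(ltW w0)// ltW.
    have te : 0 <= gauss_tail / 8 :> R by rewrite divr_ge0// ltW.
    have := ler_pM te te we we.
    rewrite /c2 => /(ler_wpM2l (ltW c20)); rewrite /c2; apply: le_trans.
    by rewrite le_eqVlt; apply/orP; left; apply/eqP; field; rewrite gt_eqF.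
  by move: h1 h2 h3; lra.
move=> x y Mx; rewrite -map_mxB cl2norm_complex.
have [gx _] := hg x; have [_ /(_ x Mx)] := hg y.
rewrite (gx Mx) (l2normB (g y)) (l2normB y).
by have -> : 50 * e = eps by rewrite /e; field.
Qed.
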